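(* Let $E$ be an arbitrary directed graph and $K$ an arbitrary field. Let $C$ be the set of all simple closed paths in $E$, where each simple closed path and all its rotations are counted as one. Let $D$ be a set containing exactly one irrational path from each tail-equivalence class of irrational paths, and containing all singular vertices of $E$. Then the set $$\{V_{[x]}\mid x\in D\}\ \cup\ \{V^f_{[c^\infty]}\mid c\in C,\ f\text{ is a monic irreducible polynomial in }K[t],\ f\ne t\}$$ forms a full list (up to isomorphism) of pairwise non-isomorphic spectral simple $L_K(E)$-modules. In particular, up to isomorphism, all finite-dimensional simple modules over $L_K(E)$ are: (i) $V_{[x]}$, where $x$ is a singular vertex such that $\{\mu\in F(E)\mid r(\mu)=x\}$ is finite; (ii) $V^f_{[c^\infty]}$, where $f$ is a monic irreducible polynomial in $K[t]$, $f\ne t$, and $c\in C$ is a maximal cycle such that $\{\mu\in F(E)\mid r(\mu)=s(c)\}$ is finite.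
   Context: Graphs. $E=(E^0,E^1,s,r)$ is a directed graph (vertices, edges, source and range maps; any cardinalities). A vertex is singular if it is a sink (emits no edges) or an infinite emitter (emits infinitely many edges). A finite path is $\mu=e_1\cdots e_n$ with $r(e_i)=s(e_{i+1})$, of length $|\mu|=n$, with $s(\mu)=s(e_1)$, $r(\mu)=r(e_n)$; vertices are paths of length $0$; $F(E)$ is the set of all finite paths (including those of length $0$). $E^\infty$ is the set of infinite paths $e_1e_2\cdots$. A closed path is a path $\mu$ of positive length with $s(\mu)=r(\mu)$; it is simple if it is not $c^n$ for a closed path $c$ and an integer $n\ge2$; it is a cycle if it does not pass through any of its vertices twice. The rotations of $e_1\cdots e_n$ are the paths $e_{i+1}\cdots e_ne_1\cdots e_i$; $c^\infty=ccc\cdots$. A cycle $c$ is maximal if there is no finite path from $s(c')$ to $s(c)$ for any other cycle $c'$ (a cycle and its rotations being counted as one). Put $\partial E=E^\infty\cup\{\mu\in F(E): r(\mu)\text{ is singular}\}$. For $x,y\in\partial E$ and $k\in\mathbb Z$, $x\sim_ky$ means $x=\mu p$, $y=\nu p$ for some $\mu,\nu\in F(E)$, $p\in\partial E$ with $r(\mu)=r(\nu)=s(p)$ and $|\mu|-|\nu|=k$. Tail-equivalence means $\sim_k$ for some $k$; $[x]$ is the class of $x$. An infinite path is rational if it is tail-equivalent to $c^\infty$ for some closed path $c$, and irrational otherwise. Leavitt path algebra. $L_K(E)$ is the $K$-algebra generated by $\{v,e,e^*\mid v\in E^0,e\in E^1\}$ with relations $vw=\delta_{v,w}v$; $s(e)e=e=er(e)$;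 $r(e)e^*=e^*=e^*s(e)$; $e^*f=\delta_{e,f}r(e)$; $v=\sum_{s(e)=v}ee^*$ for every non-singular $v$. With $(e_1\cdots e_n)^*=e_n^*\cdots e_1^*$ and $v^*=v$, it is spanned by the elements $\mu\nu^*$ with $\mu,\nu\in F(E)$, $r(\mu)=r(\nu)$. Modules are left and unital ($AM=M$). Modules $V_{[x]}$ and $V^f_{[c^\infty]}$. $V_{[x]}$ is the $K$-space with basis $[x]$ and action $(\mu\nu^* ).p=\mu p'$ if $p=\nu p'$, and $0$ otherwise. For a field $F$ and $\mathbf a=(a_e)\in(F^* )^{E^1}$, let $\sigma_{\mathbf a}$ be the automorphism of $L_F(E)$ with $v\mapsto v$, $e\mapsto a_ee$, $e^*\mapsto a_e^{-1}e^*$; $V^{\mathbf a}_{[x]}$ is the $L_F(E)$-module $V_{[x]}$ (constructed over $F$) with twisted action $(\eta,p)\mapsto\sigma_{\mathbf a}(\eta).p$. For a simple closed path $c=e_1\cdots e_n$ and a monic irreducible $f\in K[t]$, $f\ne t$, let $K'=K[t,t^{-1}]/(f)$ and let $\mathbf t\in(K'^* )^{E^1}$ have $\overline t$ (the class of $t$) in the $e_1$-coordinate and $1$ in all other coordinates; $V^f_{[c^\infty]}$ is the $L_{K'}(E)$-module $V^{\mathbf t}_{[c^\infty]}$ with scalars restricted to $L_K(E)$. Spectral modules. $\mathcal G_E=\{(x,k,y)\in\partial E\times\mathbb Z\times\partial E: x\sim_ky\}$ is the graph groupoid, with $(x,k,y)(y,l,z)=(x,k+l,z)$, $(x,k,y)^{-1}=(y,-k,x)$,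 domain $d(x,k,y)=y$ and codomain $c(x,k,y)=x$ (units $(x,0,x)$ are identified with $x\in\partial E$). For $r(\mu)=r(\nu)$ let $Z(\mu,\nu)=\{(\mu p,|\mu|-|\nu|,\nu p): p\in\partial E, s(p)=r(\mu)\}$. The sets $Z(\mu,\nu)\setminus\bigcup_{e\in F}Z(\mu e,\nu e)$, with $F\subseteq s^{-1}(r(\mu))$ finite, form a basis of compact open bisections (open sets on which $d$ and $c$ are homeomorphisms onto open subsets of the unit space) for a topology making $\mathcal G_E$ a Hausdorff ample groupoid. The Steinberg algebra $A_K(\mathcal G_E)$ (the $K$-span of the characteristic functions $\mathbf 1_U$ of compact open bisections $U$, with convolution product, so $\mathbf 1_U*\mathbf 1_V=\mathbf 1_{UV}$) is isomorphic to $L_K(E)$ via $\mu\nu^*\mapsto\mathbf 1_{Z(\mu,\nu)}$, and modules over the two algebras are identified. For $x\in\partial E$, $\mathrm{Res}_x(M)=\bigcap_U\mathbf 1_UM$, where $U$ ranges over the compact open subsets of the unit space $\partial E$ containing $x$. A nonzero module $M$ is spectral if $\mathrm{Res}_x(M)\ne0$ for some $x\in\partial E$.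
   Formalization: In V^f the factor t-bar is attached only to the first position of c, not to every occurrence of the edge e_1 in c (same module if e_1 occurs once); in (ii) the finite set is the paths μ with r(μ)=s(c) that do not end with c, as the set stated contains all powers of c. *)

(* Defs.v *)
From HB Require Import structures.
From mathcomp Require Import all_boot all_order all_algebra all_field.
From mathcomp Require Import finmap.
From mathcomp Require Import all_classical topology numfun.
From mathcomp.multinomials Require Import monalg.

Set Implicit Arguments.
Unset Strict Implicit.
Unset Printing Implicit Defensive.

Import GRing.Theory.

Local Open Scope classical_set_scope.
Local Open Scope ring_scope.

Record digraph := Digraph {
  vertex : choiceType;
  edge : choiceType;
  src : edge -> vertex;
  rng : edge -> vertex
}.

Section Paths.
Variable E : digraph.

Definition sink (v : vertex E) := forall e : edge E, src e <> v.
Definition infinite_emitter (v : vertex E) :=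
  infinite_set [set e : edge E | src e = v].
Definition singular (v : vertex E) := sink v \/ infinite_emitter v.

Fixpoint walk (v : vertex E) (p : seq (edge E)) : bool :=
  if p is e :: q then (src e == v) && walk (rng e) q else true.

(* [fsrc] is stored so that vertices are the paths of length 0 *)
Record finpath := FPath {
  fsrc : vertex E;
  fedges : seq (edge E);
  fwalk : walk fsrc fedges
}.

Definition frng (mu : finpath) : vertex E :=
  last (fsrc mu) (map (@rng E) (fedges mu)).
Definition flen (mu : finpath) : nat := size (fedges mu).
Definition fvert (v : vertex E) : finpath := @FPath v [::] isT.

Lemma walk1 (e : edge E) : walk (src e) [:: e].
Proof. by rewrite /= eqxx. Qed.
Definition fedge (e : edge E) : finpath := FPath (walk1 e).

Lemma walk_cat v p q :
  walk v (p ++ q) = walk v p && walk (last v (map (@rng E) p)) q.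
Proof. by elim: p v => //= e p IH v; rewrite IH andbA. Qed.

Lemma fcat_walk (mu nu : finpath) :
  frng mu = fsrc nu -> walk (fsrc mu) (fedges mu ++ fedges nu).
Proof. by move=> h; rewrite walk_cat fwalk -/(frng mu) h fwalk. Qed.
Definition fcat (mu nu : finpath) (h : frng mu = fsrc nu) : finpath :=
  FPath (fcat_walk h).

Record ipath := IPath {
  iedge : nat -> edge E;
  iwalk : forall i, rng (iedge i) = src (iedge i.+1)
}.

Inductive bpath :=
| BInf of ipath
| BFin (mu : finpath) of singular (frng mu).

Definition bsrc (x : bpath) : vertex E :=
  match x with BInf y => src (iedge y 0) | BFin mu _ => fsrc mu end.

Definition bedge (x : bpath) (i : nat) : option (edge E) :=
  match x with BInf y => Some (iedge y i) | BFin mu _ => onth (fedges mu) i end.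

(* [concat mu p x] says that x is the path mu p; a boundary path is determined
   by its source and its edges, see [bpath_ext] *)
Definition concat (mu : finpath) (p x : bpath) : Prop :=
  [/\ frng mu = bsrc p, bsrc x = fsrc mu &
      forall i, bedge x i =
        if (i < flen mu)%N then onth (fedges mu) i else bedge p (i - flen mu)].

Definition tail_deg (x : bpath) (k : int) (y : bpath) : Prop :=
  exists mu nu p, [/\ concat mu p x, concat nu p y &
    (flen mu : int) - (flen nu : int) = k].

Definition tail_equiv (x y : bpath) : Prop := exists k, tail_deg x k y.

Lemma finpath_ext (mu nu : finpath) :
  fsrc mu = fsrc nu -> fedges mu = fedges nu -> mu = nu.
Proof.
case: mu nu => [v p hp] [w q hq] /= vw pq.
by subst w q; rewrite (bool_irrelevance hp hq).
Qed.

Lemma bpath_ext (x y : bpath) : bsrc x = bsrc y -> bedge x =1 bedge y -> x = y.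
Proof.
case: x y => [[x hx]|mu hmu] [[y hy]|nu hnu] /= hs he.
- have xy : x = y by apply: funext => i; have [] := he i.
  by subst y; rewrite (Prop_irrelevance hx hy).
- by have /= := he (size (fedges nu)); rewrite onth_default.
- by have /= := he (size (fedges mu)); rewrite onth_default.
- have mn : mu = nu by apply: finpath_ext => //; exact: eq_from_onth.
  by subst nu; rewrite (Prop_irrelevance hmu hnu).
Qed.

Lemma concat_fun mu p x y : concat mu p x -> concat mu p y -> x = y.
Proof.
move=> [_ sx ex] [_ sy ey]; apply: bpath_ext; first by rewrite sx sy.
by move=> i; rewrite ex ey.
Qed.

Lemma concat_inj mu p q x : concat mu p x -> concat mu q x -> p = q.
Proof.
move=> [rp sx ep] [rq _ eq]; apply: bpath_ext; first by rewrite -rp -rq.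
move=> i; have := ep (flen mu + i)%N; rewrite eq.
by rewrite ltnNge leq_addr /= addKn.
Qed.

Lemma concat_vert x : concat (fvert (bsrc x)) x x.
Proof. by split => // i; rewrite /flen /= ?ltn0 ?subn0. Qed.

Lemma concat_vertE v p x : concat (fvert v) p x <-> p = x /\ bsrc x = v.
Proof.
split=> [[/= vp sx ex]|[-> <-]]; last exact: concat_vert.
split=> //; apply: bpath_ext; first by rewrite -vp sx.
by move=> i; rewrite ex /flen /= ?ltn0 ?subn0.
Qed.

Lemma tail_deg_refl x : tail_deg x 0 x.
Proof.
exists (fvert (bsrc x)), (fvert (bsrc x)), x.
by split; try exact: concat_vert; rewrite subrr.
Qed.

Lemma tail_equiv_refl x : tail_equiv x x.
Proof. by exists 0; apply: tail_deg_refl. Qed.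

Lemma concat_fcat mu nu (h : frng mu = fsrc nu) p y x :
  concat nu p y -> concat mu y x -> concat (fcat h) p x.
Proof.
move=> [rp sy ey] [ry sx ex]; split.
- by rewrite -rp /frng /= map_cat last_cat -/(frng mu) h.
- by [].
- move=> i; rewrite ex ey /flen /= size_cat onth_cat.
  case: ltnP => h1; first by rewrite (leq_trans h1) ?leq_addr.
  by rewrite ltn_subLR // subnDA.
Qed.

Lemma concat_cons_ex e p : rng e = bsrc p -> exists q, concat (fedge e) p q.
Proof.
case: p => [[y hy]|mu hmu] /= h.
- have hw : forall i, rng (if i is j.+1 then y j else e) =
                      src (if i.+1 is j.+1 then y j else e).
    by case=> [|i] //=; rewrite hy.
  exists (BInf (IPath hw)); split => //.
  by case=> [|i] //=; rewrite subn1.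
- have h' : frng (fedge e) = fsrc mu by [].
  have hs : singular (frng (fcat h')).
    by rewrite /frng /= h; exact: hmu.
  exists (BFin hs); split => //.
  by case=> [|i] //=; rewrite subn1.
Qed.

Lemma concat_uncons_ex e q : bedge q 0 = Some e -> exists p, concat (fedge e) p q.
Proof.
case: q => [[y hy]|[v [|f s] /= hw] hmu] //= [he].
- have hw : forall i, rng (y i.+1) = src (y i.+2) by move=> i; rewrite hy.
  exists (BInf (IPath hw)); split => //=; rewrite /frng /= -?he //.
  by case=> [|i] //=; rewrite subn1.
- subst f; case/andP: (hw) => /eqP sv hw'.
  exists (@BFin (FPath hw') hmu); split => //=.
  by case=> [|i] //=; rewrite subn1.
Qed.

Lemma concat_cons v e s (hs : walk v (e :: s)) (p q r : bpath) :
  concat (fedge e) r q -> concat (FPath hs) p q <->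
    concat (FPath (proj2 (andP hs))) p r.
Proof.
move=> [rr sq er]; split=> -[h1 h2 h3]; split=> //.
- by move=> i; have := er i.+1; rewrite h3 /flen /= subn1 /= ltnS subSS => ->.
- by rewrite sq /=; apply/eqP; case/andP: (hs).
- case=> [|i]; first by rewrite er.
  by rewrite er /flen /= subn1 /= h3 ltnS subSS.
Qed.

Lemma concat_first v e s (hs : walk v (e :: s)) (p q : bpath) :
  concat (FPath hs) p q -> bedge q 0 = Some e.
Proof. by case=> _ _ /(_ 0%N). Qed.

Lemma concat_edge0 e p q : concat (fedge e) p q -> bedge q 0 = Some e.
Proof. by case=> _ _ /(_ 0%N). Qed.

Lemma tail_equiv_cons x p e q :
  tail_equiv x p -> concat (fedge e) p q -> tail_equiv x q.
Proof.
move=> [k [mu [nu [z [hx hp _]]]]] hq.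
have h : frng (fedge e) = fsrc nu by case: hq => -> _ _; case: hp => _ ->.
by exists ((flen mu : int) - (flen (fcat h) : int)), mu, (fcat h), z; split => //;
  apply: concat_fcat hp hq.
Qed.

Lemma tail_equiv_uncons x p e q :
  tail_equiv x q -> concat (fedge e) p q -> tail_equiv x p.
Proof.
move=> [k [mu [[v [|f s] hs] [z [hx hp _]]]]] hq.
- have [zq _] := (concat_vertE v z q).1
    (eq_ind _ (fun n => concat n z q) hp _ (finpath_ext erefl erefl)).
  subst z; have h : frng mu = fsrc (fedge e).
    by case: hx => -> _ _; case: hq => _ ->.
  exists ((flen (fcat h) : int) - (flen (fvert (bsrc p)) : int)), (fcat h), (fvert (bsrc p)), p.
  by split => //; [apply: concat_fcat hq hx | apply: concat_vert].
- case: (hp) => rz /= sq eq.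
  have /= := eq 0%N; rewrite (concat_edge0 hq) => -[ef]; subst f.
  case/andP: (hs) => sv hs'.
  exists ((flen mu : int) - (flen (FPath hs') : int)), mu, (FPath hs'), z; split => //.
  case: hq => rp _ ep; split => //.
  move=> i; have := eq i.+1; rewrite ep /flen /= subn1 /= => ->.
  by rewrite ltnS subSS.
Qed.

Record cpath := CPath {
  chead : edge E;
  ctail : seq (edge E);
  cwalk : walk (src chead) (chead :: ctail);
  cclosed : last (rng chead) (map (@rng E) ctail) = src chead
}.

Definition cedges (c : cpath) : seq (edge E) := chead c :: ctail c.
Definition clen (c : cpath) : nat := size (cedges c).

Definition csrc (c : cpath) : vertex E := src (chead c).

Definition cpower (c d : cpath) (n : nat) : Prop :=
  cedges c = flatten (nseq n (cedges d)).
Definition simple_closed (c : cpath) : Prop :=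
  ~ exists d n, (2 <= n)%N /\ cpower c d n.
Definition is_cycle (c : cpath) : Prop := uniq (map (@src E) (cedges c)).
Definition rotation (c d : cpath) : Prop :=
  exists2 i, (i < clen c)%N & cedges d = rot i (cedges c).
Definition maximal_cycle (c : cpath) : Prop :=
  is_cycle c /\ forall d, is_cycle d -> ~ rotation c d ->
    ~ exists mu : finpath, fsrc mu = csrc d /\ frng mu = csrc c.

(* mu = nu c for some path nu. The infinitely many powers of c all end with c,
   so finiteness of the set of paths into csrc c is only meaningful modulo such
   paths: those not ending with c correspond to the elements of [c^oo]. *)
Definition ends_with (mu : finpath) (c : cpath) : Prop :=
  exists s, fedges mu = s ++ cedges c.

Definition cinf_edge (c : cpath) (i : nat) : edge E :=
  nth (chead c) (cedges c) (i %% clen c)%N.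

Lemma walk_nth v p e0 i :
  walk v p -> (i.+1 < size p)%N -> rng (nth e0 p i) = src (nth e0 p i.+1).
Proof.
elim: p v i => [|e p IH] v i //= /andP[_ hp].
case: i => [|i]; last by rewrite ltnS; exact: IH hp.
by case: p hp {IH} => [|f p] //= /andP[/eqP].
Qed.

Lemma cinf_walk c i : rng (cinf_edge c i) = src (cinf_edge c i.+1).
Proof.
rewrite /cinf_edge; set n := clen c.
have n0 : (0 < n)%N by [].
rewrite (modnS i); case: ifP => hd; last first.
  apply: walk_nth (cwalk c) _.
  have h := ltn_pmod i.+1 n0; rewrite (modnS i) hd in h; exact: h.
have nS : n = (size (ctail c)).+1 by [].
have -> : (i %% n)%N = size (ctail c).
  apply/eqP; rewrite eqn_leq -ltnS -nS ltn_pmod //= leqNgt; apply/negP => hlt.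
  have : ((i %% n).+1 %% n)%N = (i %% n).+1 by rewrite modn_small // nS.
  have hd' : (i.+1 %% n = 0)%N by apply/eqP.
  by rewrite -addn1 modnDml !addn1 hd'.
by rewrite /= -cclosed -last_nth -(last_map (@rng E)).
Qed.

Definition cinf (c : cpath) : bpath := BInf (IPath (cinf_walk c)).

Definition rational (x : bpath) : Prop :=
  (exists y, x = BInf y) /\ exists c : cpath, tail_equiv x (cinf c).
Definition irrational (x : bpath) : Prop :=
  (exists y, x = BInf y) /\ ~ rational x.

Definition bvert (v : vertex E) (hv : singular v) : bpath := @BFin (fvert v) hv.
Definition singular_vertex (x : bpath) : Prop :=
  exists v (hv : singular v), x = bvert hv.

End Paths.

Section Leavitt.
Variables (K : fieldType) (E : digraph).

Inductive lterm :=
| TVert of vertex E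
| TEdge of edge E
| TGhost of edge E
| TZero
| TAdd of lterm & lterm
| TScale of K & lterm
| TMul of lterm & lterm.

HB.instance Definition _ := gen_eqMixin lterm.
HB.instance Definition _ := gen_choiceMixin lterm.

(* the least congruence making [lterm] an associative, not necessarily unital,
   K-algebra in which the defining relations of L_K(E) hold *)
Inductive lrel : lterm -> lterm -> Prop :=
| lrel_refl a : lrel a a
| lrel_sym a b : lrel a b -> lrel b a
| lrel_trans a b c : lrel a b -> lrel b c -> lrel a c
| lrel_add a a' b b' : lrel a a' -> lrel b b' -> lrel (TAdd a b) (TAdd a' b')
| lrel_scale k a a' : lrel a a' -> lrel (TScale k a) (TScale k a')
| lrel_mul a a' b b' : lrel a a' -> lrel b b' -> lrel (TMul a b) (TMul a' b')
| lrel_addA a b c : lrel (TAdd a (TAdd b c)) (TAdd (TAdd a b) c)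
| lrel_addC a b : lrel (TAdd a b) (TAdd b a)
| lrel_add0 a : lrel (TAdd TZero a) a
| lrel_scale0 a : lrel (TScale 0 a) TZero
| lrel_scale1 a : lrel (TScale 1 a) a
| lrel_scaleA k l a : lrel (TScale k (TScale l a)) (TScale (k * l) a)
| lrel_scaleDr k a b :
    lrel (TScale k (TAdd a b)) (TAdd (TScale k a) (TScale k b))
| lrel_scaleDl k l a :
    lrel (TScale (k + l) a) (TAdd (TScale k a) (TScale l a))
| lrel_mulA a b c : lrel (TMul a (TMul b c)) (TMul (TMul a b) c)
| lrel_mulDl a b c : lrel (TMul (TAdd a b) c) (TAdd (TMul a c) (TMul b c))
| lrel_mulDr a b c : lrel (TMul a (TAdd b c)) (TAdd (TMul a b) (TMul a c))
| lrel_scaleAl k a b : lrel (TMul (TScale k a) b) (TScale k (TMul a b))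
| lrel_scaleAr k a b : lrel (TMul a (TScale k b)) (TScale k (TMul a b))
| lrel_vv v w :
    lrel (TMul (TVert v) (TVert w)) (if v == w then TVert v else TZero)
| lrel_src e : lrel (TMul (TVert (src e)) (TEdge e)) (TEdge e)
| lrel_rng e : lrel (TMul (TEdge e) (TVert (rng e))) (TEdge e)
| lrel_ghost_rng e : lrel (TMul (TVert (rng e)) (TGhost e)) (TGhost e)
| lrel_ghost_src e : lrel (TMul (TGhost e) (TVert (src e))) (TGhost e)
| lrel_CK1 e f :
    lrel (TMul (TGhost e) (TEdge f)) (if e == f then TVert (rng e) else TZero)
| lrel_CK2 v (es : seq (edge E)) :
    es != [::] -> uniq es -> (forall e, (e \in es) = (src e == v)) ->
    lrel (TVert v)
      (foldr (fun e t => TAdd (TMul (TEdge e) (TGhost e)) t) TZero es).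

Definition lequiv : rel lterm := fun a b => `[< lrel a b >].

Lemma lequiv_refl : reflexive lequiv.
Proof. by move=> a; apply/asboolP; apply: lrel_refl. Qed.
Lemma lequiv_sym : symmetric lequiv.
Proof. by move=> a b; apply/asboolP/asboolP; apply: lrel_sym. Qed.
Lemma lequiv_trans : transitive lequiv.
Proof.
by move=> b a c /asboolP ab /asboolP bc; apply/asboolP; apply: lrel_trans ab bc.
Qed.

Definition lequiv_equiv := EquivRel lequiv lequiv_refl lequiv_sym lequiv_trans.
Canonical lequiv_equiv.

Definition leavitt := {eq_quot lequiv}%qT.
HB.instance Definition _ := Choice.on leavitt.
HB.instance Definition _ := EqQuotient.on leavitt.

Definition lpi (t : lterm) : leavitt := (\pi_leavitt t)%qT.

Lemma lpiP a b : lpi a = lpi b <-> lrel a b.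
Proof. by split => [/eqmodP/asboolP|ab]; last by apply/eqmodP/asboolP. Qed.

Lemma lpi_repr (a : leavitt) : lpi (repr a) = a.
Proof. exact: reprK. Qed.

Lemma lpi_ind (P : leavitt -> Prop) : (forall t, P (lpi t)) -> forall a, P a.
Proof. by move=> h a; rewrite -(lpi_repr a). Qed.

Lemma repr_lpi t : lrel (repr (lpi t)) t.
Proof. by apply/lpiP; rewrite lpi_repr. Qed.

Definition lzero : leavitt := lpi TZero.
Definition ladd (a b : leavitt) : leavitt := lpi (TAdd (repr a) (repr b)).
Definition lscale (k : K) (a : leavitt) : leavitt := lpi (TScale k (repr a)).
Definition lopp (a : leavitt) : leavitt := lscale (-1) a.
Definition lmul (a b : leavitt) : leavitt := lpi (TMul (repr a) (repr b)).

Lemma ladd_pi s t : ladd (lpi s) (lpi t) = lpi (TAdd s t).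
Proof. by apply/lpiP; apply: lrel_add; apply: repr_lpi. Qed.
Lemma lscale_pi k t : lscale k (lpi t) = lpi (TScale k t).
Proof. by apply/lpiP; apply: lrel_scale; apply: repr_lpi. Qed.
Lemma lmul_pi s t : lmul (lpi s) (lpi t) = lpi (TMul s t).
Proof. by apply/lpiP; apply: lrel_mul; apply: repr_lpi. Qed.

Let pi_simp := (ladd_pi, lscale_pi, lmul_pi).

Lemma laddA : associative ladd.
Proof.
elim/lpi_ind=> a; elim/lpi_ind=> b; elim/lpi_ind=> c; rewrite !pi_simp.
by apply/lpiP; constructor.
Qed.
Lemma laddC : commutative ladd.
Proof.
by elim/lpi_ind=> a; elim/lpi_ind=> b; rewrite !pi_simp; apply/lpiP; constructor.
Qed.
Lemma ladd0 : left_id lzero ladd.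
Proof. by elim/lpi_ind=> a; rewrite !pi_simp; apply/lpiP; constructor. Qed.
Lemma laddN : left_inverse lzero lopp ladd.
Proof.
elim/lpi_ind=> a; rewrite /lopp !pi_simp; apply/lpiP.
apply: (lrel_trans (b := TAdd (TScale (-1) a) (TScale 1 a))).
  by apply: lrel_add; [apply: lrel_refl | apply/lrel_sym/lrel_scale1].
apply: (lrel_trans (b := TScale (-1 + 1) a)).
  by apply/lrel_sym/lrel_scaleDl.
by rewrite addNr; apply: lrel_scale0.
Qed.

HB.instance Definition _ :=
  GRing.isZmodule.Build leavitt laddA laddC ladd0 laddN.

Lemma lpiD s t : lpi (TAdd s t) = lpi s + lpi t.
Proof. exact: esym (ladd_pi s t). Qed.
Lemma lpi0 : lpi TZero = 0. Proof. by []. Qed.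

Lemma lscaleA k l (a : leavitt) : lscale k (lscale l a) = lscale (k * l) a.
Proof.
by elim/lpi_ind: a => a; rewrite !pi_simp; apply/lpiP; constructor.
Qed.
Lemma lscale1 : left_id 1 lscale.
Proof. by elim/lpi_ind=> a; rewrite !pi_simp; apply/lpiP; constructor. Qed.
Lemma lscaleDr : right_distributive lscale +%R.
Proof.
move=> k; elim/lpi_ind=> a; elim/lpi_ind=> b.
by rewrite -lpiD !pi_simp -lpiD; apply/lpiP; constructor.
Qed.
Lemma lscaleDl (a : leavitt) : {morph lscale^~ a : k l / k + l}.
Proof.
elim/lpi_ind: a => a k l.
by rewrite /= !pi_simp -lpiD; apply/lpiP; constructor.
Qed.

HB.instance Definition _ :=
  GRing.Zmodule_isLmodule.Build K leavitt lscaleA lscale1 lscaleDr lscaleDl.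

Lemma lpiZ k t : lpi (TScale k t) = k *: lpi t.
Proof. exact: esym (lscale_pi k t). Qed.
Lemma lpiM s t : lpi (TMul s t) = lmul (lpi s) (lpi t).
Proof. exact: esym (lmul_pi s t). Qed.

Lemma lmulA : associative lmul.
Proof.
elim/lpi_ind=> a; elim/lpi_ind=> b; elim/lpi_ind=> c.
by rewrite -!lpiM; apply/lpiP; constructor.
Qed.
Lemma lmulDl : left_distributive lmul +%R.
Proof.
elim/lpi_ind=> a; elim/lpi_ind=> b; elim/lpi_ind=> c.
by rewrite -!(lpiD, lpiM); apply/lpiP; constructor.
Qed.
Lemma lmulDr : right_distributive lmul +%R.
Proof.
elim/lpi_ind=> a; elim/lpi_ind=> b; elim/lpi_ind=> c.
by rewrite -!(lpiD, lpiM); apply/lpiP; constructor.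
Qed.
Lemma lscaleAl k (a b : leavitt) : lmul (k *: a) b = k *: lmul a b.
Proof.
elim/lpi_ind: a => a; elim/lpi_ind: b => b.
by rewrite -lpiZ -!lpiM -lpiZ; apply/lpiP; constructor.
Qed.
Lemma lscaleAr k (a b : leavitt) : lmul a (k *: b) = k *: lmul a b.
Proof.
elim/lpi_ind: a => a; elim/lpi_ind: b => b.
by rewrite -lpiZ -!lpiM -lpiZ; apply/lpiP; constructor.
Qed.

Definition lvert (v : vertex E) : leavitt := lpi (TVert v).
Definition ledge (e : edge E) : leavitt := lpi (TEdge e).
Definition lghost (e : edge E) : leavitt := lpi (TGhost e).

(* The element [mu] of L_K(E), with a harmless trailing factor [frng mu], and
   its adjoint. *)
Definition lpath (mu : finpath E) : leavitt :=
  foldr (fun e a => lmul (ledge e) a) (lvert (frng mu)) (fedges mu).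
Definition lpath_adj (nu : finpath E) : leavitt :=
  foldl (fun a e => lmul (lghost e) a) (lvert (fsrc nu)) (fedges nu).
Definition lmono (mu nu : finpath E) : leavitt := lmul (lpath mu) (lpath_adj nu).

End Leavitt.

Record lmodule (K : fieldType) (E : digraph) := LModule {
  lcar :> lmodType K;
  lact : leavitt K E -> lcar -> lcar;
  lactDl : forall a b m, lact (a + b) m = lact a m + lact b m;
  lactZl : forall k a m, lact (k *: a) m = k *: lact a m;
  lactDr : forall a m n, lact a (m + n) = lact a m + lact a n;
  lactZr : forall k a m, lact a (k *: m) = k *: lact a m;
  lactM : forall a b m, lact (lmul a b) m = lact a (lact b m);
  lact_unital : forall m, exists s : seq (leavitt K E * lcar),
    m = \sum_(t <- s) lact t.1 t.2
}.
Arguments lact {K E l}.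

Section ModuleNotions.
Variables (K : fieldType) (E : digraph).
Implicit Types M N : lmodule K E.

Definition lnonzero M : Prop := exists m : M, m <> 0.

Definition lsubmodule M (N : set M) : Prop :=
  [/\ N 0, forall m n, N m -> N n -> N (m + n),
      forall k m, N m -> N (k *: m) & forall a m, N m -> N (lact a m)].

Definition lsimple M : Prop :=
  lnonzero M /\ forall N : set M, lsubmodule N -> N = [set 0] \/ N = setT.

Definition lisom M N : Prop :=
  exists f : {linear M -> N}, bijective f /\
    forall a m, f (lact a m) = lact a (f m).

Definition lfinite_dim M : Prop :=
  exists (n : nat) (b : 'I_n -> M), forall m : M,
    exists c : 'I_n -> K, m = \sum_i c i *: b i.

End ModuleNotions.

Section Rep.
Variables (K : fieldType) (E : digraph) (M : lmodType K).
Variables (pv : vertex E -> {linear M -> M}) (pe pg : edge E -> {linear M -> M}).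

Record is_rep : Prop := IsRep {
  rep_vv : forall v w m, pv v (pv w m) = if v == w then pv v m else 0;
  rep_src : forall e m, pv (src e) (pe e m) = pe e m;
  rep_rng : forall e m, pe e (pv (rng e) m) = pe e m;
  rep_ghost_rng : forall e m, pv (rng e) (pg e m) = pg e m;
  rep_ghost_src : forall e m, pg e (pv (src e) m) = pg e m;
  rep_CK1 : forall e f m, pg e (pe f m) = if e == f then pv (rng e) m else 0;
  rep_CK2 : forall v (es : seq (edge E)) m, es != [::] -> uniq es ->
    (forall e, (e \in es) = (src e == v)) ->
    pv v m = \sum_(e <- es) pe e (pg e m);
  rep_unital : forall m, exists s : seq (vertex E * M),
    m = \sum_(t <- s) pv t.1 t.2
}.

Fixpoint interp (t : lterm K E) (m : M) : M :=
  match t with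
  | TVert v => pv v m
  | TEdge e => pe e m
  | TGhost e => pg e m
  | TZero => 0
  | TAdd a b => interp a m + interp b m
  | TScale k a => k *: interp a m
  | TMul a b => interp a (interp b m)
  end.

Lemma interpD t m n : interp t (m + n) = interp t m + interp t n.
Proof.
elim: t m n => [v|e|e||a IHa b IHb|k a IHa|a IHa b IHb] m n /=.
- exact: linearD.
- exact: linearD.
- exact: linearD.
- by rewrite addr0.
- by rewrite IHa IHb addrACA.
- by rewrite IHa scalerDr.
- by rewrite IHb IHa.
Qed.

Lemma interpZ t k m : interp t (k *: m) = k *: interp t m.
Proof.
elim: t m => [v|e|e||a IHa b IHb|l a IHa|a IHa b IHb] m /=.
- exact: linearZZ.
- exact: linearZZ.
- exact: linearZZ.
- by rewrite scaler0.
- by rewrite IHa IHb scalerDr.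
- by rewrite IHa !scalerA mulrC.
- by rewrite IHb IHa.
Qed.

Hypothesis hrep : is_rep.

Lemma interp_rel s t : lrel s t -> interp s =1 interp t.
Proof.
elim=> {s t} //=.
- by move=> a b _ h m; rewrite h.
- by move=> a b c _ h1 _ h2 m; rewrite h1.
- by move=> a a' b b' _ h1 _ h2 m; rewrite h1 h2.
- by move=> k a a' _ h m; rewrite h.
- by move=> a a' b b' _ h1 _ h2 m; rewrite h1 h2.
- by move=> a b c m; rewrite addrA.
- by move=> a b m; rewrite addrC.
- by move=> a m; rewrite add0r.
- by move=> a m; rewrite scale0r.
- by move=> a m; rewrite scale1r.
- by move=> k l a m; rewrite scalerA.
- by move=> k a b m; rewrite scalerDr.
- by move=> k l a m; rewrite scalerDl.
- by move=> a b c m; rewrite interpD.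
- by move=> k a b m; rewrite interpZ.
- by move=> v w m; rewrite rep_vv //; case: eqP.
- by move=> e m; rewrite rep_src.
- by move=> e m; rewrite rep_rng.
- by move=> e m; rewrite rep_ghost_rng.
- by move=> e m; rewrite rep_ghost_src.
- by move=> e f m; rewrite rep_CK1 //; case: eqP.
- move=> v es h1 h2 h3 m; rewrite (rep_CK2 hrep m h1 h2 h3).
  by elim: es {h1 h2 h3} => [|e es IH] /=; rewrite ?big_nil // big_cons IH.
Qed.

Definition rep_act (a : leavitt K E) (m : M) : M := interp (repr a) m.

Lemma rep_act_pi t m : rep_act (lpi t) m = interp t m.
Proof. exact/interp_rel/repr_lpi. Qed.

Lemma rep_actDl a b m : rep_act (a + b) m = rep_act a m + rep_act b m.
Proof.
by elim/lpi_ind: a => a; elim/lpi_ind: b => b; rewrite -lpiD !rep_act_pi.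
Qed.
Lemma rep_actZl k a m : rep_act (k *: a) m = k *: rep_act a m.
Proof. by elim/lpi_ind: a => a; rewrite -lpiZ !rep_act_pi. Qed.
Lemma rep_actDr a m n : rep_act a (m + n) = rep_act a m + rep_act a n.
Proof. exact: interpD. Qed.
Lemma rep_actZr k a m : rep_act a (k *: m) = k *: rep_act a m.
Proof. exact: interpZ. Qed.
Lemma rep_actM a b m : rep_act (lmul a b) m = rep_act a (rep_act b m).
Proof.
by elim/lpi_ind: a => a; elim/lpi_ind: b => b; rewrite -lpiM !rep_act_pi.
Qed.
Lemma rep_act_unital m : exists s : seq (leavitt K E * M),
  m = \sum_(t <- s) rep_act t.1 t.2.
Proof.
have [s ->] := rep_unital hrep m.
exists (map (fun t => (lvert K t.1, t.2)) s); rewrite big_map.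
by apply: eq_bigr => t _; rewrite rep_act_pi.
Qed.

Definition rep_module : lmodule K E :=
  LModule rep_actDl rep_actZl rep_actDr rep_actZr rep_actM rep_act_unital.

End Rep.

Section LMap.
Variables (K F : fieldType) (E : digraph) (phi : {rmorphism K -> F}).
Variables (a : edge E -> F) (ha : forall e, a e != 0).

(* On the generators: v |-> v, e |-> a_e e, e^* |-> a_e^-1 e^*, and phi on the
   scalars. With a = 1 this is the canonical map L_K(E) -> L_F(E), and with
   phi = id it is the automorphism sigma_a. *)
Fixpoint tmap (t : lterm K E) : lterm F E :=
  match t with
  | TVert v => TVert F v
  | TEdge e => TScale (a e) (TEdge F e)
  | TGhost e => TScale (a e)^-1 (TGhost F e)
  | TZero => TZero F E
  | TAdd s t => TAdd (tmap s) (tmap t)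
  | TScale k t => TScale (phi k) (tmap t)
  | TMul s t => TMul (tmap s) (tmap t)
  end.

Lemma lpi_CK2 v (es : seq (edge E)) :
  es != [::] -> uniq es -> (forall e, (e \in es) = (src e == v)) ->
  lvert F v = \sum_(e <- es) lmul (ledge F e) (lghost F e).
Proof.
move=> h1 h2 h3; rewrite /lvert (proj2 (lpiP _ _) (lrel_CK2 F h1 h2 h3)).
elim: es {h1 h2 h3} => [|e es IH] /=; first by rewrite big_nil.
by rewrite big_cons lpiD IH lpiM.
Qed.

Lemma tmap_rel s t : lrel s t -> lpi (tmap s) = lpi (tmap t).
Proof.
elim=> {s t} //=.
- by move=> x y z _ h1 _ h2; rewrite h1.
- by move=> x x' y y' _ h1 _ h2; rewrite !lpiD h1 h2.
- by move=> k x x' _ h; rewrite !lpiZ h.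
- by move=> x x' y y' _ h1 _ h2; rewrite !lpiM h1 h2.
- by move=> x y z; rewrite !lpiD addrA.
- by move=> x y; rewrite !lpiD addrC.
- by move=> x; rewrite lpiD lpi0 add0r.
- by move=> x; rewrite lpiZ rmorph0 scale0r.
- by move=> x; rewrite lpiZ rmorph1 scale1r.
- by move=> k l x; rewrite !lpiZ scalerA rmorphM.
- by move=> k x y; rewrite !(lpiZ, lpiD) scalerDr.
- by move=> k l x; rewrite !(lpiZ, lpiD) rmorphD scalerDl.
- by move=> x y z; rewrite !lpiM lmulA.
- by move=> x y z; rewrite !(lpiM, lpiD) lmulDl.
- by move=> x y z; rewrite !(lpiM, lpiD) lmulDr.
- by move=> k x y; rewrite !(lpiM, lpiZ) lscaleAl.
- by move=> k x y; rewrite !(lpiM, lpiZ) lscaleAr.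
- move=> v w; rewrite (proj2 (lpiP _ _) (lrel_vv F v w)).
  by case: eqP.
- move=> e; rewrite lpiM !lpiZ lscaleAr -lpiM.
  by rewrite (proj2 (lpiP _ _) (lrel_src F e)).
- move=> e; rewrite lpiM !lpiZ lscaleAl -lpiM.
  by rewrite (proj2 (lpiP _ _) (lrel_rng F e)).
- move=> e; rewrite lpiM !lpiZ lscaleAr -lpiM.
  by rewrite (proj2 (lpiP _ _) (lrel_ghost_rng F e)).
- move=> e; rewrite lpiM !lpiZ lscaleAl -lpiM.
  by rewrite (proj2 (lpiP _ _) (lrel_ghost_src F e)).
- move=> e f; rewrite lpiM !lpiZ lscaleAl lscaleAr -lpiM scalerA.
  rewrite (proj2 (lpiP _ _) (lrel_CK1 F e f)).
  case: eqP => [<-|_] /=; first by rewrite mulVf // scale1r.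
  by rewrite lpi0 scaler0.
- move=> v es h1 h2 h3; rewrite -/(lvert F v) (lpi_CK2 h1 h2 h3).
  elim: es {h1 h2 h3} => [|e es IH] /=; first by rewrite big_nil.
  rewrite big_cons lpiD IH lpiM !lpiZ lscaleAl lscaleAr scalerA mulfV //.
  by rewrite scale1r.
Qed.

Definition lmap (x : leavitt K E) : leavitt F E := lpi (tmap (repr x)).

Lemma lmap_pi t : lmap (lpi t) = lpi (tmap t).
Proof. exact/tmap_rel/repr_lpi. Qed.
Lemma lmapD x y : lmap (x + y) = lmap x + lmap y.
Proof.
by elim/lpi_ind: x => x; elim/lpi_ind: y => y; rewrite -lpiD !lmap_pi -lpiD.
Qed.
Lemma lmapZ k x : lmap (k *: x) = phi k *: lmap x.
Proof. by elim/lpi_ind: x => x; rewrite -lpiZ !lmap_pi -lpiZ. Qed.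
Lemma lmapM x y : lmap (lmul x y) = lmul (lmap x) (lmap y).
Proof.
by elim/lpi_ind: x => x; elim/lpi_ind: y => y; rewrite -lpiM !lmap_pi -lpiM.
Qed.

End LMap.

Definition restr (K F : fieldType) (phi : {rmorphism K -> F}) (M : lmodType F) :
  Type := M.

Section Restr.
Variables (K F : fieldType) (phi : {rmorphism K -> F}) (M : lmodType F).

HB.instance Definition _ := GRing.Zmodule.on (restr phi M).

Definition restr_scale (k : K) (m : restr phi M) : restr phi M :=
  phi k *: (m : M).

Lemma restr_scaleA k l m : restr_scale k (restr_scale l m) = restr_scale (k * l) m.
Proof. by rewrite /restr_scale scalerA rmorphM. Qed.
Lemma restr_scale1 : left_id 1 restr_scale.
Proof. by move=> m; rewrite /restr_scale rmorph1 scale1r. Qed.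
Lemma restr_scaleDr : right_distributive restr_scale +%R.
Proof. by move=> k m n; rewrite /restr_scale scalerDr. Qed.
Lemma restr_scaleDl m : {morph restr_scale^~ m : k l / k + l}.
Proof. by move=> k l; rewrite /restr_scale rmorphD scalerDl. Qed.

HB.instance Definition _ := GRing.Zmodule_isLmodule.Build K (restr phi M)
  restr_scaleA restr_scale1 restr_scaleDr restr_scaleDl.
End Restr.

Section Pullback.
Variables (K F : fieldType) (E : digraph) (phi : {rmorphism K -> F}).
Variables (a : edge E -> F) (ha : forall e, a e != 0) (M : lmodule F E).

Let V : lmodType K := restr phi M.
Definition pull_act (x : leavitt K E) (m : V) : V := lact (lmap phi a x) (m : M).

Lemma pull_actDl x y m : pull_act (x + y) m = pull_act x m + pull_act y m.
Proof. by rewrite /pull_act lmapD // lactDl. Qed.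
Lemma pull_actZl k x m : pull_act (k *: x) m = k *: pull_act x m.
Proof. by rewrite /pull_act lmapZ // lactZl. Qed.
Lemma pull_actDr x m n : pull_act x (m + n) = pull_act x m + pull_act x n.
Proof. exact: lactDr. Qed.
Lemma pull_actZr k x m : pull_act x (k *: m) = k *: pull_act x m.
Proof. exact: lactZr. Qed.
Lemma pull_actM x y m : pull_act (lmul x y) m = pull_act x (pull_act y m).
Proof. by rewrite /pull_act lmapM // lactM. Qed.

Lemma pull_act_span (t : lterm F E) (m : M) :
  exists s : seq (leavitt K E * V), lact (lpi t) m = \sum_(p <- s) pull_act p.1 p.2.
Proof.
have vE v (n : M) : lact (lvert F v) n = pull_act (lvert K v) n.
  by rewrite /pull_act lmap_pi.
elim: t m => [v|e|e||x IHx y IHy|k x IHx|x IHx y _] m.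
- by exists [:: (lvert K v, m)]; rewrite big_seq1 -vE.
- exists [:: (lvert K (src e), lact (ledge F e) m)]; rewrite big_seq1 -vE -lactM.
  by rewrite -lpiM (proj2 (lpiP _ _) (lrel_src F e)).
- exists [:: (lvert K (rng e), lact (lghost F e) m)]; rewrite big_seq1 -vE -lactM.
  by rewrite -lpiM (proj2 (lpiP _ _) (lrel_ghost_rng F e)).
- exists [::]; rewrite big_nil lpi0 -(scale0r (0 : leavitt F E)) lactZl.
  by rewrite scale0r.
- have [s hs] := IHx m; have [s' hs'] := IHy m.
  by exists (s ++ s'); rewrite lpiD lactDl hs hs' big_cat.
- by rewrite lpiZ lactZl -lactZr; apply: IHx.
- by rewrite lpiM lactM; apply: IHx.
Qed.

Lemma pull_act_unital m : exists s : seq (leavitt K E * V),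
  m = \sum_(p <- s) pull_act p.1 p.2.
Proof.
have [s ->] := lact_unital (m : M).
elim: s => [|[x n] s [s' IH]]; first by exists [::]; rewrite !big_nil.
elim/lpi_ind: x => x; have [s1 h1] := pull_act_span x n.
by exists (s1 ++ s'); rewrite big_cons /= h1 IH big_cat.
Qed.

Definition pullback : lmodule K E := LModule pull_actDl pull_actZl pull_actDr
  pull_actZr pull_actM pull_act_unital.
End Pullback.

Definition lsigma (F : fieldType) (E : digraph) (a : edge E -> F) :
  leavitt F E -> leavitt F E := lmap idfun a.
Definition twist (F : fieldType) (E : digraph) (a : edge E -> F)
  (ha : forall e, a e != 0) (M : lmodule F E) : lmodule F E :=
  pullback idfun ha M.

Lemma one_neq0 (E : digraph) (F : fieldType) :
  forall e : edge E, (fun=> 1 : F) e != 0.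
Proof. by move=> e; exact: oner_neq0. Qed.

Definition restrict (K F : fieldType) (E : digraph) (phi : {rmorphism K -> F})
  (M : lmodule F E) : lmodule K E := pullback phi (@one_neq0 E F) M.

Section FreeExt.
Variables (F : fieldType) (T : choiceType) (V : lmodType F).

Definition linext_fun (h : T -> V) (g : {malg F[T]}) : V :=
  \sum_(k <- msupp g) g@_k *: h k.

Lemma linext_funEw h (g : {malg F[T]}) (d : {fset T}) :
  (msupp g `<=` d)%fset -> linext_fun h g = \sum_(k <- d) g@_k *: h k.
Proof.
move=> sd; apply: big_fset_incl => // k _ /mcoeff_outdom ->; exact: scale0r.
Qed.

Lemma linext_linear h : linear (linext_fun h).
Proof.
move=> k a b; set d := (msupp a `|` msupp b `|` msupp (k *: a + b))%fset.
have sa : (msupp a `<=` d)%fset by rewrite /d -fsetUA fsubsetUl.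
have sb : (msupp b `<=` d)%fset by rewrite /d -fsetUA fsubsetU // fsubsetUl orbT.
rewrite (linext_funEw h sa) (linext_funEw h sb).
rewrite (@linext_funEw _ _ d) ?fsubsetUr //.
rewrite scaler_sumr -big_split /=; apply: eq_bigr => t _.
by rewrite mcoeffD mcoeffZ scalerDl scalerA.
Qed.

HB.instance Definition _ h := GRing.isLinear.Build F {malg F[T]} V _
  (linext_fun h) (linext_linear h).
Definition linext h : {linear {malg F[T]} -> V} := linext_fun h.

Lemma linextU h t : linext h << t >> = h t.
Proof.
rewrite /linext /= /linext_fun msuppU oner_eq0 big_seq_fset1 mcoeffUU.
exact: scale1r.
Qed.

Lemma malg_eq_lin (f g : {malg F[T]} -> V) : linear f -> linear g ->
  (forall t, f << t >> = g << t >>) -> f =1 g.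
Proof.
move=> lf lg fg m.
pose f' : {linear {malg F[T]} -> V} := HB.pack f (GRing.isLinear.Build _ _ _ _ f lf).
pose g' : {linear {malg F[T]} -> V} := HB.pack g (GRing.isLinear.Build _ _ _ _ g lg).
have mE : m = \sum_(k <- msupp m) m@_k *: << k >>.
  rewrite {1}[m]monalgE; apply: eq_bigr => k _.
  apply/malgP => k'; rewrite mcoeffZ !mcoeffU mulr_natr.
  by case: eqP => _; rewrite ?mulr1n ?mulr0n.
rewrite -[f m]/(f' m) -[g m]/(g' m) mE !linear_sum.
by apply: eq_bigr => k _; rewrite !linearZ /= fg.
Qed.
End FreeExt.

Section Chen.
Variables (F : fieldType) (E : digraph) (x : bpath E).

Record bclass := BClass { bval :> bpath E; bvalP : tail_equiv x bval }.
HB.instance Definition _ := gen_eqMixin bclass.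
HB.instance Definition _ := gen_choiceMixin bclass.

Lemma bclass_ext (p q : bclass) : bval p = bval q -> p = q.
Proof.
by case: p q => p hp [q hq] /= pq; subst q; rewrite (Prop_irrelevance hp hq).
Qed.

Let V : lmodType F := {malg F[bclass]}.

(* [wsum R w p] is [w q * q] for the q with [R q], and 0 if there is none; it
   is only used when there is at most one such q. *)
Definition wsum (R : bclass -> Prop) (w : bclass -> F) : V :=
  if pselect (exists q, R q) is left h then w (sval (cid h)) *: << sval (cid h) >>
  else 0.

Lemma wsum_some (R : bclass -> Prop) w q :
  (forall q', R q' -> q' = q) -> R q -> wsum R w = w q *: << q >>.
Proof.
move=> hu hq; rewrite /wsum; case: pselect => [h|]; last by case; exists q.
by case: cid => q' /= /hu ->.
Qed.
Lemma wsum_none (R : bclass -> Prop) w : (~ exists q, R q) -> wsum R w = 0.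
Proof. by rewrite /wsum; case: pselect. Qed.

(* [w e q] rescales the passage from p to q = ep; [w = 1] gives V_[x] and
   [w e q = a_e] gives V^a_[x] *)
Variable w : edge E -> bpath E -> F.

Definition op_vert (v : vertex E) : {linear V -> V} :=
  linext (fun p : bclass => if bsrc p == v then << p >> else 0).
Definition op_edge (e : edge E) : {linear V -> V} :=
  linext (fun p : bclass =>
    wsum (fun q : bclass => concat (fedge e) p q) (fun q => w e q)).
Definition op_ghost (e : edge E) : {linear V -> V} :=
  linext (fun p : bclass =>
    wsum (fun q : bclass => concat (fedge e) q p) (fun=> (w e p)^-1)).

Lemma op_vertE v (p : bclass) :
  op_vert v << p >> = if bsrc p == v then << p >> else 0.
Proof. exact: linextU. Qed.

Lemma op_edgeE e (p q : bclass) :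
  concat (fedge e) p q -> op_edge e << p >> = w e q *: << q >>.
Proof.
move=> h; rewrite /op_edge linextU; rewrite (wsum_some _ _ h) // => q' h'.
exact/bclass_ext/(concat_fun h' h).
Qed.
Lemma op_edge0 e (p : bclass) : bsrc p <> rng e -> op_edge e << p >> = 0.
Proof.
move=> h; rewrite /op_edge linextU wsum_none // => -[q [hq _ _]].
by apply: h; rewrite -hq.
Qed.
Lemma op_ghostE e (p q : bclass) :
  concat (fedge e) p q -> op_ghost e << q >> = (w e q)^-1 *: << p >>.
Proof.
move=> h; rewrite /op_ghost linextU.
rewrite (@wsum_some (fun q0 : bclass => concat (fedge e) q0 q) _ p) // => p' h'.
exact/bclass_ext/(concat_inj h' h).
Qed.
Lemma op_ghost0 e (q : bclass) :
  bedge q 0 <> Some e -> op_ghost e << q >> = 0.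
Proof.
move=> h; rewrite /op_ghost linextU wsum_none // => -[p /concat_edge0].
exact: h.
Qed.

Lemma bclass_cons e (p : bclass) :
  bsrc p = rng e -> exists q : bclass, concat (fedge e) p q.
Proof.
move=> h; have [q hq] := concat_cons_ex (esym h).
by exists (BClass (tail_equiv_cons (bvalP p) hq)).
Qed.
Lemma bclass_uncons e (q : bclass) :
  bedge q 0 = Some e -> exists p : bclass, concat (fedge e) p q.
Proof.
move=> h; have [p hp] := concat_uncons_ex h.
by exists (BClass (tail_equiv_uncons (bvalP q) hp)).
Qed.

Hypothesis hw : forall e q, w e q != 0.

Lemma bedge_src (q : bpath E) e : bedge q 0 = Some e -> bsrc q = src e.
Proof. by move=> /concat_uncons_ex [p []]. Qed.

Lemma op_ext (f g : {linear V -> V}) :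
  (forall p : bclass, f << p >> = g << p >>) -> f =1 g.
Proof. by apply: malg_eq_lin; [exact: linearP | exact: linearP]. Qed.

Lemma edgeP e (p : bclass) :
  (exists2 q : bclass, concat (fedge e) p q & op_edge e << p >> = w e q *: << q >>)
  \/ (bsrc p <> rng e /\ op_edge e << p >> = 0).
Proof.
have [h|h] := pselect (bsrc p = rng e); last by right; split=> //; exact: op_edge0.
by have [q hq] := bclass_cons h; left; exists q => //; exact: op_edgeE.
Qed.
Lemma ghostP e (q : bclass) :
  (exists2 p : bclass, concat (fedge e) p q &
     op_ghost e << q >> = (w e q)^-1 *: << p >>)
  \/ (bedge q 0 <> Some e /\ op_ghost e << q >> = 0).
Proof.
have [h|h] := pselect (bedge q 0 = Some e); last by right; split=> //; exact: op_ghost0.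
by have [p hp] := bclass_uncons h; left; exists p => //; exact: op_ghostE.
Qed.

Lemma bedge_regular (q : bpath E) v (es : seq (edge E)) :
  es != [::] -> (forall e, (e \in es) = (src e == v)) -> bsrc q = v ->
  exists e, bedge q 0 = Some e.
Proof.
case: q => [y|[u [|e s] hu] hmu] /= h1 h3 qv.
- by exists (iedge y 0).
- subst u; case: hmu => [hs|[]].
    case: es h1 h3 => // e es _ /(_ e); rewrite mem_head => /esym/eqP.
    by move/hs.
  suff -> : [set e | src e = v] = [set` es] by exact: finite_seq.
  by apply/seteqP; split=> e /=; rewrite h3 => /eqP.
- by exists e.
Qed.

Lemma chen_is_rep : is_rep op_vert op_edge op_ghost.
Proof.
split.
- move=> u v m; pose g : {linear V -> V} := if u == v then op_vert u else \0.
  have -> : (if u == v then op_vert u m else 0) = g m by rewrite /g; case: eqP.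
  rewrite -[LHS]/((op_vert u \o op_vert v) m); apply: op_ext => p /=.
  rewrite /g op_vertE; case: (bsrc p =P v) => [pv|pv].
    rewrite op_vertE pv eq_sym; case: (u =P v) => [->|_] //=.
    by rewrite op_vertE pv eqxx.
  rewrite linear0; case: (u =P v) => [->|_] //=.
  by rewrite op_vertE; case: eqP.
- move=> e m; rewrite -[LHS]/((op_vert (src e) \o op_edge e) m).
  apply: op_ext => p /=; have [[q hq ->]|[_ ->]] := edgeP e p; last exact: linear0.
  by rewrite linearZ /= op_vertE; case: hq => _ -> _; rewrite eqxx.
- move=> e m; rewrite -[LHS]/((op_edge e \o op_vert (rng e)) m).
  apply: op_ext => p /=; rewrite op_vertE; case: eqP => // h.
  by rewrite linear0 op_edge0.
- move=> e m; rewrite -[LHS]/((op_vert (rng e) \o op_ghost e) m).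
  apply: op_ext => q /=; have [[p hp ->]|[_ ->]] := ghostP e q; last exact: linear0.
  by rewrite linearZ /= op_vertE; case: hp => <- _ _; rewrite eqxx.
- move=> e m; rewrite -[LHS]/((op_ghost e \o op_vert (src e)) m).
  apply: op_ext => q /=; rewrite op_vertE; case: eqP => // h.
  rewrite linear0 op_ghost0 // => /bedge_src; exact: h.
- move=> e f m; pose g : {linear V -> V} := if e == f then op_vert (rng e) else \0.
  have -> : (if e == f then op_vert (rng e) m else 0) = g m by rewrite /g; case: eqP.
  rewrite -[LHS]/((op_ghost e \o op_edge f) m); apply: op_ext => p /=.
  rewrite /g; have [[q hq ->]|[h ->]] := edgeP f p.
    rewrite linearZ /=; case: (e =P f) => [ef|ef].
      subst f; rewrite (op_ghostE hq) scalerA mulfV // scale1r op_vertE.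
      by case: hq => <- _ _; rewrite eqxx.
    rewrite op_ghost0 ?scaler0 // (concat_edge0 hq) => -[fe].
    by apply: ef.
  rewrite linear0; case: (e =P f) => [ef|//].
  by subst f; rewrite op_vertE; case: eqP.
- move=> v es m h1 h2 h3.
  pose g : V -> V := fun m => \sum_(e <- es) op_edge e (op_ghost e m).
  rewrite -[RHS]/(g m); apply: malg_eq_lin; first exact: linearP.
    move=> k a b; rewrite /g scaler_sumr -big_split /=.
    by apply: eq_bigr => e _; rewrite !linearP.
  move=> q; rewrite op_vertE /g.
  case: (bsrc q =P v) => qv.
    have [e he] := bedge_regular h1 h3 qv.
    have ees : e \in es by rewrite h3 -(bedge_src he) qv.
    rewrite (bigD1_seq e) //= big1 ?addr0 => [|f /eqP fe]; last first.
      rewrite op_ghost0 ?linear0 //; rewrite he => -[ef]; exact: fe.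
    have [p hp] := bclass_uncons he.
    by rewrite (op_ghostE hp) linearZ /= (op_edgeE hp) scalerA mulVf // scale1r.
  rewrite big_seq big1 // => e; rewrite h3 => /eqP ev.
  rewrite op_ghost0 ?linear0 // => /bedge_src qe.
  by apply: qv; rewrite qe.
- move=> m; exists (map (fun k : bclass => (bsrc k, m@_k *: << k >>)) (msupp m)).
  rewrite big_map /= {1}[m]monalgE; apply: eq_bigr => k _.
  rewrite linearZ /= op_vertE eqxx.
  apply/malgP => k'; rewrite mcoeffZ !mcoeffU mulr_natr.
  by case: eqP => _; rewrite ?mulr1n ?mulr0n.
Qed.

Definition weighted_chen : lmodule F E := rep_module chen_is_rep.

End Chen.

(* V_[x]; see [chen_mono] and [chen_mono0] for the action of mu nu^* *)
Definition chen (F : fieldType) (E : digraph) (x : bpath E) : lmodule F E :=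
  weighted_chen x (fun _ _ => oner_neq0 F).

Lemma lact0r (K : fieldType) (E : digraph) (M : lmodule K E) a :
  lact a (0 : M) = 0.
Proof. by have := lactZr 0 a (0 : M); rewrite !scale0r. Qed.

Section ChenAction.
Variables (F : fieldType) (E : digraph) (x : bpath E).
Local Notation B := (bclass x).
Local Notation V := (chen F x).
Implicit Types p q : B.

Lemma weighted_chen_pi (w : edge E -> bpath E -> F)
    (hw : forall e (q : bpath E), w e q != 0) t
    (m : weighted_chen x hw) :
  lact (lpi t) m =
    interp (@op_vert F E x) (@op_edge F E x w) (@op_ghost F E x w) t (m : {malg F[B]}).
Proof. exact: rep_act_pi (chen_is_rep x hw) t m. Qed.

Lemma chen_vert v p : lact (lvert F v) (<< p >> : V) = if bsrc p == v then << p >> else 0.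
Proof.
by rewrite weighted_chen_pi /= op_vertE.
Qed.
Lemma chen_edge e p q : concat (fedge e) p q ->
  lact (ledge F e) (<< p >> : V) = << q >>.
Proof.
move=> h; rewrite weighted_chen_pi.
by apply: (etrans (op_edgeE (fun _ _ => 1) h)); rewrite scale1r.
Qed.
Lemma chen_ghost e p q : concat (fedge e) p q ->
  lact (lghost F e) (<< q >> : V) = << p >>.
Proof.
move=> h; rewrite weighted_chen_pi.
by apply: (etrans (op_ghostE (fun _ _ => 1) h)); rewrite invr1 scale1r.
Qed.
Lemma chen_ghost0 e q : bedge q 0 <> Some e ->
  lact (lghost F e) (<< q >> : V) = 0.
Proof.
move=> h; rewrite weighted_chen_pi.
exact: op_ghost0.
Qed.

Lemma bclass_tail nu (r : bpath E) q : concat nu r q -> exists z : B, bval z = r.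
Proof.
case: nu => v s hs; elim: s v hs q => [|e s IH] v hs q h.
  exists q; case: h => /= h1 h2 h3; apply: bpath_ext; first by rewrite -h1.
  by move=> i; rewrite h3 /flen /= subn0.
have [q' hq'] := bclass_uncons (concat_first h).
exact: IH ((concat_cons hs r hq').1 h).
Qed.

Lemma chen_path mu p q : concat mu p q -> lact (lpath F mu) (<< p >> : V) = << q >>.
Proof.
case: mu => v s hs.
rewrite -[lpath F _]/(foldr (fun e a => lmul (ledge F e) a)
  (lvert F (last v (map (@rng E) s))) s).
elim: s v hs q => [|e s IH] v hs q h.
  case: (h) => h1 h2 h3; have pq : p = q.
    apply: bclass_ext; apply: bpath_ext; first by rewrite -h1 h2.
    by move=> i; rewrite h3 /flen /= subn0.
  by subst q; rewrite [foldr _ _ _]/= chen_vert h2 eqxx.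
have [q' hq'] := bclass_uncons (concat_first h).
have h' := (concat_cons hs p hq').1 h.
by rewrite [foldr _ _ _]/= lactM (IH _ _ _ h') (chen_edge hq').
Qed.

Lemma chen_adj nu p q : concat nu p q ->
  lact (lpath_adj F nu) (<< q >> : V) = << p >>.
Proof.
move=> h; rewrite /lpath_adj.
have : lact (lvert F (fsrc nu)) (<< q >> : V) = << q >>.
  by rewrite chen_vert; case: h => _ -> _; rewrite eqxx.
move: (lvert F (fsrc nu)) {1 3}(<< q >> : V) => a m.
case: nu h => v s hs; rewrite [fedges _]/=.
elim: s v hs a q => [|e s IH] v hs a q h ham; rewrite [foldl _ _ _]/=.
  rewrite ham; congr (<< _ >>); case: h => h1 h2 h3.
  apply/bclass_ext/bpath_ext; first by rewrite h2 -h1.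
  by move=> i; rewrite h3 /flen /= subn0.
have [q' hq'] := bclass_uncons (concat_first h).
apply: (IH _ _ _ _ ((concat_cons hs p hq').1 h)).
by rewrite lactM ham (chen_ghost hq').
Qed.

Lemma chen_adj0 nu q : (forall p, ~ concat nu p q) ->
  lact (lpath_adj F nu) (<< q >> : V) = 0.
Proof.
have L1 s a m : lact a m = 0 :> V ->
    lact (foldl (fun b e => lmul (lghost F e) b) a s) m = 0.
  elim: s a => [|e s IH] a h; first exact: h.
  by rewrite [foldl _ _ _]/=; apply: IH; rewrite lactM h lact0r.
move=> h; rewrite /lpath_adj.
have [qv|qv] := eqVneq (bsrc q) (fsrc nu); last first.
  by apply: L1; rewrite chen_vert (negPf qv).
have : lact (lvert F (fsrc nu)) (<< q >> : V) = << q >>.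
  by rewrite chen_vert qv eqxx.
move: (lvert F (fsrc nu)) {1 3}(<< q >> : V) => a m.
case: nu h qv => v s hs; rewrite [fedges _]/=.
elim: s v hs a q => [|e s IH] v hs a q h qv ham; rewrite [foldl _ _ _]/=.
  case: (h q); split=> // i; by rewrite /flen /= subn0.
have [he|he] := pselect (bedge q 0 = Some e); last first.
  by apply: L1; rewrite lactM ham chen_ghost0.
have [q' hq'] := bclass_uncons he.
apply: (IH _ (proj2 (andP hs)) _ q').
- by move=> p hp; apply: (h p); apply/(concat_cons hs p hq').
- by case: hq' => /= <-.
- by rewrite lactM ham (chen_ghost hq').
Qed.

(* (mu nu^* ).p = mu p' if p = nu p', and 0 otherwise *)
Lemma chen_mono mu nu (p q : B) (r : bpath E) :
  concat nu r p -> concat mu r q ->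
  lact (lmono F mu nu) (<< p >> : V) = << q >>.
Proof.
move=> hp hq; have [z zr] := bclass_tail hp; subst r.
by rewrite lactM (chen_adj hp) (chen_path hq).
Qed.
Lemma chen_mono0 mu nu (p : B) : ~ (exists r, concat nu r p) ->
  lact (lmono F mu nu) (<< p >> : V) = 0.
Proof.
move=> h; rewrite lactM chen_adj0 => [|z hz]; last by apply: h; exists z.
exact: lact0r.
Qed.

(* the weights [w e q = a_e] give the module twisted by sigma_a *)
Lemma weighted_chen_twist (a : edge E -> F) (ha : forall e, a e != 0)
    (w : edge E -> bpath E -> F) (hw : forall e (q : bpath E), w e q != 0) :
  (forall e (q : bpath E), bedge q 0 = Some e -> w e q = a e) ->
  forall eta m, lact (l := weighted_chen x hw) eta m = lact (l := twist ha V) eta m.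
Proof.
move=> wa; elim/lpi_ind=> t m.
rewrite [RHS]/(pull_act _ _ _) /pull_act lmap_pi // !weighted_chen_pi.
have he e n : op_edge x w e n = a e *: op_edge x (fun _ _ => 1) e n :> {malg F[B]}.
  pose g : {linear {malg F[B]} -> {malg F[B]}} :=
    a e \*: op_edge x (fun _ _ => 1) e.
  move: n; apply: (@op_ext _ _ _ _ g) => p.
  rewrite -[RHS]/(a e *: op_edge x (fun _ _ => 1) e << p >>).
  have [pe|pe] := pselect (bsrc p = rng e).
    have [q hq] := bclass_cons pe.
    rewrite (op_edgeE w hq) (op_edgeE (fun _ _ => 1) hq).
    by rewrite (wa _ _ (concat_edge0 hq)) scale1r.
  by rewrite (op_edge0 w pe) (op_edge0 (fun _ _ => 1) pe) scaler0.
have hg e n :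
    op_ghost x w e n = (a e)^-1 *: op_ghost x (fun _ _ => 1) e n :> {malg F[B]}.
  pose g : {linear {malg F[B]} -> {malg F[B]}} :=
    (a e)^-1 \*: op_ghost x (fun _ _ => 1) e.
  move: n; apply: (@op_ext _ _ _ _ g) => q.
  rewrite -[RHS]/((a e)^-1 *: op_ghost x (fun _ _ => 1) e << q >>).
  have [qe|qe] := pselect (bedge q 0 = Some e).
    have [p hp] := bclass_uncons qe.
    rewrite (op_ghostE w hp) (op_ghostE (fun _ _ => 1) hp).
    by rewrite (wa _ _ qe) invr1 scale1r.
  by rewrite (op_ghost0 w qe) (op_ghost0 (fun _ _ => 1) qe) scaler0.
elim: t m => [v|e|e||s IHs t IHt|k s IHs|s IHs t IHt] m //=.
- exact: he.
- exact: hg.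
- by rewrite IHs IHt.
- by rewrite IHs.
- by rewrite IHt IHs.
Qed.

End ChenAction.

Record lpoly (K : fieldType) := LPoly {
  lp_poly :> {poly K};
  lp_irr : monic_irreducible_poly lp_poly;
  lp_neqX : lp_poly != 'X
}.

Section Vf.
Variables (K : fieldType) (E : digraph) (c : cpath E) (f : lpoly K).

(* K[t, t^-1]/(f), which is K[t]/(f) because t is invertible modulo f *)
Definition lpfield : fieldType := {poly %/ (lp_poly f) with lp_irr f}.
Definition tbar : lpfield := in_qpoly (lp_poly f) 'X.

Lemma tbar_neq0 : tbar != 0.
Proof.
apply/eqP => /(congr1 val) /= h.
have [[fs fi] fm] := lp_irr f.
move: h; rewrite mk_monicE; last exact: lp_irr.
move=> /eqP h; have hd : lp_poly f %| 'X.
  by rewrite -[_ %| _]/(_ == 0) Pdiv.IdomainMonic.modpE.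
case/negP: (lp_neqX f).
rewrite -eqp_monic ?monicX // -dvdp_size_eqp // eqn_leq size_polyX fs andbT.
by have := dvdp_leq (negbT (polyX_eq0 K)) hd; rewrite size_polyX.
Qed.

(* V^f_[c^oo] for c = e_1...e_n. The space is K'^([c^oo]), and tbar is the
   factor attached to the passage through e_1. If e_1 occurs only once in c
   (for instance if c is a cycle) this is the module twisted by sigma_tvec,
   with tbar at e_1 and 1 at the other edges, see [chen_poly_twist]. If e_1
   occurs m > 1 times, that twist would make c act on c^oo by tbar^m, and the
   K-module obtained would in general be neither simple nor determined by f up
   to isomorphism (take c = aabb, f = t - 1 and f = t + 1); so only the first
   of the n positions of c carries the factor tbar, and the other occurrences
   of e_1 in a turn of c^oo carry the factor 1. *)
Definition later_turn (q : bpath E) : Prop :=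
  exists i, (0 < i < clen c)%N /\ forall j, bedge q j = Some (cinf_edge c (i + j)).

Definition cweight (e : edge E) (q : bpath E) : lpfield :=
  if (e == chead c) && ~~ `[< later_turn q >] then tbar else 1.

Lemma cweight_neq0 e q : cweight e q != 0.
Proof. by rewrite /cweight; case: ifP => _; [exact: tbar_neq0 | exact: oner_neq0]. Qed.

Definition chen_poly : lmodule K E :=
  restrict (in_alg lpfield) (weighted_chen (cinf c) cweight_neq0).

Definition tvec (e : edge E) : lpfield := if e == chead c then tbar else 1.
Lemma tvec_neq0 e : tvec e != 0.
Proof. by rewrite /tvec; case: ifP => _; [exact: tbar_neq0 | exact: oner_neq0]. Qed.

Lemma chen_poly_twist : chead c \notin ctail c ->
  forall eta m, lact (l := chen_poly) eta m =
    lact (l := restrict (in_alg lpfield)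
                 (twist tvec_neq0 (chen lpfield (cinf c)))) eta m.
Proof.
move=> hc eta m; apply: weighted_chen_twist => e q qe.
rewrite /cweight /tvec; case: eqP => //= ec; case: asboolP => //= -[i [hi /(_ 0%N)]].
rewrite qe addn0 /cinf_edge modn_small; last by case/andP: hi.
case: i hi => // i /= hi [ei]; case/negP: hc.
by rewrite -ec ei mem_nth.
Qed.
End Vf.

Section Groupoid.
Variable E : digraph.
Local Notation bpath := (bpath E).
Local Notation finpath := (finpath E).

Record groupoid := Gpd {
  gcod : bpath;
  gdeg : int;
  gdom : bpath;
  gdegP : tail_deg gcod gdeg gdom
}.

Lemma groupoid_ext (g h : groupoid) :
  gcod g = gcod h -> gdeg g = gdeg h -> gdom g = gdom h -> g = h.
Proof.
case: g h => [x k y hg] [x' k' y' hh] /= xx kk yy.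
by subst x' k' y'; rewrite (Prop_irrelevance hg hh).
Qed.

Definition gunit (x : bpath) : groupoid := Gpd (tail_deg_refl x).

Definition Zset (mu nu : finpath) : set groupoid :=
  [set g | exists p, [/\ concat mu p (gcod g), concat nu p (gdom g) &
    gdeg g = (flen mu : int) - (flen nu : int)]].

(* Z(mu e, nu e); empty unless src e = frng mu = frng nu *)
Definition Zset_ext (mu nu : finpath) (e : edge E) : set groupoid :=
  [set g | exists (h : frng mu = fsrc (fedge e)) (h' : frng nu = fsrc (fedge e)),
    Zset (fcat h) (fcat h') g].

Definition Zbasic (mu nu : finpath) (es : seq (edge E)) : set groupoid :=
  Zset mu nu `\` \bigcup_(e in [set` es]) Zset_ext mu nu e.

Definition Zbase : set (set groupoid) :=
  [set A | exists mu nu es, [/\ frng mu = frng nu,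
    forall e, e \in es -> src e = frng mu & A = Zbasic mu nu es]].

Lemma Zbase_cover : \bigcup_(A in Zbase) A = setT.
Proof.
apply/seteqP; split=> // g _.
have [mu [nu [p [hx hy hk]]]] := gdegP g.
exists (Zbasic mu nu [::]); first exists mu, nu, [::].
  by split=> //; case: hx hy => -> _ _ [-> _ _].
split; first by exists p; split.
by case=> e.
Qed.

Lemma concat_prefix (mu : finpath) (x : bpath) : bsrc x = fsrc mu ->
  (forall i, (i < flen mu)%N -> bedge x i = onth (fedges mu) i) ->
  exists r, concat mu r x.
Proof.
case: mu => v s hs; elim: s v hs x => [|e s IH] v hs x hx he.
  exists x; split=> // i; by rewrite /flen /= subn0.
have x0 : bedge x 0 = Some e by rewrite (he 0%N).
have [x' hx'] := concat_uncons_ex x0.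
have [||r hr] := IH (rng e) (proj2 (andP hs)) x'.
- by case: hx' => /= <-.
- move=> i hi; have := he i.+1; rewrite /flen /= ltnS => /(_ hi) <-.
  by case: hx' => _ _ ->; rewrite /flen /= subn1.
- by exists r; apply/(concat_cons hs r hx').
Qed.

Lemma concat_shift mu (p x : bpath) i :
  concat mu p x -> bedge x (flen mu + i) = bedge p i.
Proof. by case=> _ _ ->; rewrite ltnNge leq_addr /= addKn. Qed.
Lemma concat_onth mu (p x : bpath) i :
  concat mu p x -> (i < flen mu)%N -> bedge x i = onth (fedges mu) i.
Proof. by case=> _ _ -> ->. Qed.

Lemma concat_same_len mu mu' (p p' x : bpath) :
  concat mu p x -> concat mu' p' x -> flen mu = flen mu' -> mu = mu'.
Proof.
move=> h h' hl; apply: finpath_ext; first by case: h h' => _ <- _ [_ <- _].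
apply: eq_from_onth => i; have [hi|hi] := ltnP i (flen mu).
  by rewrite -(concat_onth h) // -(concat_onth h') // -hl.
by rewrite !onth_default // -/(flen mu') -hl.
Qed.

Lemma Zbase_join_le mu nu es mu' nu' es' (g : groupoid) :
  (flen mu <= flen mu')%N ->
  frng mu = frng nu -> (forall e, e \in es -> src e = frng mu) ->
  frng mu' = frng nu' -> (forall e, e \in es' -> src e = frng mu') ->
  Zbasic mu nu es g -> Zbasic mu' nu' es' g ->
  exists A, [/\ Zbase A, A g & A `<=` Zbasic mu nu es `&` Zbasic mu' nu' es'].
Proof.
move=> hle hr hes hr' hes' [[p [px py pk]] pN] [[p' [px' py' pk']] pN'].
have hd : (flen nu' - flen nu = flen mu' - flen mu)%N /\ (flen nu <= flen nu')%N.
  move: pk'; rewrite pk => /eqP; rewrite subr_eq addrAC eq_sym subr_eq.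
  rewrite -!PoszD => /eqP [hk].
  have hle' : (flen nu <= flen nu')%N.
    by rewrite -(leq_add2l (flen mu)) -hk leq_add2r.
  split=> //; apply/eqP; rewrite -(eqn_add2r (flen nu)) subnK //.
  rewrite -(eqn_add2l (flen mu)) addnA subnKC // hk //.
move: hd => [hd hle'].
move: hle; rewrite leq_eqVlt => /predU1P [hl|hlt].
  have mm := concat_same_len px px' hl.
  have nn : nu = nu'.
    apply: (concat_same_len py py'); apply/eqP; rewrite eqn_leq hle' /=.
    by rewrite -subn_eq0 hd hl subnn.
  subst mu' nu'; exists (Zbasic mu nu (es ++ es')); split.
  - exists mu, nu, (es ++ es'); split=> // e; rewrite mem_cat => /orP[].
      exact: hes.
    exact: hes'.
  - split; first by exists p.
    move=> [e /=]; rewrite mem_cat => /orP[he hg|he hg].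
      by apply: pN; exists e.
    by apply: pN'; exists e.
  - move=> h [hz hn]; split; split=> // -[e /= he hg]; apply: hn; exists e => //=.
      by rewrite mem_cat he.
    by rewrite mem_cat he orbT.
exists (Zbasic mu' nu' es'); split.
- by exists mu', nu', es'.
- by split; first by exists p'.
move=> h [[q [qx qy qk]] qN]; split; last by split=> //; exists q.
have m1 i : (i < flen mu')%N -> bedge (gcod h) i = bedge (gcod g) i.
  by move=> hi; rewrite (concat_onth qx hi) (concat_onth px' hi).
have n1 i : (i < flen nu')%N -> bedge (gdom h) i = bedge (gdom g) i.
  by move=> hi; rewrite (concat_onth qy hi) (concat_onth py' hi).
have [||r rx] := @concat_prefix mu (gcod h).
- by case: qx => _ -> _; case: px' => _ <- _; case: px.
- by move=> i hi; rewrite m1 ?(concat_onth px) // (ltn_trans hi).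
have [||r' ry] := @concat_prefix nu (gdom h).
- by case: qy => _ -> _; case: py' => _ <- _; case: py.
- by move=> i hi; rewrite n1 ?(concat_onth py) // (leq_trans hi).
have rr : r' = r.
  apply: bpath_ext; first by case: rx ry => <- _ _ [<- _ _].
  move=> i; rewrite -(concat_shift i rx) -(concat_shift i ry).
  have [hi|hi] := ltnP i (flen mu' - flen mu).
    rewrite m1; last by rewrite -ltn_subRL.
    rewrite n1; last by rewrite -ltn_subRL hd.
    by rewrite (concat_shift i px) (concat_shift i py).
  have -> : (flen mu + i = flen mu' + (i - (flen mu' - flen mu)))%N.
    by rewrite -{1}(subnKC hi) addnA subnKC // ltnW.
  have -> : (flen nu + i = flen nu' + (i - (flen mu' - flen mu)))%N.
    by rewrite -hd in hi *; rewrite -{1}(subnKC hi) addnA subnKC.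
  by rewrite (concat_shift _ qx) (concat_shift _ qy).
subst r'; split.
  exists r; split=> //; rewrite qk -pk'; exact: pk.
case=> e /= he [he1 [he2 [z [zx zy _]]]].
have pe : bedge p 0 = Some e.
  rewrite -(concat_shift 0 px) addn0 -m1 //.
  rewrite (concat_onth zx) /flen /= ?size_cat ?addn1 // onth_cat ltnn.
  by rewrite subnn.
apply: pN; exists e => //=; exists he1, he2.
have [p1 hp1] := concat_uncons_ex pe.
exists p1; split; [exact: concat_fcat hp1 px | exact: concat_fcat hp1 py |].
by rewrite pk /flen /= !size_cat /= !addn1 !intS opprD addrACA subrr add0r.
Qed.

Lemma Zbase_join (A B : set groupoid) (g : groupoid) :
  Zbase A -> Zbase B -> A g -> B g ->
  exists C, [/\ Zbase C, C g & C `<=` A `&` B].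
Proof.
move=> [mu [nu [es [h1 h2 ->]]]] [mu' [nu' [es' [h1' h2' ->]]]] hA hB.
case: (leqP (flen mu) (flen mu')) => hl.
  exact: (Zbase_join_le hl h1 h2 h1' h2' hA hB).
rewrite setIC; exact: (Zbase_join_le (ltnW hl) h1' h2' h1 h2 hB hA).
Qed.

HB.instance Definition _ := gen_eqMixin groupoid.
HB.instance Definition _ := gen_choiceMixin groupoid.
HB.instance Definition _ :=
  isBaseTopological.Build groupoid Zbase_cover Zbase_join.

HB.instance Definition _ := gen_eqMixin bpath.
HB.instance Definition _ := gen_choiceMixin bpath.

(* The boundary with the topology of the unit space: the subspace topology
   under x |-> (x, 0, x). *)
Definition unit_space : topologicalType := initial_topology gunit.

Definition compact_open (U : set unit_space) : Prop := open U /\ compact U.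

End Groupoid.

HB.instance Definition _ (E : digraph) := gen_eqMixin (finpath E).
HB.instance Definition _ (E : digraph) := gen_choiceMixin (finpath E).

Section Spectral.
Variables (K : fieldType) (E : digraph).

(* The graph of the isomorphism L_K(E) -> A_K(G_E): the linear extension of
   mu nu^* |-> 1_Z(mu, nu). *)
Definition steinberg_iso (a : leavitt K E) (phi : groupoid E -> K) : Prop :=
  exists s : seq (K * (finpath E * finpath E)),
    [/\ {in s, forall t, frng t.2.1 = frng t.2.2},
        a = \sum_(t <- s) t.1 *: lmono K t.2.1 t.2.2 &
        forall g, phi g = \sum_(t <- s) t.1 * \1_(Zset t.2.1 t.2.2) g].

(* 1_U M, where U is viewed as a set of units and 1_U as an element of L_K(E)
   through [steinberg_iso] *)
Definition char_image (M : lmodule K E) (U : set (unit_space E)) : set M :=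
  [set m | exists a n, steinberg_iso a \1_(@gunit E @` U) /\ m = lact a n].
Arguments char_image : clear implicits.

Definition lRes (M : lmodule K E) (x : bpath E) : set M :=
  \bigcap_(U in [set U : set (unit_space E) | compact_open U /\ U x])
    char_image M U.
Arguments lRes : clear implicits.

Definition spectral (M : lmodule K E) : Prop :=
  lnonzero M /\ exists x, lRes M x <> [set 0].

End Spectral.

(* Main.v *)
From HB Require Import structures.
Require Import Defs.
From mathcomp Require Import all_boot all_order all_algebra all_field.
From mathcomp Require Import finmap zify.
From mathcomp Require Import all_classical topology numfun.
From mathcomp.multinomials Require Import monalg.

(** The algebra [L_K(E)] contains the commuting idempotents [nu nu^*], [nu] a finite
    path. A vector of a module is supported at a boundary path [x] ([localized]) when
    [nu nu^*] fixes it for every initial segment [nu] of [x] and kills it for all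
    other [nu]. These vectors are exactly those of [Res_x(M)] ([lResE]). One
    inclusion needs that the indicator of a compact open set is a combination
    of indicators of sets [Z(mu)]; the other needs that [Z(nu)] and its
    complement in [Z(s(nu))] are compact ([ultra_cvg]) and that [L_K(E)] maps
    injectively to the Steinberg algebra ([steinberg_inj]). So a module is
    spectral when it has a nonzero vector supported somewhere ([spectralE]).

    If [x = nu p] and [q = mu p], then [mu nu^*] maps the vectors supported at [x]
    isomorphically to those supported at [q], and vectors supported at distinct
    paths are independent ([component]). As the monomials [mu nu^*] span the
    algebra ([span]), whether an element annihilates a vector supported at [x] is
    decided by the monomials that fix [x] ([ann_sub]), that is, by the isotropy
    group at [x]. A simple module is generated by any of its nonzero vectors, so
    two simple modules are isomorphic once they have nonzero vectors with the
    same annihilator ([lisom_of_ann]).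

    The isotropy at [x] is trivial when [x] is irrational or a singular vertex. Then
    all simple modules with a nonzero vector supported at [x] are isomorphic to
    [V_[x]] ([nonrational_lisom]). When [x = c^oo] with [c] simple, the isotropy is
    generated by [c] ([period_dvd]), the vectors supported at [x] form a module
    over [K[t,t^-1]] on which [t] acts as [c], and a simple module is determined by
    an irreducible polynomial [f] such that [f(c)] annihilates a nonzero vector
    supported at [x] ([rational_lisom]). Such an [f] exists ([rational_poly]), is
    unique ([rational_poly_uniq]), and occurs in [V^f_[c^oo]], where [c] acts on [c^oo]
    as the class of [t] ([cact_bas]). In the listed modules the only vectors
    supported somewhere are the multiples of the basis elements ([wloc_inv]); this gives
    their simplicity ([wsimple]) and the recovery of the tail-equivalence class
    from the isomorphism type.

    A finite-dimensional nonzero module is spectral: over a minimal nonzero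
    subspace stable under all [nu nu^*] each of these acts as 0 or 1, and the
    paths for which it acts as 1 are the initial segments of a boundary path
    ([finite_dim_localized]). By independence the class of that path is finite
    ([finite_dim_class]), which excludes irrational paths, and at [c^oo] forces [c] to
    be a maximal cycle: if a closed path [d] leads to [c] through [beta], then the
    paths [d^k beta c^oo] lie in the class, so they are not distinct and [d^oo] is in
    the class ([pump]). *)

Set Implicit Arguments.
Unset Strict Implicit.
Unset Printing Implicit Defensive.

Import GRing.Theory.
Local Open Scope classical_set_scope.
Local Open Scope ring_scope.

(** * Initial segments of boundary paths *)
Section Prefixes.
Variable E : digraph.
Implicit Types (v : vertex E) (mu nu eta : finpath E) (x y p q : bpath E).

Definition bprefix mu x : Prop := exists p, concat mu p x.

Lemma bprefixP mu x : bprefix mu x <->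
  bsrc x = fsrc mu /\ forall i, (i < flen mu)%N -> bedge x i = onth (fedges mu) i.
Proof.
split=> [[p h]|[h1 h2]]; last exact: concat_prefix.
by split=> [|i]; [case: h | exact: concat_onth h].
Qed.

Lemma concat_ex mu p : frng mu = bsrc p -> exists x, concat mu p x.
Proof.
case: mu => v s hs; elim: s v hs => [|e s IH] v hs h.
  exists p; rewrite /frng /= in h; subst v.
  by rewrite (_ : FPath hs = fvert (bsrc p)); [exact: concat_vert | exact: finpath_ext].
have [y hy] := IH _ (proj2 (andP hs)) h.
have [z hz] : exists z, concat (fedge e) y z.
  by apply: concat_cons_ex; case: hy => _ ->.
by exists z; apply/(concat_cons hs p hz).
Qed.

Lemma concat_fcatE mu eta (h : frng mu = fsrc eta) p y x :
  concat mu y x -> (concat (fcat h) p x <-> concat eta p y).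
Proof.
move=> hy; split=> [hp|hp]; last exact: concat_fcat hp hy.
have [r1 r2 r3] := hp; have [q1 q2 q3] := hy.
split; [by rewrite -r1 /frng /= map_cat last_cat -/(frng mu) h | by rewrite -q1 |].
move=> i; rewrite -(concat_shift i hy) r3 /flen /= size_cat ltn_add2l onth_cat.
by rewrite (ltnNge (_ + _)) leq_addr /= addKn subnDl.
Qed.

Lemma bprefix_fcatl mu eta (h : frng mu = fsrc eta) x :
  bprefix (fcat h) x -> bprefix mu x.
Proof.
move=> /bprefixP[h1 h2]; apply/bprefixP; split=> // i hi.
rewrite h2 /flen /= ?size_cat ?onth_cat; last exact: ltn_addr.
by rewrite -/(flen mu) hi.
Qed.

Lemma frng_fcat mu eta (h : frng mu = fsrc eta) : frng (fcat h) = frng eta.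
Proof. by rewrite /frng /= map_cat last_cat -/(frng mu) h. Qed.

Lemma flen_fcat mu eta (h : frng mu = fsrc eta) :
  flen (fcat h) = (flen mu + flen eta)%N.
Proof. exact: size_cat. Qed.

Lemma fpath_split nu n : (n <= flen nu)%N ->
  exists mu eta (h : frng mu = fsrc eta), nu = fcat h /\ flen mu = n.
Proof.
move=> hn; have := fwalk nu; rewrite -{1}(cat_take_drop n (fedges nu)) walk_cat.
case/andP=> h1 h2; pose mu := FPath h1; pose eta := FPath h2.
exists mu, eta, erefl; split; last by rewrite /flen /= size_takel.
by apply: finpath_ext => //=; rewrite cat_take_drop.
Qed.

Lemma bprefix_comp mu nu x : bprefix mu x -> bprefix nu x ->
  (flen mu <= flen nu)%N -> exists eta (h : frng mu = fsrc eta), nu = fcat h.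
Proof.
move=> [p hp] hnu hl; have [mu' [eta [h [e1 e2]]]] := fpath_split hl.
subst nu; have [p' hp'] := bprefix_fcatl hnu.
have e : mu = mu' by apply: concat_same_len hp hp' _.
by subst mu'; exists eta, h.
Qed.

Lemma bprefix_vert v x : bprefix (fvert v) x <-> bsrc x = v.
Proof.
split=> [[p /concat_vertE []]//|<-]; exists x; exact: concat_vert.
Qed.

Lemma bprefix_cons v e s (hs : walk v (e :: s)) p q : concat (fedge e) p q ->
  bprefix (FPath hs) q <-> bprefix (FPath (proj2 (andP hs))) p.
Proof.
by move=> hq; split=> -[r hr]; exists r; apply/(concat_cons hs r hq).
Qed.

Lemma fpath0 (v : vertex E) (hs : walk v [::]) : FPath hs = fvert v.
Proof. exact: finpath_ext. Qed.

(** Two distinct boundary paths differ in their sources or in the edge at some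
    position; the initial segment up to there belongs to only one of them. *)
Lemma bprefix_sep x q : q <> x ->
  (exists2 nu, bprefix nu x & ~ bprefix nu q) \/
  (exists2 nu, bprefix nu q & ~ bprefix nu x).
Proof.
move=> qx; apply: contrapT => /not_orP [hn1 hn2]; apply: qx.
have hE nu : bprefix nu x <-> bprefix nu q.
  by split=> h; apply: contrapT => h'; [apply: hn1 | apply: hn2]; exists nu.
have es : bsrc q = bsrc x.
  exact: (bprefix_vert _ _).1 ((hE _).1 ((bprefix_vert _ x).2 erefl)).
have cut (y : bpath E) i e : bedge y i = Some e ->
    exists2 mu, bprefix mu y & onth (fedges mu) i = Some e.
  elim: i y => [|i IH] y hy.
    have [p hp] := concat_uncons_ex hy.
    by exists (fedge e) => //; exists p.
  have [f hf] : exists f, bedge y 0 = Some f.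
    case: y hy => [[y hy]|[v [|f s] hs] hv] //=; last by exists f.
    by exists (y 0%N).
  have [p hp] := concat_uncons_ex hf.
  have hpi : bedge p i = Some e by rewrite -(concat_shift i hp) add1n.
  have [mu [r hr] hmu] := IH _ hpi.
  have h : frng (fedge f) = fsrc mu by case: hp => -> _ _; case: hr => _ ->.
  exists (fcat h); last by [].
  by exists r; apply/(concat_fcatE h _ hp).
apply: bpath_ext => // i.
case hq: (bedge q i) => [e|]; case hx: (bedge x i) => [f|] //.
- have [mu /hE/bprefixP[_ h] hmu] := cut _ _ _ hq.
  by rewrite -hx h ?hmu // /flen -onthTE hmu.
- have [mu /hE/bprefixP[_ h] hmu] := cut _ _ _ hq.
  by rewrite -hx h ?hmu // /flen -onthTE hmu.
- have [mu /hE/bprefixP[_ h] hmu] := cut _ _ _ hx.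
  by rewrite -hq h ?hmu // /flen -onthTE hmu.
Qed.

(** Either a singular vertex can be reached from [v], or a choice of outgoing
    edges can be followed forever. *)
Lemma bpath_from v : exists x, bsrc x = v.
Proof.
have [[mu hmu mus]|hreg] :=
    pselect (exists2 mu, fsrc mu = v & @singular E (frng mu)).
  by exists (BFin mus).
have out mu : fsrc mu = v -> exists e, src e = frng mu.
  move=> hmu; apply: contrapT => hn; apply: hreg; exists mu => //; left.
  by move=> e he; apply: hn; exists e.
pose reach u := exists2 mu, fsrc mu = v & frng mu = u.
have step (u : {u | reach u}) : {e : edge E | src e = sval u}.
  by apply: cid; case: u => u /= [mu h1 <-]; exact: out.
have reachS (u : {u | reach u}) : reach (rng (sval (step u))).
  case: (step u) => e /=; case: u => u /= [mu h1 h2] he.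
  have h : frng mu = fsrc (fedge e) by rewrite h2 -he.
  by exists (fcat h) => //; rewrite frng_fcat.
have reach0 : reach v by exists (fvert v).
pose st n := iter n (fun u => exist _ _ (reachS u)) (exist reach v reach0).
have hw i : rng (sval (step (st i))) = src (sval (step (st i.+1))).
  by rewrite (svalP (step (st i.+1))).
exists (BInf (IPath hw)) => /=.
by rewrite (svalP (step (st 0%N))).
Qed.

(** A set of finite paths that looks like the set of initial segments of a
    boundary path is one. The longest member, if there is one, ends at a
    singular vertex by the last condition; otherwise the members fit together
    into an infinite path. *)
Lemma bpath_of_prefixes (S : finpath E -> Prop) v :
  S (fvert v) ->
  (forall mu nu, S mu -> S nu -> (flen mu <= flen nu)%N ->
     exists eta (h : frng mu = fsrc eta), nu = fcat h) ->
  (forall mu eta (h : frng mu = fsrc eta), S (fcat h) -> S mu) ->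
  (forall nu, S nu -> ~ singular (frng nu) ->
     exists e (h : frng nu = fsrc (fedge e)), S (fcat h)) ->
  exists x, forall nu, S nu <-> bprefix nu x.
Proof.
move=> Sv Scomp Spre Snext.
have Ssrc nu : S nu -> fsrc nu = v.
  by move=> /(Scomp _ _ Sv)[|eta [h ->]].
have [[n hn]|hbnd] := pselect (exists n, forall nu, S nu -> (flen nu <= n)%N).
  pose P k := `[< exists2 nu, S nu & flen nu = k >].
  have P0 : exists k, P k by exists 0%N; apply/asboolP; exists (fvert v).
  have Pn k : P k -> (k <= n)%N by move=> /asboolP[nu /hn h <-].
  case: (ex_maxnP P0 Pn) => k /asboolP[mu Smu <-] hmax.
  have mus : singular (frng mu).
    apply: contrapT => /(Snext _ Smu)[e [h Se]].
    have /hmax : P (flen (fcat h)) by apply/asboolP; exists (fcat h).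
    by rewrite flen_fcat /flen /= addn1 ltnn.
  have hmu : concat mu (bvert mus) (BFin mus).
    split=> // i /=; case: ltnP => // hi; rewrite onth_default //.
    by rewrite /flen /= onth0n.
  exists (BFin mus) => nu; split=> [Snu|[p hp]].
    have [|eta [h he]] := Scomp _ _ Snu Smu.
      by apply: hmax; apply/asboolP; exists nu.
    apply: (@bprefix_fcatl _ _ h); rewrite -he; by exists (bvert mus).
  have hl : (flen nu <= flen mu)%N.
    rewrite leqNgt; apply/negP => hl.
    have := concat_onth hp hl.
    rewrite (_ : bedge _ _ = None); last by apply: onth_default.
    by move=> e; have := onthTE (fedges nu) (flen mu); rewrite -e -/(flen nu) hl.
  have [eta [h he]] := bprefix_comp (ex_intro _ p hp) (ex_intro _ (bvert mus) hmu) hl.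
  by rewrite he in Smu; exact: Spre Smu.
have long n : exists2 nu, S nu & flen nu = n.
  apply: contrapT => hno; apply: hbnd; exists n => nu Snu.
  rewrite leqNgt; apply/negP => /ltnW/fpath_split[mu [eta [h [e1 e2]]]].
  by apply: hno; exists mu => //; apply: (@Spre _ _ h); rewrite -e1.
pose w n := s2val (cid2 (long n)).
have Sw n : S (w n) by rewrite /w; case: cid2.
have lw n : flen (w n) = n by rewrite /w; case: cid2.
have wE nu i : S nu -> (i < flen nu)%N ->
    onth (fedges (w i.+1)) i = onth (fedges nu) i.
  move=> Snu hi; have [|eta [h ->]] := Scomp _ _ (Sw i.+1) Snu.
    by rewrite lw.
  by rewrite /= onth_cat -/(flen _) lw ltnSn.
have we i : {e | onth (fedges (w i.+1)) i = Some e}.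
  case he: (onth _ _) => [e|]; first by exists e.
  by have := onthTE (fedges (w i.+1)) i; rewrite he -/(flen _) lw ltnSn.
pose ed i := sval (we i).
have edE nu i : S nu -> (i < flen nu)%N -> onth (fedges nu) i = Some (ed i).
  by move=> Snu hi; rewrite -(wE nu) // /ed; case: (we i).
have walk_onth (u : vertex E) s i e f : walk u s -> onth s i = Some e ->
    onth s i.+1 = Some f -> rng e = src f.
  elim: s u i => [|g s IH] u i //=.
  case/andP=> _ hs; case: i => [|i] /=; last exact: (IH _ _ hs).
  by case: s hs {IH} => [|g' s] //= /andP[/eqP h _] [<-] [<-].
have hw i : rng (ed i) = src (ed i.+1).
  apply: (@walk_onth (fsrc (w i.+2)) (fedges (w i.+2)) i).
  - exact: fwalk.
  - by apply: edE (Sw _) _; rewrite lw.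
  - by apply: edE (Sw _) _; rewrite lw.
exists (BInf (IPath hw)) => nu.
have src0 : src (ed 0%N) = v.
  rewrite -(Ssrc _ (Sw 1%N)); have := edE _ 0%N (Sw 1%N); rewrite lw => /(_ isT).
  by case: (w 1%N) => u [|e s] //= /andP[/eqP <- _] [->].
split=> [Snu|/bprefixP[/= h1 h2]].
  apply/bprefixP; split=> [|i hi] /=; first by rewrite src0 (Ssrc _ Snu).
  by rewrite (edE _ _ Snu).
rewrite (_ : nu = w (flen nu)); first exact: Sw.
apply: finpath_ext; first by rewrite -h1 src0 (Ssrc _ (Sw _)).
apply: eq_from_onth => i; have [hi|hi] := ltnP i (flen nu).
  by rewrite -h2 // (edE _ _ (Sw _)) ?lw.
by rewrite !onth_default // -/(flen _) lw.
Qed.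

End Prefixes.

(** * The action of paths and of their adjoints *)
Section PathAction.
Variables (K : fieldType) (E : digraph) (M : lmodule K E).
Implicit Types (v w : vertex E) (e f : edge E) (mu nu eta : finpath E) (m : M).

Lemma lact0l m : lact (0 : leavitt K E) m = 0.
Proof. by have := lactZl 0 (0 : leavitt K E) m; rewrite !scale0r. Qed.

Lemma lact_sumr (I : Type) (r : seq I) (P : pred I) a (F : I -> M) :
  lact a (\sum_(i <- r | P i) F i) = \sum_(i <- r | P i) lact a (F i).
Proof.
by elim/big_rec2: _ => [|i x y _ <-]; rewrite ?lact0r // lactDr.
Qed.

Lemma lact_suml (I : Type) (r : seq I) (F : I -> leavitt K E) m :
  lact (\sum_(i <- r) F i) m = \sum_(i <- r) lact (F i) m.
Proof.
by elim/big_rec2: _ => [|i x y _ <-]; rewrite ?lact0l // lactDl.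
Qed.

Lemma lactNr a m : lact a (- m) = - lact a m.
Proof. by rewrite -scaleN1r lactZr scaleN1r. Qed.
Lemma lactBr a m n : lact a (m - n) = lact a m - lact a n.
Proof. by rewrite lactDr lactNr. Qed.
Lemma lactBl a b m : lact (a - b) m = lact a m - lact b m.
Proof. by rewrite lactDl -scaleN1r lactZl scaleN1r. Qed.

Lemma vertvert v w m : lact (lvert K v) (lact (lvert K w) m) =
  if v == w then lact (lvert K v) m else 0.
Proof.
rewrite -lactM -lpiM (proj2 (lpiP _ _) (lrel_vv K v w)).
by case: eqP => // _; exact: lact0l.
Qed.
Lemma vertact_src e m : lact (lvert K (src e)) (lact (ledge K e) m) = lact (ledge K e) m.
Proof. by rewrite -lactM -lpiM (proj2 (lpiP _ _) (lrel_src K e)). Qed.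
Lemma edge_vert e m : lact (ledge K e) (lact (lvert K (rng e)) m) = lact (ledge K e) m.
Proof. by rewrite -lactM -lpiM (proj2 (lpiP _ _) (lrel_rng K e)). Qed.
Lemma vert_ghost e m : lact (lvert K (rng e)) (lact (lghost K e) m) = lact (lghost K e) m.
Proof. by rewrite -lactM -lpiM (proj2 (lpiP _ _) (lrel_ghost_rng K e)). Qed.
Lemma ghost_vert e m : lact (lghost K e) (lact (lvert K (src e)) m) = lact (lghost K e) m.
Proof. by rewrite -lactM -lpiM (proj2 (lpiP _ _) (lrel_ghost_src K e)). Qed.
Lemma ghost_edge e f m : lact (lghost K e) (lact (ledge K f) m) =
  if e == f then lact (lvert K (rng e)) m else 0.
Proof.
rewrite -lactM -lpiM (proj2 (lpiP _ _) (lrel_CK1 K e f)).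
by case: eqP => // _; exact: lact0l.
Qed.

Definition pathact mu m : M := lact (lpath K mu) m.
Definition ghostact nu m : M := lact (lpath_adj K nu) m.

Lemma lmonoE mu nu m : lact (lmono K mu nu) m = pathact mu (ghostact nu m).
Proof. exact: lactM. Qed.

Lemma pathact_vert v m : pathact (fvert v) m = lact (lvert K v) m.
Proof. by []. Qed.
Lemma ghostact_vert v m : ghostact (fvert v) m = lact (lvert K v) m.
Proof. by []. Qed.

Lemma pathact_cons v e s (hs : walk v (e :: s)) m :
  pathact (FPath hs) m = lact (ledge K e) (pathact (FPath (proj2 (andP hs))) m).
Proof. by rewrite /pathact -lactM. Qed.

Lemma foldl_ghost (a : leavitt K E) s m :
  lact (foldl (fun b e => lmul (lghost K e) b) a s) m =
  foldl (fun n e => lact (lghost K e) n) (lact a m) s.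
Proof. by elim: s a => //= e s IH a; rewrite IH lactM. Qed.

Lemma ghostact_cons v e s (hs : walk v (e :: s)) m :
  ghostact (FPath hs) m = ghostact (FPath (proj2 (andP hs))) (lact (lghost K e) m).
Proof.
have sv := eqP (proj1 (andP hs)); rewrite /ghostact /lpath_adj !foldl_ghost /=.
by rewrite vert_ghost -sv ghost_vert.
Qed.

Lemma pathact0 mu : pathact mu 0 = 0. Proof. exact: lact0r. Qed.
Lemma ghostact0 mu : ghostact mu 0 = 0. Proof. exact: lact0r. Qed.
Lemma pathactZ mu k m : pathact mu (k *: m) = k *: pathact mu m.
Proof. exact: lactZr. Qed.
Lemma ghostactZ mu k m : ghostact mu (k *: m) = k *: ghostact mu m.
Proof. exact: lactZr. Qed.
Lemma pathactD mu m n : pathact mu (m + n) = pathact mu m + pathact mu n.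
Proof. exact: lactDr. Qed.
Lemma ghostactD mu m n : ghostact mu (m + n) = ghostact mu m + ghostact mu n.
Proof. exact: lactDr. Qed.
Lemma pathact_sum mu (I : Type) (r : seq I) (P : pred I) (F : I -> M) :
  pathact mu (\sum_(i <- r | P i) F i) = \sum_(i <- r | P i) pathact mu (F i).
Proof. exact: lact_sumr. Qed.
Lemma ghostact_sum mu (I : Type) (r : seq I) (P : pred I) (F : I -> M) :
  ghostact mu (\sum_(i <- r | P i) F i) = \sum_(i <- r | P i) ghostact mu (F i).
Proof. exact: lact_sumr. Qed.

Lemma vert_pathact mu m : lact (lvert K (fsrc mu)) (pathact mu m) = pathact mu m.
Proof.
case: mu => v [|e s] hs /=; first by rewrite fpath0 /pathact vertvert eqxx.
have /eqP sv := proj1 (andP hs).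
by rewrite pathact_cons -{1}sv vertact_src.
Qed.

Lemma vert_pathact0 v mu m : v <> fsrc mu -> lact (lvert K v) (pathact mu m) = 0.
Proof. by move=> /eqP/negPf h; rewrite -vert_pathact vertvert h. Qed.

Lemma pathact_rng mu m : pathact mu (lact (lvert K (frng mu)) m) = pathact mu m.
Proof.
case: mu => v s hs; elim: s v hs => [|e s IH] v hs.
  by rewrite fpath0 /pathact vertvert eqxx.
by rewrite !pathact_cons; congr (lact _ _); exact: IH.
Qed.

Lemma ghostact_src nu m : ghostact nu (lact (lvert K (fsrc nu)) m) = ghostact nu m.
Proof.
case: nu => v [|e s] hs /=; first by rewrite fpath0 /ghostact vertvert eqxx.
have /eqP sv := proj1 (andP hs).
rewrite !ghostact_cons; congr (ghostact _ _).
by move: sv => {hs} <-; exact: ghost_vert.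
Qed.

Lemma ghostact_vert0 v nu m : v <> fsrc nu -> ghostact nu (lact (lvert K v) m) = 0.
Proof.
move=> /eqP/negPf h; rewrite -ghostact_src vertvert eq_sym h; exact: ghostact0.
Qed.

Lemma vert_ghostact nu m : lact (lvert K (frng nu)) (ghostact nu m) = ghostact nu m.
Proof.
case: nu => v s hs; elim: s v hs m => [|e s IH] v hs m.
  by rewrite fpath0 /ghostact vertvert eqxx.
rewrite ghostact_cons; exact: IH.
Qed.

Lemma pathact_fcat mu eta (h : frng mu = fsrc eta) m :
  pathact (fcat h) m = pathact mu (pathact eta m).
Proof.
rewrite /pathact /lpath /= foldr_cat frng_fcat.
case: mu h => v s hs /=; rewrite /frng /= => h.
elim: s v hs h => [|e s IH] v hs h /=; last first.
  by rewrite !lactM; congr (lact _ _); apply: IH h; case/andP: hs.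
by rewrite [v]h; exact: esym (vert_pathact eta m).
Qed.

Lemma ghostact_fcat mu eta (h : frng mu = fsrc eta) m :
  ghostact (fcat h) m = ghostact eta (ghostact mu m).
Proof.
have := vert_ghostact mu m; rewrite h.
rewrite /ghostact /lpath_adj /= foldl_cat !foldl_ghost => ->.
by [].
Qed.

Lemma ghost_path mu m : ghostact mu (pathact mu m) = lact (lvert K (frng mu)) m.
Proof.
case: mu => v s hs; elim: s v hs m => [|e s IH] v hs m.
  by rewrite fpath0 /ghostact vertvert eqxx.
rewrite ghostact_cons pathact_cons ghost_edge eqxx.
by rewrite (vert_pathact (FPath (proj2 (andP hs)))) IH.
Qed.

Lemma ghost_path_fcat mu eta (h : frng mu = fsrc eta) m :
  ghostact mu (pathact (fcat h) m) = pathact eta m.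
Proof. by rewrite pathact_fcat ghost_path h vert_pathact. Qed.

Lemma ghost_fcat_path mu eta (h : frng mu = fsrc eta) m :
  ghostact (fcat h) (pathact mu m) = ghostact eta m.
Proof. by rewrite ghostact_fcat ghost_path h ghostact_src. Qed.

Lemma ghost_path0 mu nu m : flen mu = flen nu -> mu <> nu ->
  ghostact mu (pathact nu m) = 0.
Proof.
case: mu nu => v s hs [w t ht]; rewrite /flen /=.
elim: s t v w hs ht => [|e s IH] [|f t] v w hs ht //.
  rewrite !fpath0 => _ hn; rewrite ghostact_vert vertvert.
  by case: eqP => // vw; case: hn; rewrite vw.
move=> [hl] hn; rewrite ghostact_cons pathact_cons ghost_edge.
case: (e =P f) => [ef|_]; last exact: ghostact0.
subst f; rewrite (vert_pathact (FPath (proj2 (andP ht)))) IH // => -[est].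
have /eqP sv := proj1 (andP hs); have /eqP sw := proj1 (andP ht).
by apply: hn; apply: finpath_ext => /=; [rewrite -sv -sw | rewrite est].
Qed.

(** In the last case the two paths differ at a position that both have, so they
    are orthogonal in every module and share no boundary path. *)
Variant path_cmp mu nu : Prop :=
| PathCmpL eta (h : frng mu = fsrc eta) of nu = fcat h
| PathCmpR eta (h : frng nu = fsrc eta) of mu = fcat h
| PathCmpN of (forall (N : lmodule K E) (m : N),
      lact (lpath_adj K mu) (lact (lpath K nu) m) = 0)
    & ~ (exists2 x, bprefix mu x & bprefix nu x).

Lemma CK2_act (es : seq (edge E)) v m : es != [::] -> uniq es ->
  (forall e, (e \in es) = (src e == v)) ->
  lact (lvert K v) m = \sum_(e <- es) lact (ledge K e) (lact (lghost K e) m).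
Proof.
move=> h1 h2 h3; rewrite (lpi_CK2 K h1 h2 h3) lact_suml.
by apply: eq_bigr => e _; rewrite lactM.
Qed.

End PathAction.

Lemma path_cmpP K E (mu nu : finpath E) : path_cmp K mu nu.
Proof.
have [hl|/ltnW hl] := leqP (flen mu) (flen nu).
- have [mu' [eta [h [e1 e2]]]] := fpath_split hl.
  have [e|hne] := pselect (mu = mu').
    by subst mu'; apply: PathCmpL e1.
  apply: PathCmpN => [N m|[x hx hy]].
    rewrite e1 -/(pathact _ _) -/(ghostact _ _) pathact_fcat ghost_path0 //.
  rewrite e1 in hy; have [p hp] := hx; have [q hq] := bprefix_fcatl hy.
  by apply: hne; exact: concat_same_len hp hq _.
- have [nu' [eta [h [e1 e2]]]] := fpath_split hl.
  have [e|hne] := pselect (nu = nu').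
    by subst nu'; apply: PathCmpR e1.
  apply: PathCmpN => [N m|[x hx hy]].
    rewrite e1 -/(pathact _ _) -/(ghostact _ _) ghostact_fcat ghost_path0 //.
      exact: ghostact0.
    by move=> e; apply: hne.
  rewrite e1 in hx; have [p hp] := hy; have [q hq] := bprefix_fcatl hx.
  by apply: hne; exact: concat_same_len hp hq _.
Qed.

Lemma regular_edges E (v : vertex E) : ~ singular v ->
  exists es : seq (edge E),
    [/\ es != [::], uniq es & forall e, (e \in es) = (src e == v)].
Proof.
move=> /not_orP[hs hi].
have /finite_seqP [es hes] : finite_set [set e : edge E | src e = v].
  by apply: contrapT.
have hin e : (e \in undup es) = (src e == v).
  rewrite mem_undup; apply/idP/eqP => h.
    by have : [set` es] e by []; rewrite -hes.
  by have : [set` es] e by rewrite -hes.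
exists (undup es); split=> //; last exact: undup_uniq.
apply/eqP => h0; apply: hs => e /eqP; by rewrite -hin h0.
Qed.

Lemma CK2_expand K E (M : lmodule K E) (mu nu : finpath E) es (m : M) :
  frng mu = frng nu -> es != [::] -> uniq es ->
  (forall e, (e \in es) = (src e == frng mu)) ->
  forall F : edge E -> finpath E * finpath E,
  (forall e (h : frng mu = fsrc (fedge e)) (h' : frng nu = fsrc (fedge e)),
      F e = (fcat h, fcat h')) ->
  pathact mu (ghostact nu m) =
  \sum_(e <- es) pathact (F e).1 (ghostact (F e).2 m).
Proof.
move=> hr h1 h2 h3 F hF; rewrite -{1}vert_ghostact -hr (CK2_act _ h1 h2 h3).
rewrite pathact_sum [LHS]big_seq [RHS]big_seq; apply: eq_bigr => e.
rewrite h3 => /eqP es_; have h : frng mu = fsrc (fedge e) by rewrite -es_.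
have h' : frng nu = fsrc (fedge e) by rewrite -hr.
rewrite (hF e h h') /= pathact_fcat ghostact_fcat.
rewrite /pathact /ghostact -[fedge e]/(FPath (walk1 e)) -!/(pathact _ _) -!/(ghostact _ _).
rewrite pathact_cons ghostact_cons !fpath0 pathact_vert ghostact_vert.
by rewrite vertvert eqxx edge_vert.
Qed.

(** * Vectors supported at a boundary path *)
(** The idempotent [nu nu^*] is 1 or 0 on the vector according to whether [x]
    begins with [nu]. These vectors form [Res_x(M)], see [lResE]. *)
Definition localized K E (M : lmodule K E) (x : bpath E) (m : M) : Prop :=
  forall nu, (bprefix nu x -> pathact nu (ghostact nu m) = m) /\
             (~ bprefix nu x -> ghostact nu m = 0).

Section Localized.
Variables (K : fieldType) (E : digraph) (M : lmodule K E).
Implicit Types (v w : vertex E) (e f : edge E) (mu nu eta : finpath E).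
Implicit Types (m : M) (x p q : bpath E).

Lemma loc0 x : localized x (0 : M).
Proof. by move=> nu; rewrite ghostact0 pathact0. Qed.

Lemma locD x m n : localized x m -> localized x n -> localized x (m + n).
Proof.
move=> hm hn nu; split=> h; rewrite ghostactD.
  by rewrite pathactD (hm nu).1 // (hn nu).1.
by rewrite (hm nu).2 // (hn nu).2 // addr0.
Qed.

Lemma locZ x k m : localized x m -> localized x (k *: m).
Proof.
move=> hm nu; split=> h; rewrite ghostactZ.
  by rewrite pathactZ (hm nu).1.
by rewrite (hm nu).2 // scaler0.
Qed.

Lemma locN x m : localized x m -> localized x (- m).
Proof. by rewrite -scaleN1r; exact: locZ. Qed.

Lemma loc_sum x (I : Type) (r : seq I) (P : pred I) (F : I -> M) :
  (forall i, P i -> localized x (F i)) ->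
  localized x (\sum_(i <- r | P i) F i).
Proof. by move=> h; elim/big_rec: _ => [|i y /h]; [exact: loc0 | exact: locD]. Qed.

Lemma loc_src x m : localized x m -> lact (lvert K (bsrc x)) m = m.
Proof.
move=> /(_ (fvert (bsrc x))) [/(_ ((bprefix_vert _ x).2 erefl)) h _].
by move: h; rewrite pathact_vert ghostact_vert vertvert eqxx.
Qed.

Lemma loc_edge e p q m : concat (fedge e) p q -> localized p m ->
  localized q (lact (ledge K e) m).
Proof.
move=> hq hm [v [|f s] hs]; rewrite ?fpath0.
  rewrite ghostact_vert pathact_vert; have [_ sq _] := hq.
  split=> [/bprefix_vert <-|hn]; first by rewrite vertvert eqxx sq vertact_src.
  rewrite -vertact_src vertvert; case: eqP => // ve.
  by case: hn; apply/bprefix_vert; rewrite sq.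
rewrite ghostact_cons pathact_cons ghost_edge.
have [fe|fe] := eqVneq f e; last first.
  rewrite ghostact0 pathact0 lact0r; split=> // -[r hr].
  have := concat_first hr; rewrite (concat_edge0 hq) => -[ef].
  by rewrite ef eqxx in fe.
subst f; have hp := bprefix_cons hs hq.
have sp : rng e = bsrc p by case: hq.
have -> : lact (lvert K (rng e)) m = m by rewrite sp loc_src.
split=> [/hp h|hn]; first by rewrite (hm _).1.
by rewrite (hm _).2 // => /hp.
Qed.

Lemma loc_ghost e p q m : concat (fedge e) p q -> localized q m ->
  localized p (lact (lghost K e) m) /\
  lact (ledge K e) (lact (lghost K e) m) = m.
Proof.
move=> hq hm; have sp : rng e = bsrc p by case: hq.
have ee : lact (ledge K e) (lact (lghost K e) m) = m.
  have [+ _] := hm (fedge e); move=> /(_ (ex_intro _ p hq)).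
  rewrite -[fedge e]/(FPath (walk1 e)) pathact_cons ghostact_cons !fpath0.
  by rewrite pathact_vert ghostact_vert vertvert eqxx edge_vert.
split=> // nu.
have [hn|hn] := eqVneq (fsrc nu) (rng e); last first.
  have h0 : ghostact nu (lact (lghost K e) m) = 0.
    by rewrite -vert_ghost ghostact_vert0 // => h; rewrite h eqxx in hn.
  split=> // -[r [_ h _]]; by rewrite -h -sp eqxx in hn.
case: nu hn => v s hs /= vE; subst v.
have hs' : walk (src e) (e :: s) by rewrite /= eqxx.
have eF : FPath (proj2 (andP hs')) = FPath hs by exact: finpath_ext.
have hp := bprefix_cons hs' hq; rewrite eF in hp.
have := hm (FPath hs'); rewrite ghostact_cons pathact_cons eF.
move=> [h1 h2]; split=> [/hp/h1 h|/hp]; last by [].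
have := congr1 (lact (lghost K e)) h; rewrite ghost_edge eqxx.
by rewrite (vert_pathact (FPath hs)).
Qed.

Lemma loc_path mu p q m : concat mu p q -> localized p m ->
  localized q (pathact mu m).
Proof.
case: mu => v s hs; elim: s v hs q => [|e s IH] v hs q hq hm.
  rewrite fpath0 pathact_vert; move: hq; rewrite fpath0 => /concat_vertE[<- <-].
  by rewrite loc_src.
have [q' hq'] := concat_uncons_ex (concat_first hq).
rewrite pathact_cons; apply: (loc_edge hq').
exact: IH ((concat_cons hs p hq').1 hq) hm.
Qed.

Lemma loc_ghostpath mu p q m : concat mu p q -> localized q m ->
  localized p (ghostact mu m).
Proof.
case: mu => v s hs; elim: s v hs q m => [|e s IH] v hs q m hq hm.
  rewrite fpath0 ghostact_vert; move: hq; rewrite fpath0 => /concat_vertE[-> <-].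
  by rewrite loc_src.
have [q' hq'] := concat_uncons_ex (concat_first hq).
rewrite ghostact_cons; apply: (IH _ _ q' _ ((concat_cons hs p hq').1 hq)).
by case: (loc_ghost hq' hm).
Qed.

Lemma loc_ghost_path mu p q m : concat mu p q -> localized p m ->
  ghostact mu (pathact mu m) = m.
Proof. by move=> [h _ _] hm; rewrite ghost_path h loc_src. Qed.

Lemma loc_path_ghost mu p q m : concat mu p q -> localized q m ->
  pathact mu (ghostact mu m) = m.
Proof. by move=> h hm; apply: (hm mu).1; exists p. Qed.

(** Since [nu mu^*] undoes [mu nu^*], the spaces of vectors supported at the
    different members of a tail-equivalence class are isomorphic. *)
Lemma loc_move mu nu p x q m : concat nu p x -> concat mu p q ->
  localized x m ->
  localized q (pathact mu (ghostact nu m)) /\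
  pathact nu (ghostact mu (pathact mu (ghostact nu m))) = m.
Proof.
move=> hx hq hm; have hp := loc_ghostpath hx hm.
split; first exact: loc_path hq hp.
by rewrite (loc_ghost_path hq hp) (loc_path_ghost hx hm).
Qed.

Lemma loc_move_eq0 mu nu p x q m : concat nu p x -> concat mu p q ->
  localized x m -> pathact mu (ghostact nu m) = 0 -> m = 0.
Proof.
move=> hx hq hm h; have [_ <-] := loc_move hx hq hm.
by rewrite h ghostact0 pathact0.
Qed.

Lemma loc_tail_equiv x q m : tail_equiv x q -> localized x m -> m <> 0 ->
  exists2 n : M, localized q n & n <> 0.
Proof.
move=> [k [mu [nu [p [hx hq _]]]]] hm m0; exists (pathact nu (ghostact mu m)).
  by case: (loc_move hx hq hm).
by move=> /(loc_move_eq0 hx hq hm).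
Qed.

End Localized.

(** The bisection [Z(mu, nu)] contains an element of the isotropy group at [x];
    then [mu nu^*] maps the vectors supported at [x] to such vectors. *)
Definition isotropic E (x : bpath E) (t : finpath E * finpath E) : Prop :=
  exists2 p, concat t.1 p x & concat t.2 p x.

Section Separation.
Variables (K : fieldType) (E : digraph).
Implicit Types (M : lmodule K E) (x p q : bpath E).

(** An element of the algebra acting on the vectors supported at [x] as 1 and
    on those supported at [q] as 0: [nu nu^*] when only [x] begins with [nu], and
    [s(nu) - nu nu^*] when only [q] does. *)
Lemma separate1 x q : q <> x -> exists a : leavitt K E,
  [/\ forall M (m : M), localized x m -> lact a m = m,
      forall M (m : M), localized q m -> lact a m = 0 &
      forall M p (m : M), localized p m -> lact a m = m \/ lact a m = 0].
Proof.
have vertP v M p (m : M) : localized p m ->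
    lact (lvert K v) m = if bsrc p == v then m else 0.
  move=> hm; rewrite -{1}(loc_src hm) vertvert eq_sym.
  by case: eqP => // <-; rewrite loc_src.
have monoP nu M p (m : M) : localized p m ->
    (bprefix nu p -> lact (lmono K nu nu) m = m) /\
    (~ bprefix nu p -> lact (lmono K nu nu) m = 0).
  move=> hm; rewrite lmonoE; split=> h; first by rewrite (hm nu).1.
  by rewrite (hm nu).2 // pathact0.
have [sx|/negPf sx] := eqVneq (bsrc q) (bsrc x); last first.
  move=> _; exists (lvert K (bsrc x)); split=> [M m|M m|M p m] /vertP ->.
  - by rewrite eqxx.
  - by rewrite sx.
  - by case: eqP => _; [left | right].
move=> /bprefix_sep [] [nu h1 h2].
  exists (lmono K nu nu); split=> [M m|M m|M p m] /(monoP nu)[h h'].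
  - exact: h.
  - exact: h'.
  - by have [/h|/h'] := pselect (bprefix nu p); [left | right].
have snu : fsrc nu = bsrc x by rewrite -sx; case: h1 => r [_ ->].
exists (lvert K (bsrc x) - lmono K nu nu).
split=> [M m hm|M m hm|M p m hm]; have [h h'] := monoP nu _ _ _ hm;
  rewrite lactBl (vertP _ _ _ _ hm).
- by rewrite eqxx h' // subr0.
- by rewrite sx eqxx h // subrr.
- have [hp|/h' ->] := pselect (bprefix nu p); last first.
    by rewrite subr0; case: eqP => _; [left | right].
  have -> : bsrc p == bsrc x by rewrite -snu; case: hp => r [_ -> _].
  by rewrite h // subrr; right.
Qed.

Lemma separate x (s : seq (bpath E)) : (forall q, q \in s -> q <> x) ->
  exists a : leavitt K E,
  (forall M (m : M), localized x m -> lact a m = m) /\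
  (forall M q (m : M), q \in s -> localized q m -> lact a m = 0).
Proof.
elim: s => [|q s IH] hs.
  by exists (lvert K (bsrc x)); split=> // M m; exact: loc_src.
have [|a [a1 a2]] := IH; first by move=> p ps; apply: hs; rewrite inE ps orbT.
have [b [b1 b2 b3]] := separate1 (hs q (mem_head _ _)).
exists (lmul a b); split=> [M m hm|M p m]; first by rewrite lactM b1 // a1.
rewrite inE lactM => /predU1P[->|ps] hm; first by rewrite b2 // lact0r.
by have [->|->] := b3 _ _ _ hm; [exact: a2 ps hm | exact: lact0r].
Qed.

(** Vectors supported at distinct boundary paths are independent, and the
    components of a sum of such vectors lie in the submodule it generates. *)
Lemma component (I : Type) (r : seq I) (Q : I -> bpath E) q :
  exists a : leavitt K E, forall M (F : I -> M),
    (forall i, localized (Q i) (F i)) ->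
    \sum_(i <- r | Q i == q) F i = lact a (\sum_(i <- r) F i).
Proof.
have [|a [a1 a2]] := @separate q [seq p <- map Q r | p != q].
  by move=> p; rewrite mem_filter => /andP[/eqP].
exists a => M F hF; rewrite lact_sumr.
have : {subset map Q r <= map Q r} by [].
elim: {-2}r => [|i s IH] hs; first by rewrite !big_nil.
rewrite !big_cons IH; last first.
  by move=> p ps; apply: hs; rewrite inE ps orbT.
case: eqP => [qi|/eqP qi]; first by rewrite a1 // -qi.
rewrite (a2 _ (Q i)) ?add0r //.
by rewrite mem_filter qi hs // mem_head.
Qed.

Lemma independent M (I : Type) (r : seq I) (Q : I -> bpath E) (F : I -> M) q :
  (forall i, localized (Q i) (F i)) -> \sum_(i <- r) F i = 0 ->
  \sum_(i <- r | Q i == q) F i = 0.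
Proof.
move=> hF h; have [a ha] := component r Q q.
by rewrite (ha _ _ hF) h lact0r.
Qed.

End Separation.

(** * The isomorphism with the Steinberg algebra *)
Section Snoc.
Variable E : digraph.
Implicit Types (mu nu : finpath E) (e : edge E).

(* junk value [mu] if [mu e] is not a path *)
Definition fsnoc mu e : finpath E :=
  if pselect (frng mu = fsrc (fedge e)) is left h then fcat h else mu.

Lemma fsnocE mu e (h : frng mu = fsrc (fedge e)) : fsnoc mu e = fcat h.
Proof.
rewrite /fsnoc; case: pselect => // h'; by rewrite (Prop_irrelevance h h').
Qed.

Definition fsnoc2 (u : finpath E * finpath E) e := (fsnoc u.1 e, fsnoc u.2 e).

End Snoc.

Section Steinberg.
Variables (K : fieldType) (E : digraph).
Local Notation pair := (finpath E * finpath E)%type.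
Implicit Types (u : pair) (g : groupoid E).

Definition matched u := frng u.1 = frng u.2.
Local Notation cyl u := (Zset u.1 u.2).

(** The relation [mu nu^* = \sum_(s(e) = r(mu)) (mu e)(nu e)^*] for an arbitrary
    function of [(mu, nu)]: both the action of [mu nu^*] on a vector and the
    indicator of [Z(mu, nu)] at a point satisfy it, so that the rewriting of a
    combination below acts on both sides of the isomorphism at once. *)
Definition CK2_additive (V : lmodType K) (F : pair -> V) : Prop :=
  forall u es, matched u -> es != [::] -> uniq es ->
    (forall e, (e \in es) = (src e == frng u.1)) ->
    F u = \sum_(e <- es) F (fsnoc2 u e).

Lemma act_CK2_additive (M : lmodule K E) (m : M) :
  CK2_additive (fun u => pathact u.1 (ghostact u.2 m)).
Proof.
move=> [mu nu] es hm h1 h2 h3; apply: (CK2_expand m hm h1 h2 h3) => e h h'.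
by rewrite /fsnoc2 /= (fsnocE h) (fsnocE h').
Qed.

Lemma Zset_snoc u e g : matched u -> src e = frng u.1 ->
  cyl (fsnoc2 u e) g <-> exists p, [/\ concat u.1 p (gcod g),
    concat u.2 p (gdom g), gdeg g = (flen u.1 : int) - (flen u.2 : int) &
    bedge p 0 = Some e].
Proof.
case: u => mu nu /= hm es; have h : frng mu = fsrc (fedge e) by rewrite -es.
have h' : frng nu = fsrc (fedge e) by rewrite -hm.
have hd : (flen (fcat h) : int) - (flen (fcat h') : int) =
    (flen mu : int) - (flen nu : int).
  by rewrite !flen_fcat !PoszD opprD addrACA subrr addr0.
rewrite (fsnocE h) (fsnocE h'); split=> -[p].
  move=> [h1 h2 h3]; have [q hq] := bprefix_fcatl (ex_intro _ p h1).
  have hpq := (concat_fcatE h p hq).1 h1.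
  exists q; split=> //; [|by rewrite -hd | exact: concat_edge0 hpq].
  have [q' hq'] := bprefix_fcatl (ex_intro _ p h2).
  by rewrite (concat_fun hpq ((concat_fcatE h' p hq').1 h2)).
move=> [h1 h2 h3 h4]; have [q hq] := concat_uncons_ex h4.
by exists q; split; [exact: concat_fcat hq h1 | exact: concat_fcat hq h2 | rewrite hd].
Qed.

Lemma cyl_CK2_additive g :
  CK2_additive (fun u => \1_(cyl u) g : K^o).
Proof.
move=> u es hm h1 h2 h3; rewrite !indicE.
have [hg|hg] := pselect (cyl u g); last first.
  rewrite memNset // big_seq big1 // => e; rewrite h3 => /eqP se.
  rewrite indicE memNset // => /(Zset_snoc _ hm se)[p [p1 p2 p3 _]].
  by apply: hg; exists p.
rewrite mem_set //; have [p [p1 p2 p3]] := hg.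
have sp : bsrc p = frng u.1 by case: p1.
have [e he] := bedge_regular h1 h3 sp.
have ees : e \in es by rewrite h3 -sp (bedge_src he).
have hes f : f \in es -> src f = frng u.1 by rewrite h3 => /eqP.
rewrite (bigD1_seq e) //= big_seq_cond big1 ?addr0 => [|f /andP[fes fe]].
  by rewrite indicE mem_set //; apply/Zset_snoc => //; [exact: hes|exists p].
rewrite indicE memNset // => /(Zset_snoc _ hm (hes _ fes))[q [q1 _ _ qf]].
case/eqP: fe; rewrite (concat_inj q1 p1) he in qf.
by case: qf.
Qed.

(** A point [(mu p, |mu| - |nu|, nu p)] lies in no other set of the list when [p]
    is the vertex [r(mu)], because the other first components are not shorter
    than [mu], or when they all have the same length. *)
Lemma coef_eq0 n d (s : seq (K * pair)) u : matched u -> flen u.1 = n ->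
  (forall t, t \in s -> (n <= flen t.2.1 <= n + d)%N) ->
  (forall g, \sum_(t <- s) t.1 * \1_(cyl t.2) g = 0) ->
  singular (frng u.1) \/ d = 0%N ->
  \sum_(t <- s | t.2 == u) t.1 = 0.
Proof.
case: u => mu nu /= hm hn hs hz hd.
have [p [sp hp]] : exists p, frng mu = bsrc p /\
    forall mu' p' x, concat mu p x -> concat mu' p' x ->
      (n <= flen mu' <= n + d)%N -> flen mu' = n.
  case: hd => [hsing|->]; last first.
    have [p hp] := bpath_from (frng mu); exists p; split=> // mu' _ _ _ _.
    by rewrite addn0 -eqn_leq eq_sym => /eqP.
  exists (bvert hsing); split=> // mu' p' x hx hx' /andP[hle _].
  apply/eqP; rewrite eqn_leq hle andbT leqNgt; apply/negP => hlt.
  have := concat_shift 0 hx; rewrite addn0 hn (concat_onth hx' hlt) /=.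
  by move=> h0; have := onthTE (fedges mu') n; rewrite h0 -/(flen _) hlt.
have [x hx] := concat_ex sp.
have [y hy] : exists y, concat nu p y by apply: concat_ex; rewrite -hm.
have xy : tail_deg x ((flen mu : int) - (flen nu : int)) y by exists mu, nu, p.
rewrite -[RHS](hz (Gpd xy)) big_mkcond /= [LHS]big_seq [RHS]big_seq.
apply: eq_bigr => -[k [mu' nu']] /= ts; rewrite indicE.
case: eqP => [[-> ->]|hne]; first by rewrite mem_set ?mulr1 //; exists p.
rewrite memNset ?mulr0 // => -[q [/= q1 q2 q3]].
have e1 : flen mu' = flen mu by rewrite hn; apply: hp hx q1 (hs _ ts).
have emu := concat_same_len q1 hx e1; apply: hne; congr (_, _) => //.
apply: (concat_same_len q2 hy); move/eqP: q3; rewrite e1 eq_sym.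
by rewrite (inj_eq (addrI _)) eqr_opp => /eqP[].
Qed.

Lemma sum_by_pair (V : lmodType K) (F : pair -> V) (s : seq (K * pair)) (P : pred pair) :
  \sum_(t <- s | P t.2) t.1 *: F t.2 =
  \sum_(u <- undup (map snd s) | P u) (\sum_(t <- s | t.2 == u) t.1) *: F u.
Proof.
rewrite [RHS](eq_bigr (fun u => \sum_(t <- s) if t.2 == u then t.1 *: F t.2 else 0)).
  rewrite exchange_big /= big_mkcond big_seq [RHS]big_seq; apply: eq_bigr => t ts.
  have tin : t.2 \in undup (map snd s) by rewrite mem_undup map_f.
  case: (boolP (P t.2)) => Pt; last first.
    by rewrite big1 // => u Pu; case: eqP => // tu; rewrite tu Pu in Pt.
  rewrite [RHS]big_mkcond (bigD1_seq t.2) ?undup_uniq //= eqxx Pt.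
  by rewrite big1 ?addr0 // => u; rewrite eq_sym => /negPf ->; case: ifP.
move=> u _; rewrite scaler_suml big_mkcond; apply: eq_bigr => t _.
by case: eqP => [->|].
Qed.

(** Injectivity of the isomorphism. Terms with a shortest first component [mu]
    cancel when [r(mu)] is singular, by [coef_eq0], and are replaced by longer
    ones when it is not; [d] bounds the difference of lengths. *)
Lemma steinberg_inj_len d n (s : seq (K * pair)) :
  (forall t, t \in s -> matched t.2) ->
  (forall t, t \in s -> (n <= flen t.2.1 <= n + d)%N) ->
  (forall g, \sum_(t <- s) t.1 * \1_(cyl t.2) g = 0) ->
  forall (V : lmodType K) (F : pair -> V), CK2_additive F ->
    \sum_(t <- s) t.1 *: F t.2 = 0.
Proof.
elim: d n s => [|d IH] n s hm hs hz V F hF.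
  rewrite -[LHS]/(\sum_(t <- s | xpredT t.2) t.1 *: F t.2) sum_by_pair.
  rewrite big_seq big1 // => u; rewrite mem_undup => /mapP[t ts ->].
  rewrite (coef_eq0 (n := n) (d := 0) (hm t ts)) ?scale0r //; last by right.
  by have := hs t ts; rewrite addn0 -eqn_leq eq_sym => /eqP.
pose P u := (flen u.1 == n) && `[< singular (frng u.1) >].
have hP (W : lmodType K) (G : pair -> W) :
    \sum_(t <- s | P t.2) t.1 *: G t.2 = 0.
  rewrite sum_by_pair big_seq_cond big1 // => u.
  rewrite mem_undup => /andP[/mapP[t ts ->]] /andP[/eqP hl /asboolP hsing].
  by rewrite (coef_eq0 (n := n) (d := d.+1) (hm t ts)) ?scale0r //; left.
pose es (v : vertex E) : seq (edge E) :=
  if pselect (singular v) is right h then sval (cid (regular_edges h))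
             else [::].
(* [X t] is [t], expanded by one edge if its first component is shortest *)
pose X (t : K * pair) : seq (K * pair) := if flen t.2.1 == n then
  [seq (t.1, fsnoc2 t.2 e) | e <- es (frng t.2.1)] else [:: t].
pose s' := flatten [seq X t | t <- s & ~~ P t.2].
have esP u : ~~ P u -> flen u.1 = n -> [/\ es (frng u.1) != [::],
    uniq (es (frng u.1)) & forall e, (e \in es (frng u.1)) = (src e == frng u.1)].
  rewrite negb_and => /orP[/eqP//|/asboolP h _].
  by rewrite /es; case: pselect => // h'; case: cid.
have hX (W : lmodType K) (G : pair -> W) : CK2_additive G ->
    \sum_(t <- s) t.1 *: G t.2 = \sum_(t <- s') t.1 *: G t.2.
  move=> hG; rewrite (bigID (fun t => P t.2)) /= hP add0r.
  rewrite /s' big_flatten big_map big_filter.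
  rewrite big_seq_cond [RHS]big_seq_cond; apply: eq_bigr => t /andP[ts Pt].
  rewrite /X; case: eqP => [hl|_]; last by rewrite big_seq1.
  have [e1 e2 e3] := esP _ Pt hl.
  by rewrite (hG _ _ (hm _ ts) e1 e2 e3) big_map scaler_sumr.
rewrite hX //; apply: (IH n.+1).
- move=> t' /flattenP[l /mapP[t]]; rewrite mem_filter => /andP[Pt ts] ->.
  rewrite /X; case: eqP => [hl|_]; last by rewrite inE => /eqP ->; exact: hm.
  have [e1 e2 e3] := esP _ Pt hl.
  move=> /mapP[e]; rewrite e3 => /eqP ee -> /=; have hmt := hm _ ts.
  have h : frng t.2.1 = fsrc (fedge e) by rewrite -ee.
  have h' : frng t.2.2 = fsrc (fedge e) by rewrite -hmt.
  by rewrite /matched /= (fsnocE h) (fsnocE h') !frng_fcat.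
- move=> t' /flattenP[l /mapP[t]]; rewrite mem_filter => /andP[Pt ts] ->.
  have /andP[l1 l2] := hs _ ts; rewrite /X; case: eqP => [hl|hl].
    have [e1 e2 e3] := esP _ Pt hl.
    move=> /mapP[e]; rewrite e3 => /eqP ee -> /=.
    have h : frng t.2.1 = fsrc (fedge e) by rewrite -ee.
    by rewrite (fsnocE h) flen_fcat hl /flen /= addn1 ltnSn leq_addr.
  rewrite inE => /eqP ->; rewrite addSnnS l2 andbT ltn_neqAle l1 andbT.
  by rewrite eq_sym; apply/eqP.
- by move=> g; rewrite -[RHS](hz g) -(hX _ _ (cyl_CK2_additive g)).
- exact: hF.
Qed.

Lemma steinberg_inj (s : seq (K * pair)) :
  {in s, forall t, frng t.2.1 = frng t.2.2} ->
  (forall g, \sum_(t <- s) t.1 * \1_(cyl t.2) g = 0) ->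
  forall (M : lmodule K E) (m : M),
    \sum_(t <- s) t.1 *: lact (lmono K t.2.1 t.2.2) m = 0.
Proof.
move=> hm hz M m.
under eq_bigr do rewrite lmonoE.
apply: (@steinberg_inj_len (\max_(t <- s) flen t.2.1) 0 s hm _ hz _ _
  (act_CK2_additive m)) => t ts.
by rewrite add0n; apply: (@leq_bigmax_seq _ s xpredT (fun t => flen t.2.1)).
Qed.

(** [steinberg_iso] is a relation; by injectivity the function determines the
    action of the element. *)
Lemma steinberg_iso_act (a b : leavitt K E) (phi : groupoid E -> K) :
  steinberg_iso a phi -> steinberg_iso b phi ->
  forall (M : lmodule K E) (m : M), lact a m = lact b m.
Proof.
move=> [s [s1 -> s3]] [s' [s1' -> s3']] M m.
rewrite !lact_suml; under eq_bigr do rewrite lactZl.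
under [RHS]eq_bigr do rewrite lactZl.
apply/eqP; rewrite -subr_eq0 -sumrN.
pose s'' := s ++ [seq (- t.1, t.2) | t <- s'].
have := @steinberg_inj s''; rewrite /s'' => h.
have {}h := h _ _ M m; rewrite big_cat big_map /= in h.
under [X in _ + X]eq_bigr do rewrite -scaleNr.
apply/eqP; apply: h => [t|g].
  by rewrite mem_cat => /orP[/s1//|/mapP[t' /s1' h ->]].
rewrite big_cat big_map /= -s3.
under eq_bigr do rewrite mulNr.
by rewrite sumrN -s3' subrr.
Qed.

End Steinberg.

(** * Compact open sets of boundary paths *)
Section Cylinders.
Variable E : digraph.
Implicit Types (mu nu : finpath E) (x y : bpath E) (es : seq (edge E)).

(* the trace of a basic open bisection on the unit space *)
Definition cylinder mu es : set (unit_space E) :=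
  [set x | bprefix mu x /\ forall e, e \in es -> ~ bprefix (fsnoc mu e) x].

Lemma Zset_unit mu nu x : Zset mu nu (gunit x) <-> mu = nu /\ bprefix mu x.
Proof.
split=> [[p [/= h1 h2 h3]]|[-> [p hp]]].
  have e : mu = nu.
    apply: concat_same_len h1 h2 _; move/esym/eqP: h3.
    by rewrite subr_eq0 => /eqP[].
  by split=> //; exists p.
by exists p; split=> //=; rewrite subrr.
Qed.

Lemma Zbasic_unit mu es x : (forall e, e \in es -> src e = frng mu) ->
  Zbasic mu mu es (gunit x) <-> cylinder mu es x.
Proof.
move=> hes; split=> [[/Zset_unit[_ h] hn]|[h hn]].
  split=> // e ees hx; apply: hn; exists e => //.
  have he : frng mu = fsrc (fedge e) by rewrite -(hes _ ees).
  by exists he, he; apply/Zset_unit; rewrite -(fsnocE he).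
split; first exact/Zset_unit.
move=> [e /= ees [he [he' /Zset_unit[_ hx]]]]; apply: (hn e ees).
by rewrite (fsnocE he).
Qed.

Lemma gpd_openE (A : set (groupoid E)) : open A <->
  exists2 D : set (set (groupoid E)), D `<=` @Zbase E & \bigcup_(B in D) B = A.
Proof. by []. Qed.

Lemma unit_open_basis (U : set (unit_space E)) x : open U -> U x ->
  exists mu es, [/\ forall e, e \in es -> src e = frng mu, cylinder mu es x &
    cylinder mu es `<=` U].
Proof.
move=> [V /gpd_openE[D hD <-] <-] [B DB Bx].
have [mu [nu [es [h1 h2 eB]]]] := hD _ DB.
have emn : mu = nu by move: Bx; rewrite eB => -[/Zset_unit[]].
subst nu; exists mu, es; split=> //; first by apply/Zbasic_unit; rewrite // -eB.
by move=> y /(Zbasic_unit _ h2) hy; exists B => //; rewrite eB.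
Qed.

Lemma cylinder_open mu es : (forall e, e \in es -> src e = frng mu) ->
  open (cylinder mu es).
Proof.
move=> hes; exists (Zbasic mu mu es).
  apply/gpd_openE; exists [set Zbasic mu mu es]; last by rewrite bigcup_set1.
  by move=> _ ->; exists mu, mu, es.
by apply/seteqP; split=> x /(Zbasic_unit _ hes).
Qed.

Lemma ultra_bigU (T : Type) (F : set_system T) (I : eqType) (s : seq I)
    (A : I -> set T) : UltraFilter F ->
  F [set x | exists2 i, i \in s & A i x] -> exists2 i, i \in s & F (A i).
Proof.
move=> FU; elim: s => [|i s IH] hF.
  by have [x []] := filter_ex hF.
have [hi|hi] := in_ultra_setVsetC (A i) FU.
  by exists i; rewrite ?mem_head.
have [|j js hj] := IH; last by exists j; rewrite ?inE ?js ?orbT.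
apply: filterS (filterI hF hi) => x [[j]]; rewrite inE => /predU1P[->|js] //.
by exists j.
Qed.

(** Compactness of the cylinder sets: the finite paths whose cylinder set belongs
    to the ultrafilter satisfy the conditions of [bpath_of_prefixes]. If
    [r(nu)] is regular, [Z(nu)] is a finite union of sets [Z(nu e)], one of
    which belongs to the ultrafilter with [Z(nu)]. *)
Lemma ultra_cvg (F : set_system (unit_space E)) mu : UltraFilter F ->
  F (cylinder mu [::]) -> exists x : unit_space E,
    (forall nu, F (cylinder nu [::]) <-> bprefix nu x) /\ F --> x.
Proof.
move=> FU hmu; pose S nu := F (cylinder nu [::]).
have cylS nu nu' : (forall x, bprefix nu x -> bprefix nu' x) -> S nu -> S nu'.
  by move=> h; apply: filterS => x [/h].
have [||||x hx] := @bpath_of_prefixes E S (fsrc mu).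
- apply: cylS hmu => x [p [_ sx _]]; exact/bprefix_vert.
- move=> nu nu' h1 h2 hl; have [x [[hx _] [hx' _]]] := filter_ex (filterI h1 h2).
  exact: bprefix_comp hx hx' hl.
- by move=> nu eta h; apply: cylS => x; exact: bprefix_fcatl.
- move=> nu hnu hreg; have [es [h1 h2 h3]] := regular_edges hreg.
  have [|e ees he] := @ultra_bigU _ F _ es (fun e => cylinder (fsnoc nu e) [::]) FU.
    apply: filterS hnu => x [[p hp] _].
    have [e he] := bedge_regular h1 h3 (esym (let: And3 h _ _ := hp in h)).
    have [q hq] := concat_uncons_ex he; have [se _ _] := hp.
    have h : frng nu = fsrc (fedge e) by rewrite se (bedge_src he).
    exists e; first by rewrite h3 h.
    split=> //; rewrite (fsnocE h); exists q; exact: concat_fcat hq hp.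
  have h : frng nu = fsrc (fedge e) by move: ees; rewrite h3 => /eqP <-.
  by exists e, h; rewrite -(fsnocE h).
exists x; split=> // A; rewrite nbhsE => -[B [oB Bx] BA].
have [nu [es [h1 [h2 h3] h4]]] := unit_open_basis oB Bx.
apply: filterS BA _; apply: filterS h4 _.
have {}h2 := (hx _).2 h2; elim: es h3 {h1} => [|e es IH] h3; first exact: h2.
have hne : ~ F (cylinder (fsnoc nu e) [::]).
  by move=> /hx; apply: h3; exact: mem_head.
have [//|he] := in_ultra_setVsetC (cylinder (fsnoc nu e) [::]) FU.
have {}IH := IH (fun f fs => h3 f (mem_behead (s := e :: es) fs)).
apply: filterS (filterI he IH) => y [h [h5 h6]]; split=> // f.
by rewrite inE => /predU1P[->|/h6] // hy; apply: h.
Qed.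

Lemma cylinder_compact_open mu : Defs.compact_open (cylinder mu [::]).
Proof.
split; first exact: cylinder_open.
rewrite compact_ultra => F FU hF; have [x [hx Fx]] := ultra_cvg FU hF.
by exists x; split=> //; split=> //; apply/hx.
Qed.

(** The shortest initial segment of [mu] with which [x] does not begin gives a
    basic neighbourhood of [x] outside [Z(mu)]. *)
Lemma first_wrong_edge mu x : fsrc mu = bsrc x -> ~ bprefix mu x ->
  exists nu e (h : frng nu = fsrc (fedge e)), [/\ bprefix nu x,
    ~ bprefix (fcat h) x & forall y, bprefix mu y -> bprefix (fcat h) y].
Proof.
move: {2}(flen mu) (erefl (flen mu)) => n; elim: n mu => [|n IH] mu hl sx hx.
  case: hx; rewrite (_ : mu = fvert (fsrc mu)); first exact/bprefix_vert.
  by apply: finpath_ext => //; exact: size0nil.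
have [|nu [eta [h [e1 e2]]]] := @fpath_split E mu n; first by rewrite hl.
have [hnu|hnu] := pselect (bprefix nu x); last first.
  have [|nu' [e [h' [h1 h2 h3]]]] := IH _ e2 _ hnu; first by rewrite -sx e1.
  exists nu', e, h'; split=> // y; rewrite e1 => /bprefix_fcatl; exact: h3.
have [e ee] : exists e, eta = fedge e.
  have : flen eta = 1%N.
    by apply/eqP; rewrite -(eqn_add2l (flen nu)) -(flen_fcat h) -e1 hl e2 addn1.
  case: eta {h e1} => v [|e [|f s]] hs //= _; exists e.
  by apply: finpath_ext => //=; case/andP: hs => /eqP.
by subst eta; exists nu, e, h; split=> [||y]; rewrite -?e1.
Qed.

Definition cylinderC mu : set (unit_space E) :=
  [set x | bsrc x = fsrc mu /\ ~ bprefix mu x].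

Lemma cylinderC_compact_open mu : Defs.compact_open (cylinderC mu).
Proof.
split; last first.
  rewrite compact_ultra => F FU hF.
  have [|x [hx Fx]] := @ultra_cvg F (fvert (fsrc mu)) FU.
    by apply: filterS hF => x [sx _]; split=> //; apply/bprefix_vert.
  exists x; split=> //; split.
    apply/bprefix_vert/hx; apply: filterS hF => y [sy _].
    by split=> //; apply/bprefix_vert.
  move=> /hx hmu; have [y [[_ hn] [hy _]]] := filter_ex (filterI hF hmu).
  exact: hn.
rewrite openE => x [sx hx].
have [nu [e [h [h1 h2 h3]]]] := first_wrong_edge (esym sx) hx.
exists (cylinder nu [:: e]); split.
- by apply: cylinder_open => f; rewrite inE => /eqP ->; rewrite h.
- by split=> // f; rewrite inE => /eqP ->; rewrite (fsnocE h).
move=> y [hy /(_ e (mem_head _ _)) hn]; split; last first.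
  by move=> /h3 hy'; apply: hn; rewrite (fsnocE h).
by rewrite -sx; case: hy => p [_ -> _]; case: h1 => q [_ <- _].
Qed.

End Cylinders.

Section Diagonal.
Variables (K : fieldType) (E : digraph).
Implicit Types (mu nu : finpath E) (x : bpath E) (U V : set (bpath E)).

Definition ind U x : K := (`[< U x >])%:R.

Definition diagonal (f : bpath E -> K) : Prop :=
  exists s : seq (K * finpath E),
    forall x, f x = \sum_(t <- s) t.1 * ind (bprefix t.2) x.

Lemma eq_diagonal f g : f =1 g -> diagonal f -> diagonal g.
Proof. by move=> fg [s hs]; exists s => x; rewrite -fg. Qed.

Lemma diagonal0 : diagonal (fun=> 0).
Proof. by exists [::] => x; rewrite big_nil. Qed.

Lemma diagonalD f g : diagonal f -> diagonal g -> diagonal (fun x => f x + g x).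
Proof. by move=> [s hs] [t ht]; exists (s ++ t) => x; rewrite big_cat hs ht. Qed.

Lemma diagonalZ k f : diagonal f -> diagonal (fun x => k * f x).
Proof.
move=> [s hs]; exists [seq (k * t.1, t.2) | t <- s] => x.
by rewrite big_map hs mulr_sumr; apply: eq_bigr => t _; rewrite mulrA.
Qed.

Lemma diagonal_sum (I : Type) (r : seq I) (F : I -> bpath E -> K) :
  (forall i, diagonal (F i)) -> diagonal (fun x => \sum_(i <- r) F i x).
Proof.
move=> hF; elim: r => [|i r IH].
  by apply: eq_diagonal diagonal0 => x; rewrite big_nil.
by apply: eq_diagonal (diagonalD (hF i) IH) => x; rewrite big_cons.
Qed.

Lemma diagonal_prefix mu : diagonal (ind (bprefix mu)).
Proof. by exists [:: (1, mu)] => x; rewrite big_seq1 mul1r. Qed.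

Lemma diagonalM f g : diagonal f -> diagonal g -> diagonal (fun x => f x * g x).
Proof.
move=> [s hs] [t ht]; apply: (@eq_diagonal (fun x => \sum_(a <- s) \sum_(b <- t)
    (a.1 * b.1) * (ind (bprefix a.2) x * ind (bprefix b.2) x))).
  move=> x; rewrite hs ht mulr_suml; apply: eq_bigr => a _.
  by rewrite mulr_sumr; apply: eq_bigr => b _; rewrite mulrACA.
apply: diagonal_sum => -[k mu]; apply: diagonal_sum => -[l nu] /=.
apply: diagonalZ; rewrite /ind.
case: (path_cmpP K mu nu) => [eta h ->|eta h ->|_ hn].
- apply: eq_diagonal (diagonal_prefix (fcat h)) => x; rewrite /ind -natrM mulnb.
  congr (_%:R); congr (nat_of_bool _); apply/asboolP/andP => [hx|[_ /asboolP]//].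
  by split; apply/asboolP => //; exact: bprefix_fcatl hx.
- apply: eq_diagonal (diagonal_prefix (fcat h)) => x; rewrite /ind -natrM mulnb.
  congr (_%:R); congr (nat_of_bool _); apply/asboolP/andP => [hx|[/asboolP]//].
  by split; apply/asboolP => //; exact: bprefix_fcatl hx.
- apply: eq_diagonal diagonal0 => x; rewrite -natrM mulnb.
  by case: andP => // -[/asboolP h1 /asboolP h2]; case: hn; exists x.
Qed.

Lemma diagonalI U V : diagonal (ind U) -> diagonal (ind V) ->
  diagonal (ind (U `&` V)).
Proof.
move=> hU hV; apply: eq_diagonal (diagonalM hU hV) => x.
rewrite /ind -natrM mulnb; congr (_%:R); congr (nat_of_bool _).
by apply/andP/asboolP => [[/asboolP ? /asboolP ?]|[? ?]]; split=> //; apply/asboolP.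
Qed.

Lemma diagonal_diff U V : diagonal (ind U) -> diagonal (ind V) ->
  diagonal (ind (U `\` V)).
Proof.
move=> hU hV.
apply: eq_diagonal (diagonalD hU (diagonalZ (-1) (diagonalI hU hV))) => x.
rewrite /ind mulN1r; have [hx|hx] := pselect (U x); last first.
  by rewrite !asboolF ?subr0 // => -[].
have [hy|hy] := pselect (V x).
  by rewrite (asboolT hx) (@asboolT ((U `&` V) x)) // asboolF ?subrr // => -[].
by rewrite (asboolT hx) (@asboolF ((U `&` V) x)) ?subr0 ?asboolT // => -[].
Qed.

Lemma diagonalU U V : diagonal (ind U) -> diagonal (ind V) ->
  diagonal (ind (U `|` V)).
Proof.
move=> hU hV; apply: eq_diagonal (diagonalD hU (diagonal_diff hV hU)) => x.
rewrite /ind; have [hx|hx] := pselect (U x).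
  rewrite (asboolT hx) (@asboolT ((U `|` V) x)); last by left.
  by rewrite asboolF ?addr0 // => -[].
rewrite (asboolF hx) add0r; congr (_%:R); congr (nat_of_bool _).
by apply/asboolP/asboolP => [[]|[]]; [right | | split].
Qed.

Lemma diagonal_cylinder mu es : diagonal (ind (cylinder mu es)).
Proof.
elim: es => [|e es IH].
  apply: eq_diagonal (diagonal_prefix mu) => x; rewrite /ind.
  by congr (_%:R); congr (nat_of_bool _); apply/asboolP/asboolP => [|[]].
apply: eq_diagonal (diagonal_diff IH (diagonal_prefix (fsnoc mu e))) => x.
rewrite /ind; congr (_%:R); congr (nat_of_bool _).
apply/asboolP/asboolP => [[[h1 h2] h3]|[h1 h2]].
  by split=> // f; rewrite inE => /predU1P[->//|]; exact: h2.
split; last exact/h2/mem_head.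
by split=> // f fes; apply: h2; rewrite inE fes orbT.
Qed.

(** Otherwise the complements in [U] of its subsets with a diagonal indicator
    generate a proper filter; it has a cluster point in [U], but basic open sets
    have diagonal indicators. *)
Lemma diagonal_compact_open (U : set (unit_space E)) :
  Defs.compact_open U -> diagonal (ind U).
Proof.
move=> [oU cU]; apply: contrapT => hU.
pose F : set_system (unit_space E) := [set A |
  exists V, [/\ diagonal (ind V), V `<=` U & U `\` V `<=` A]].
have d0 : diagonal (ind set0).
  by apply: eq_diagonal diagonal0 => x; rewrite /ind asboolF.
have FF : ProperFilter F.
  apply: Build_ProperFilter_ex.
    move=> A [V [hV VU VA]]; apply: contrapT => hA; apply: hU.
    rewrite (_ : U = V) //; apply/seteqP; split=> [x Ux|//].
    by apply: contrapT => Vx; apply: hA; exists x; apply: VA.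
  split.
  - by exists set0; split=> // x [].
  - move=> A B [V [hV VU VA]] [W [hW WU WB]].
    exists (V `|` W); split; [exact: diagonalU | by move=> x [/VU|/WU] |].
    by move=> x [Ux /not_orP[Vx Wx]]; split; [exact: VA | exact: WB].
  - move=> A B AB [V [hV VU VA]]; exists V; split=> //.
    exact: subset_trans AB.
have FU : F U by exists set0; split=> // x [].
have [x [Ux hx]] := cU F FF FU.
have [mu [es [h1 h2 h3]]] := unit_open_basis oU Ux.
have [||y [[Uy hy1] hy2]] := hx (U `\` cylinder mu es) (cylinder mu es).
- by exists (cylinder mu es); split=> //; exact: diagonal_cylinder.
- by apply: open_nbhs_nbhs; split=> //; exact: cylinder_open.
- exact: hy1.
Qed.

Definition diag_elt (s : seq (K * finpath E)) : leavitt K E :=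
  \sum_(t <- s) t.1 *: lmono K t.2 t.2.

Lemma steinberg_diag U s :
  (forall x, ind U x = \sum_(t <- s) t.1 * ind (bprefix t.2) x) ->
  steinberg_iso (diag_elt s) \1_(@gunit E @` U).
Proof.
move=> hs; exists [seq (t.1, (t.2, t.2)) | t <- s]; split.
- by move=> t' /mapP[t _ ->].
- by rewrite big_map.
move=> g; rewrite big_map /= indicE.
have [[x xg]|hg] := pselect (exists x, gunit x = g); last first.
  rewrite memNset; last by move=> [x _ xg]; apply: hg; exists x.
  rewrite big1 // => t _; rewrite indicE memNset ?mulr0 //.
  move=> [p [p1 p2 p3]]; apply: hg; exists (gcod g); apply: groupoid_ext => //=.
    by rewrite p3 subrr.
  exact: concat_fun p1 p2.
subst g; transitivity (ind U x); last first.
  rewrite hs; apply: eq_bigr => t _; congr (_ * _).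
  rewrite indicE /ind; congr (_%:R); congr (nat_of_bool _).
  by apply/asboolP/idP => [h|/set_mem/Zset_unit[]//]; apply/mem_set/Zset_unit.
rewrite /ind; congr (_%:R); congr (nat_of_bool _).
apply/idP/asboolP => [/set_mem[y Uy [<-]]//|Ux].
by apply: mem_set; exists x.
Qed.

Lemma diag_elt_loc s (M : lmodule K E) x (m : M) : localized x m ->
  lact (diag_elt s) m = (\sum_(t <- s) t.1 * ind (bprefix t.2) x) *: m.
Proof.
move=> hm; rewrite lact_suml scaler_suml; apply: eq_bigr => t _.
rewrite lactZl lmonoE -scalerA /ind; congr (_ *: _).
case: asboolP => h; first by rewrite (hm _).1 // scale1r.
by rewrite (hm _).2 // pathact0 scale0r.
Qed.

(** [Res_x(M)] is the space of vectors supported at [x]: every compact open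
    neighbourhood of [x] has an indicator acting as 1 on the latter, and those
    of the form [Z(nu)] and [Z(s(nu)) \ Z(nu)] cut it out. *)
Lemma lResE (M : lmodule K E) x (m : M) : lRes x m <-> localized x m.
Proof.
split=> [hm nu|hm U [/diagonal_compact_open[s hs] Ux]]; last first.
  exists (diag_elt s), m; split; first exact: steinberg_diag.
  by rewrite (diag_elt_loc _ hm) -hs /ind asboolT // scale1r.
have actE (U : set (unit_space E)) s :
    Defs.compact_open U -> U x ->
    (forall y, ind U y = \sum_(t <- s) t.1 * ind (bprefix t.2) y) ->
    exists n, m = lact (diag_elt s) n.
  move=> cU Ux hs; have [a [n [ha ->]]] := hm U (conj cU Ux).
  by exists n; exact: steinberg_iso_act ha (steinberg_diag hs) _ _.
have prefE mu : bprefix mu x -> exists n, m = pathact mu (ghostact mu n).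
  move=> hx; have [|||n ->] := @actE (cylinder mu [::]) [:: (1, mu)].
  - exact: cylinder_compact_open.
  - by split.
  - move=> y; rewrite big_seq1 mul1r /ind; congr (_%:R); congr (nat_of_bool _).
    by apply/asboolP/asboolP => [[]|].
  by exists n; rewrite /diag_elt big_seq1 scale1r lmonoE.
have fix_prefix mu : bprefix mu x -> pathact mu (ghostact mu m) = m.
  move=> /prefE[n ->]; by rewrite ghost_path vert_ghostact.
split=> [|hx]; first exact: fix_prefix.
have sm : lact (lvert K (bsrc x)) m = m.
  have := fix_prefix _ ((bprefix_vert (bsrc x) x).2 erefl).
  by rewrite pathact_vert ghostact_vert vertvert eqxx.
have [sx|sx] := eqVneq (bsrc x) (fsrc nu); last first.
  by rewrite -sm ghostact_vert0 //; apply/eqP.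
have [|||n ->] := @actE (cylinderC nu) [:: (1, fvert (fsrc nu)); (-1, nu)].
- exact: cylinderC_compact_open.
- by split.
- move=> y; rewrite big_cons big_seq1 /= mul1r mulN1r /ind.
  have [sy|sy] := eqVneq (bsrc y) (fsrc nu); last first.
    rewrite !asboolF ?subrr //; last first.
    + by move=> [hy _]; rewrite hy eqxx in sy.
    + by move=> /bprefix_vert hy; rewrite hy eqxx in sy.
    + by move=> [p [_ hy _]]; rewrite hy eqxx in sy.
  rewrite (@asboolT (bprefix (fvert _) y)); last exact/bprefix_vert.
  have [hy|hy] := pselect (bprefix nu y).
    by rewrite (asboolT hy) asboolF ?subrr // => -[].
  by rewrite (asboolF hy) asboolT ?subr0.
rewrite /diag_elt big_cons big_seq1 /= scale1r scaleN1r lactBl !lmonoE.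
rewrite pathact_vert ghostact_vert vertvert eqxx /ghostact lactBr -!/(ghostact _ _).
by rewrite ghostact_src ghost_path vert_ghostact subrr.
Qed.

Lemma spectralE (M : lmodule K E) :
  spectral M <-> exists x (m : M), localized x m /\ m <> 0.
Proof.
split=> [[_ [x hx]]|[x [m [hm m0]]]]; last first.
  split; [by exists m | exists x => h].
  by apply: m0; have /lResE := hm; rewrite h.
exists x; apply: contrapT => hn; apply: hx; apply/seteqP; split=> m /=.
  by move=> /lResE hm; apply: contrapT => m0; apply: hn; exists m.
move=> ->; apply/lResE; exact: loc0.
Qed.

End Diagonal.

(** * Annihilators of vectors supported at a boundary path *)
Section Span.
Variables (K : fieldType) (E : digraph).
Local Notation pair := (finpath E * finpath E)%type.
Implicit Types (u w : pair) (s : seq (K * pair)) (x p q : bpath E).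
Implicit Types (M N : lmodule K E).

Definition monoact M u (m : M) : M := pathact u.1 (ghostact u.2 m).
Definition combo M s (m : M) : M := \sum_(t <- s) t.1 *: monoact t.2 m.

Lemma monoact0 M u : monoact u (0 : M) = 0.
Proof. by rewrite /monoact ghostact0 pathact0. Qed.
Lemma monoactZ M u k (m : M) : monoact u (k *: m) = k *: monoact u m.
Proof. by rewrite /monoact ghostactZ pathactZ. Qed.
Lemma monoact_sum M u (I : Type) (r : seq I) (F : I -> M) :
  monoact u (\sum_(i <- r) F i) = \sum_(i <- r) monoact u (F i).
Proof. by rewrite /monoact ghostact_sum pathact_sum. Qed.

Lemma monoactM u w : exists s,
  forall M (m : M), monoact u (monoact w m) = combo s m.
Proof.
have zero : (forall M (m : M), monoact u (monoact w m) = 0) -> exists s,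
    forall M (m : M), monoact u (monoact w m) = combo s m.
  by move=> h; exists [::] => M m; rewrite h /combo big_nil.
case: u w zero => [mu nu] [mu' nu'] zero.
case: (path_cmpP K nu mu') => [eta h e|eta h e|h _].
- have [h'|h'] := pselect (frng mu = fsrc eta).
    exists [:: (1, (fcat h', nu'))] => M m; rewrite /combo big_seq1 scale1r.
    by rewrite /monoact /= e ghost_path_fcat pathact_fcat.
  apply: zero => M m; rewrite /monoact /= e ghost_path_fcat.
  by rewrite -pathact_rng vert_pathact0 ?pathact0.
- have [h'|h'] := pselect (frng nu' = fsrc eta).
    exists [:: (1, (mu, fcat h'))] => M m; rewrite /combo big_seq1 scale1r.
    by rewrite /monoact /= e ghost_fcat_path ghostact_fcat.
  apply: zero => M m; rewrite /monoact /= e ghost_fcat_path.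
  by rewrite -(vert_ghostact nu') ghostact_vert0 ?pathact0.
- by apply: zero => M m; rewrite /monoact /= [ghostact _ _]h pathact0.
Qed.

Lemma combo_mul s s' : exists s'', forall M (m : M),
  combo s (combo s' m) = combo s'' m.
Proof.
elim: s => [|[k u] s [s1 h1]].
  by exists [::] => M m; rewrite /combo !big_nil.
have [s2 h2] : exists s2, forall M (m : M), monoact u (combo s' m) = combo s2 m.
  elim: s' {h1} => [|[l w] s' [s2 h2]].
    by exists [::] => M m; rewrite /combo !big_nil monoact0.
  have [s3 h3] := monoactM u w.
  exists ([seq (l * t.1, t.2) | t <- s3] ++ s2) => M m.
  rewrite /combo big_cons big_cat big_map /monoact ghostactD pathactD.
  rewrite -!/(monoact _ _) -/(combo s' m) h2; congr (_ + _).
  rewrite monoactZ /= h3 scaler_sumr; apply: eq_bigr => t _.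
  by rewrite scalerA.
exists ([seq (k * t.1, t.2) | t <- s2] ++ s1) => M m.
rewrite {1}/combo big_cons -/(combo s _) h1 [RHS]big_cat big_map; congr (_ + _).
by rewrite h2 scaler_sumr; apply: eq_bigr => t _; rewrite scalerA.
Qed.

(** The combination does not depend on the module: a product of two monomials
    [mu nu^*] is zero or a monomial, so these span the algebra. *)
Lemma span (a : leavitt K E) : exists s, forall M (m : M), lact a m = combo s m.
Proof.
elim/lpi_ind: a => t; elim: t => [v|e|e||a [s hs] b [s' hs']|k a [s hs]|a [s hs] b [s' hs']].
- exists [:: (1, (fvert v, fvert v))] => M m.
  rewrite /combo big_seq1 scale1r /monoact pathact_vert ghostact_vert vertvert.
  by rewrite eqxx.
- exists [:: (1, (fedge e, fvert (rng e)))] => M m.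
  rewrite /combo big_seq1 scale1r /monoact /= /fedge.
  rewrite pathact_cons fpath0 pathact_vert ghostact_vert vertvert eqxx.
  by rewrite edge_vert.
- exists [:: (1, (fvert (rng e), fedge e))] => M m.
  rewrite /combo big_seq1 scale1r /monoact /= /fedge.
  rewrite ghostact_cons fpath0 pathact_vert ghostact_vert vertvert eqxx.
  by rewrite vert_ghost.
- by exists [::] => M m; rewrite lpi0 lact0l /combo big_nil.
- by exists (s ++ s') => M m; rewrite lpiD lactDl hs hs' /combo big_cat.
- exists [seq (k * t.1, t.2) | t <- s] => M m; rewrite lpiZ lactZl hs.
  rewrite /combo big_map scaler_sumr.
  by apply: eq_bigr => t _; rewrite scalerA.
- have [s'' h] := combo_mul s s'; exists s'' => M m.
  by rewrite lpiM lactM hs hs' h.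
Qed.

Section Moves.
Variable x : bpath E.

Definition moves u q : Prop := exists2 p, concat u.2 p x & concat u.1 p q.

(* the value [x] stands for the absence of a target *)
Definition target u : bpath E :=
  if pselect (exists q, moves u q) is left h then sval (cid h) else x.

Lemma target_moves u : (exists q, moves u q) -> moves u (target u).
Proof. by move=> h; rewrite /target; case: pselect => // h'; case: cid. Qed.

Lemma moves_or_kills u : (exists q, moves u q) \/
  (forall M (m : M), localized x m -> monoact u m = 0).
Proof.
have [[p hp]|hn] := pselect (bprefix u.2 x); last first.
  by right=> M m hm; rewrite /monoact (hm _).2 ?pathact0.
have [h|h] := pselect (frng u.1 = frng u.2).
  left; have [q hq] : exists q, concat u.1 p q.
    by apply: concat_ex; rewrite h; case: hp.
  by exists q, p.
right=> M m _; rewrite /monoact -pathact_rng -vert_ghostact vertvert.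
by move/eqP/negPf: h => ->; rewrite pathact0.
Qed.

Lemma loc_target u M (m : M) : localized x m -> localized (target u) (monoact u m).
Proof.
move=> hm; have [h|h] := moves_or_kills u; last by rewrite h //; exact: loc0.
by have [p h1 h2] := target_moves h; have [] := loc_move h1 h2 hm.
Qed.

Lemma span_loc (a : leavitt K E) : exists s,
  (forall t, t \in s -> moves t.2 (target t.2)) /\
  forall M (m : M), localized x m -> lact a m = combo s m.
Proof.
have [s hs] := span a; exists [seq t <- s | `[< exists q, moves t.2 q >]].
split=> [t|M m hm]; first by rewrite mem_filter => /andP[/asboolP/target_moves].
rewrite hs /combo big_filter [RHS]big_mkcond; apply: eq_bigr => t _.
case: asboolP => // h; have [//|h'] := moves_or_kills t.2.
by rewrite h' // scaler0.
Qed.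

(** If [mu' = mu eta], then [nu mu^* mu' nu'^* = (nu eta) nu'^*], and
    symmetrically. *)
Lemma moves_back u w q : moves u q -> moves w q -> exists2 i, isotropic x i &
  forall M (m : M), monoact (u.2, u.1) (monoact w m) = monoact i m.
Proof.
case: u w => [mu nu] [mu' nu'] [p /= h1 h2] [p' /= h1' h2'].
have [n1 _ _] := h1; have [n2 _ _] := h2.
have [n1' _ _] := h1'; have [n2' _ _] := h2'.
case: (path_cmpP K mu mu') => [eta h e|eta h e|_ []]; last first.
- by exists q; [exists p | exists p'].
- have h' : frng nu' = fsrc eta by rewrite n1' -n2' h.
  have hp : concat eta p p' by apply/(concat_fcatE h p h2'); rewrite -e.
  exists (nu, fcat h'); last first.
    by move=> M m; rewrite /monoact /= e ghost_fcat_path ghostact_fcat.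
  by exists p => //=; apply: concat_fcat hp h1'.
- have h' : frng nu = fsrc eta by rewrite n1 -n2 h.
  have hp : concat eta p' p by apply/(concat_fcatE h p' h2); rewrite -e.
  exists (fcat h', nu'); last first.
    by move=> M m; rewrite /monoact /= e ghost_path_fcat pathact_fcat.
  by exists p' => //=; apply: concat_fcat hp h1.
Qed.

Lemma sum_by_target M (s : seq (K * pair)) (F : K * pair -> M) :
  (forall q, \sum_(t <- s | target t.2 == q) F t = 0) -> \sum_(t <- s) F t = 0.
Proof.
move=> h; transitivity (\sum_(q <- undup [seq target t.2 | t <- s])
    \sum_(t <- s) if target t.2 == q then F t else 0).
  rewrite exchange_big /= big_seq [RHS]big_seq; apply: eq_bigr => t ts.
  rewrite (bigD1_seq (target t.2)) ?undup_uniq //=; last first.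
    by rewrite mem_undup; apply/mapP; exists t.
  by rewrite eqxx big1 ?addr0 // => q /negPf; rewrite eq_sym => ->.
by rewrite big1 // => q _; rewrite -big_mkcond h.
Qed.

(** To compare annihilators of vectors supported at [x], only combinations of
    monomials fixing [x] matter: an element of the algebra splits, according to
    where its monomials move [x], into parts that annihilate separately. *)
Lemma ann_sub M N (m : M) (n : N) : localized x m -> localized x n ->
  (forall s, (forall t, t \in s -> isotropic x t.2) ->
     combo s m = 0 -> combo s n = 0) ->
  forall a, lact a m = 0 -> lact a n = 0.
Proof.
move=> hm hn hiso a; have [s [hs ha]] := span_loc a.
rewrite !ha // => sm0; apply: sum_by_target => q.
have gm : \sum_(t <- s | target t.2 == q) t.1 *: monoact t.2 m = 0.
  apply: (@independent K E M _ s (fun t => target t.2)) sm0 => t.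
  exact/locZ/loc_target.
have [/hasP[b bs /eqP hb]|/hasPn hno] := boolP (has (fun t => target t.2 == q) s);
    last first.
  by rewrite big_seq_cond big1 // => t /andP[/hno/negPf ->].
have mb : moves b.2 q by rewrite -hb; exact: hs.
have back (t : K * pair) : {i | t \in s -> target t.2 == q -> isotropic x i /\
    forall M (m : M), monoact (b.2.2, b.2.1) (monoact t.2 m) = monoact i m}.
  apply: cid; have [/andP[ts /eqP tq]|h] := boolP ((t \in s) && (target t.2 == q)).
    have [|i i1 i2] := @moves_back b.2 t.2 q mb; first by rewrite -tq; exact: hs.
    by exists i.
  by exists t.2 => ts tq; rewrite ts tq in h.
pose s' := [seq (t.1, sval (back t)) | t <- s & target t.2 == q].
have s'E (L : lmodule K E) (l : L) : combo s' l =
    monoact (b.2.2, b.2.1) (\sum_(t <- s | target t.2 == q) t.1 *: monoact t.2 l).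
  rewrite -big_filter monoact_sum /combo big_map big_seq [RHS]big_seq.
  apply: eq_bigr => t; rewrite mem_filter => /andP[tq ts] /=.
  by rewrite monoactZ; case: (back t) => i /= /(_ ts tq)[_ ->].
have : combo s' n = 0.
  apply: hiso; last by rewrite s'E gm monoact0.
  move=> t' /mapP[t]; rewrite mem_filter => /andP[tq ts] -> /=.
  by case: (back t) => i /= /(_ ts tq)[].
have [p h1 h2] := mb; rewrite s'E; apply: (loc_move_eq0 h2 h1).
apply: loc_sum => t /eqP <-; exact/locZ/loc_target.
Qed.

(** The monomials that move [x] contribute to components at other paths, which
    add up to zero. *)
Lemma project M (m : M) a : localized x m -> localized x (lact a m) ->
  exists2 s, forall t, t \in s -> isotropic x t.2 & lact a m = combo s m.
Proof.
move=> hm ham; have [s [hs ha]] := span_loc a.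
exists [seq t <- s | target t.2 == x].
  move=> t; rewrite mem_filter => /andP[/eqP tx /hs [p h1 h2]].
  by exists p; rewrite // -[in X in concat _ _ X]tx.
pose F (o : option (K * pair)) : M :=
  if o is Some t then t.1 *: monoact t.2 m else - lact a m.
pose Q (o : option (K * pair)) := if o is Some t then target t.2 else x.
have := @independent K E M _ (None :: map Some s) Q F x.
rewrite !big_cons /= eqxx !big_map /= -/(combo s m) -ha // addNr.
rewrite /combo big_filter => h; apply/esym/eqP; rewrite -subr_eq0 addrC.
apply/eqP/h => // -[t|] /=; [exact/locZ/loc_target | exact: locN].
Qed.

End Moves.
End Span.

(** * Isomorphisms of simple modules *)
Section Schur.
Variables (K : fieldType) (E : digraph).
Implicit Types (M N : lmodule K E) (x : bpath E).

Lemma cyclic M x (m : M) : lsimple M -> localized x m -> m <> 0 ->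
  forall m', exists a, m' = lact a m.
Proof.
move=> [_ hM] hm m0; have [|h m'|h m'] := hM [set m' | exists a, m' = lact a m].
- split.
  + by exists 0; rewrite lact0l.
  + by move=> _ _ [a ->] [b ->]; exists (a + b); rewrite lactDl.
  + by move=> k _ [a ->]; exists (k *: a); rewrite lactZl.
  + by move=> b _ [a ->]; exists (lmul b a); rewrite lactM.
- case: m0; have : [set m' | exists a, m' = lact a m] m.
    by exists (lvert K (bsrc x)); rewrite loc_src.
  by rewrite h.
- by have : [set m' | exists a, m' = lact a m] m' by rewrite h.
Qed.

Lemma schur M N (f : {linear M -> N}) : lsimple M -> lsimple N ->
  (forall a m, f (lact a m) = lact a (f m)) -> (exists m, f m <> 0) -> bijective f.
Proof.
move=> [_ hM] [_ hN] hf [m0 fm0].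
have inj : injective f.
  have [|hk|hk] := hM [set m | f m = 0].
  - split; rewrite /= ?linear0 //.
    + by move=> m n; rewrite linearD => -> ->; rewrite addr0.
    + by move=> k m; rewrite linearZ /= => ->; rewrite scaler0.
    + by move=> a m; rewrite hf => ->; rewrite lact0r.
  - move=> m n mn; apply/eqP; rewrite -subr_eq0; apply/eqP.
    have : [set m | f m = 0] (m - n) by rewrite /= linearB mn subrr.
    by rewrite hk.
  - by case: fm0; have : [set m | f m = 0] m0 by rewrite hk.
have surj n : exists m, f m = n.
  have [|hk|hk] := hN [set n | exists m, f m = n].
  - split.
    + by exists 0; rewrite linear0.
    + by move=> _ _ [m <-] [m' <-]; exists (m + m'); rewrite linearD.
    + by move=> k _ [m <-]; exists (k *: m); rewrite linearZ.
    + by move=> a _ [m <-]; exists (lact a m).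
  - case: fm0; have : [set n | exists m, f m = n] (f m0) by exists m0.
    by rewrite hk.
  - by have : [set n | exists m, f m = n] n by rewrite hk.
exists (fun n => sval (cid (surj n))) => [m|n]; last by case: cid.
by apply: inj; case: cid.
Qed.

(** The map [a m |-> a n] is well defined. *)
Lemma lisom_of_ann M N x (m : M) (n : N) : lsimple M -> lsimple N ->
  localized x m -> localized x n -> m <> 0 -> n <> 0 ->
  (forall a, lact a m = 0 -> lact a n = 0) -> lisom M N.
Proof.
move=> sM sN hm hn m0 n0 ann.
have cy := cyclic sM hm m0.
pose f m' : N := lact (sval (cid (cy m'))) n.
have fE a : f (lact a m) = lact a n.
  rewrite /f; case: cid => b /= ab; apply/esym/eqP; rewrite -subr_eq0 -lactBl.
  by apply/eqP/ann; rewrite lactBl ab subrr.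
have lf : linear f.
  move=> k m1 m2; have [a ->] := cy m1; have [b ->] := cy m2.
  by rewrite -lactZl -lactDl !fE lactDl lactZl.
pose g : {linear M -> N} := HB.pack f (GRing.isLinear.Build _ _ _ _ f lf).
have hg a m' : g (lact a m') = lact a (g m').
  have [b ->] := cy m'; rewrite -lactM /= !fE; exact: lactM.
exists g; split=> //; apply: schur => //; exists m => /=.
by rewrite -{1}(loc_src hm) fE loc_src.
Qed.

Lemma lisom_sym M N : lisom M N -> lisom N M.
Proof.
move=> [f [[g fK gK] hf]].
have lg : linear g.
  by move=> k m n; apply: (can_inj fK); rewrite linearP !gK.
exists (HB.pack g (GRing.isLinear.Build _ _ _ _ g lg) : {linear N -> M}).
split=> [|a n] /=; first by exists f.
by apply: (can_inj fK); rewrite hf !gK.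
Qed.

Lemma hom_loc M N x (f : {linear M -> N}) (m : M) :
  (forall a m, f (lact a m) = lact a (f m)) -> localized x m -> localized x (f m).
Proof.
move=> hf hm nu; split=> h; rewrite /pathact /ghostact -!hf.
  by rewrite [X in f X](hm nu).1.
by rewrite [X in f X](hm nu).2 // linear0.
Qed.

Lemma lisom_loc M N x : lisom M N ->
  (exists2 m : M, localized x m & m <> 0) -> exists2 n : N, localized x n & n <> 0.
Proof.
move=> [f [bf hf]] [m hm m0]; exists (f m); first exact: hom_loc.
by move=> h; apply: m0; apply: (bij_inj bf); rewrite h linear0.
Qed.

Lemma lisom_simple M N : lisom M N -> lsimple M -> lsimple N.
Proof.
move=> [f [[g fK gK] hf]] [[m0 hm0] hM]; split.
  exists (f m0) => h; apply: hm0; apply: (can_inj fK); by rewrite h linear0.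
move=> S [S0 SD SZ SL]; have [|h|h] := hM [set m | S (f m)].
- split=> /=; first by rewrite linear0.
  + by move=> m n h1 h2; rewrite linearD; exact: SD.
  + by move=> k m h; rewrite linearZ; exact: SZ.
  + by move=> a m h; rewrite hf; exact: SL.
- left; apply/seteqP; split=> [n Sn|_ ->] //=.
  have : [set m | S (f m)] (g n) by rewrite /= gK.
  by rewrite h /= => /(congr1 f); rewrite gK linear0.
- right; apply/seteqP; split=> // n _.
  have : [set m | S (f m)] (g n) by rewrite h.
  by rewrite /= gK.
Qed.

Lemma lisom_spectral M N : lisom M N -> spectral M -> spectral N.
Proof.
move=> h /spectralE[x [m [h1 h2]]]; apply/spectralE.
by have [n] := lisom_loc h (ex_intro2 _ _ m h1 h2); exists x, n.
Qed.

End Schur.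

(** * Closed paths and their infinite powers *)
Section ClosedPaths.
Variable E : digraph.
Implicit Types (c d : cpath E) (mu nu eta : finpath E) (x p q : bpath E).

Definition cfp c : finpath E := FPath (cwalk c).

Lemma frng_cfp c : frng (cfp c) = csrc c.
Proof. exact: cclosed. Qed.

Lemma clen_gt0 c : (0 < clen c)%N. Proof. by []. Qed.

Lemma cpath_of eta : frng eta = fsrc eta -> (0 < flen eta)%N ->
  exists c, cfp c = eta.
Proof.
case: eta => v [|e s] //= hs h _; have /eqP sv := proj1 (andP hs).
have hw : walk (src e) (e :: s) by rewrite sv.
have hc : last (rng e) (map (@rng E) s) = src e by rewrite sv.
by exists (CPath hw hc); apply: finpath_ext => //=.
Qed.

Lemma cinf_edgeD c i : cinf_edge c (clen c + i) = cinf_edge c i.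
Proof. by rewrite /cinf_edge modnDl. Qed.

Lemma cinf_edgeDM c k i : cinf_edge c (k * clen c + i) = cinf_edge c i.
Proof. by rewrite /cinf_edge modnMDl. Qed.

Lemma onth_cedges c i : (i < clen c)%N -> onth (cedges c) i = Some (cinf_edge c i).
Proof. by move=> hi; rewrite onthE (nth_map (chead c)) // /cinf_edge modn_small. Qed.

Lemma concat_cfp c : concat (cfp c) (cinf c) (cinf c).
Proof.
split=> // [|i]; first by rewrite frng_cfp.
rewrite /flen /= -/(cedges c) -/(clen c); case: ltnP => hi.
  by rewrite onth_cedges.
by rewrite -{1}(subnKC hi) cinf_edgeD.
Qed.

Lemma fixed_cinf c p : concat (cfp c) p p -> p = cinf c.
Proof.
move=> h; apply: bpath_ext; first by case: h.
elim/ltn_ind => i IH; case: (h) => _ _ ->; rewrite -[flen _]/(clen c).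
case: ltnP => hi; first by rewrite [fedges _]/(cedges c) onth_cedges.
rewrite IH /=; last by rewrite ltn_subrL clen_gt0 (leq_trans _ hi).
by rewrite -{2}(subnKC hi) cinf_edgeD.
Qed.

Lemma bpath_ext_inf (y : ipath E) x :
  (forall i, bedge x i = Some (iedge y i)) -> x = BInf y.
Proof.
move=> h; apply: bpath_ext => //.
by rewrite (bedge_src (h 0%N)).
Qed.

Lemma shift_walk (y : ipath E) a i : rng (iedge y (a + i)) = src (iedge y (a + i.+1)).
Proof. by rewrite addnS iwalk. Qed.
Definition shift (y : ipath E) a : ipath E := IPath (shift_walk y a).

Lemma shift_prefix y a :
  exists2 mu, flen mu = a & concat mu (BInf (shift y a)) (BInf y).
Proof.
elim: a => [|a [mu hl hmu]].
  exists (fvert (bsrc (BInf y))) => //.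
  rewrite (_ : BInf (shift y 0) = BInf y); first exact: concat_vert.
  exact: bpath_ext_inf.
have [|p hp] := @concat_uncons_ex E (iedge y a) (BInf (shift y a)).
  by rewrite /= addn0.
have pE : p = BInf (shift y a.+1).
  apply: bpath_ext_inf => i; rewrite -(concat_shift i hp) /=.
  by rewrite addSn add1n addnS.
subst p; have h : frng mu = fsrc (fedge (iedge y a)).
  by case: hmu => -> _ _; case: hp => _ -> _.
by exists (fcat h); [rewrite flen_fcat hl addn1 | exact: concat_fcat hp hmu].
Qed.

Lemma tail_equiv_concat mu p x : concat mu p x -> tail_equiv x p.
Proof.
move=> h; exists ((flen mu : int) - (flen (fvert (bsrc p)) : int)).
by exists mu, (fvert (bsrc p)), p; split=> //; exact: concat_vert.
Qed.

Lemma tail_equiv_sym x q : tail_equiv x q -> tail_equiv q x.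
Proof.
move=> [k [mu [nu [p [h1 h2 h3]]]]].
by exists ((flen nu : int) - (flen mu : int)), nu, mu, p.
Qed.

Lemma tail_equiv_trans x p q : tail_equiv x p -> tail_equiv p q -> tail_equiv x q.
Proof.
move=> h [k [mu [nu [z [hp hq _]]]]].
have uncons : tail_equiv x z.
  elim: (flen mu) {-2}mu (erefl (flen mu)) p h hp {hq nu} => [|n IH] [v s hs].
    move=> /size0nil /= s0; subst s => p h; rewrite fpath0.
    by move=> /concat_vertE[-> _].
  case: s hs => [|e s] hs //= [hl] p h hp.
  have [r hr] := concat_uncons_ex (concat_first hp).
  apply: (IH (FPath (proj2 (andP hs))) hl r); first exact: tail_equiv_uncons h hr.
  exact/(concat_cons hs z hr).
elim: (flen nu) {-2}nu (erefl (flen nu)) q hq => [|n IH] [v s hs].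
  move=> /size0nil /= s0; subst s => q; rewrite fpath0.
  by move=> /concat_vertE[<- _].
case: s hs => [|e s] hs //= [hl] q hq.
have [r hr] := concat_uncons_ex (concat_first hq).
apply: (tail_equiv_cons _ hr); apply: (IH (FPath (proj2 (andP hs))) hl).
exact/(concat_cons hs z hr).
Qed.

Lemma cinf_eq c d : (forall i, cinf_edge c i = cinf_edge d i) -> cinf c = cinf d.
Proof. by move=> h; apply: bpath_ext_inf => i /=; rewrite h. Qed.

Lemma cinf_eq_edge c d i : cinf c = cinf d -> cinf_edge c i = cinf_edge d i.
Proof. by move=> /(congr1 (fun x => bedge x i)) [].  Qed.

Lemma nth_flatten_nseq (T : Type) (x0 : T) k t i : (i < k * size t)%N ->
  nth x0 (flatten (nseq k t)) i = nth x0 t (i %% size t).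
Proof.
elim: k i => [|k IH] i //; rewrite mulSn /= nth_cat => hi.
case: ltnP => h; first by rewrite modn_small.
rewrite IH; last by rewrite ltn_subLR.
by rewrite -{2}(subnK h) modnDr.
Qed.

Lemma size_flatten_nseq (T : Type) k (t : seq T) :
  size (flatten (nseq k t)) = (k * size t)%N.
Proof. by elim: k => //= k IH; rewrite size_cat IH mulSn. Qed.

Lemma cpowerE c d k : cpower c d k <-> clen c = (k * clen d)%N /\ cinf c = cinf d.
Proof.
rewrite /cpower; split=> [h|[hl hi]].
  have hl : clen c = (k * clen d)%N by rewrite /clen h size_flatten_nseq.
  split=> //; apply: cinf_eq => i; rewrite /cinf_edge.
  rewrite h (set_nth_default (chead d)); last first.
    by rewrite size_flatten_nseq -/(clen d) -hl ltn_pmod // clen_gt0.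
  rewrite nth_flatten_nseq -/(clen d); last by rewrite -hl ltn_pmod // clen_gt0.
  by rewrite hl modn_dvdm // dvdn_mull.
apply: (@eq_from_nth _ (chead d)) => [|i hi']; first by rewrite size_flatten_nseq.
rewrite nth_flatten_nseq; last by rewrite -/(clen d) -hl.
have := cinf_eq_edge i hi; rewrite /cinf_edge (modn_small hi') => <-.
exact: set_nth_default.
Qed.

(** A closed path of minimal length with the same infinite power is simple. *)
Lemma root_exists c : exists2 d, simple_closed d & cinf d = cinf c.
Proof.
have [n] := ubnP (clen c); elim: n c => // n IH c hc.
have [hs|/contrapT[d [k [k2 /cpowerE[hl hi]]]]] := pselect (simple_closed c).
  by exists c.
have [|d' h1 h2] := IH d; last by exists d' => //; rewrite h2.
rewrite -ltnS; apply: leq_trans hc; rewrite ltnS hl -[X in (X < _)%N]mul1n.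
by rewrite ltn_pmul2r.
Qed.

(** The lengths of the closed paths fixing [c^oo] are the periods of the word
    [c^oo]. With [n = |c|] also their gcd is a period, and a proper divisor of
    [n] cannot be one when [c] is simple. *)
Lemma period_dvd c a : simple_closed c ->
  (forall i, cinf_edge c (a + i) = cinf_edge c i) -> (clen c %| a)%N.
Proof.
move=> hs ha; have haM k i : cinf_edge c (k * a + i) = cinf_edge c i.
  by elim: k => // k IH; rewrite mulSn -addnA ha.
set g := gcdn (clen c) a.
have hg i : cinf_edge c (g + i) = cinf_edge c i.
  case: (egcdnP a (clen_gt0 c)) => km kn hk _; rewrite -(haM kn (g + i)%N).
  by rewrite addnA -hk cinf_edgeDM.
have gdv : (g %| clen c)%N by exact: dvdn_gcdl.
have g0 : (0 < g)%N by rewrite gcdn_gt0 clen_gt0.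
have [mu hl hmu] := @shift_prefix (IPath (@cinf_walk E c)) g.
have sE : BInf (shift (IPath (@cinf_walk E c)) g) = cinf c.
  by apply: bpath_ext_inf => i /=; rewrite hg.
rewrite sE in hmu; have [d hd] : exists d, cfp d = mu.
  by apply: cpath_of; [case: hmu => -> <- | rewrite hl].
subst mu; have /esym hi := fixed_cinf hmu.
have hn : clen c = (clen c %/ g * clen d)%N by rewrite (hl : clen d = g) divnK.
have [k2|] := leqP 2 (clen c %/ g).
  by case: hs; exists d, (clen c %/ g)%N; split=> //; apply/cpowerE.
have : (0 < clen c %/ g)%N by rewrite divn_gt0 // dvdn_leq.
case k : (clen c %/ g)%N => [|[|m]] // _ _.
by have := divnK gdv; rewrite k mul1n => <-; exact: dvdn_gcdr.
Qed.

(** A word with a purely periodic tail of period [l - m] that is itself purely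
    periodic has that period. *)
Lemma shift_period_dvd c l m : simple_closed c -> (m <= l)%N ->
  (forall i, cinf_edge c (l + i) = cinf_edge c (m + i)) -> (clen c %| l - m)%N.
Proof.
move=> hs hlm h; apply: period_dvd => // i.
have hm : (m <= m * clen c)%N by rewrite leq_pmulr ?clen_gt0.
rewrite -(cinf_edgeDM c m (_ + i)) -[RHS](cinf_edgeDM c m i).
have -> : (m * clen c + (l - m + i) = l + (m * clen c - m + i))%N by lia.
by rewrite h; congr (cinf_edge c _); lia.
Qed.

Lemma cinf_iso_dvd c mu nu : simple_closed c -> isotropic (cinf c) (mu, nu) ->
  (flen mu <= flen nu)%N -> (clen c %| flen nu - flen mu)%N.
Proof.
move=> hs [p /= h1 h2] hl; apply: shift_period_dvd => // i.
have := concat_shift i h1; have := concat_shift i h2.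
by move=> <- /= [].
Qed.

(** If [nu = mu eta] with [mu p = x = nu p] and [eta] nontrivial, then [p = eta p],
    so [p = eta^oo] and [x] is rational. *)
Lemma rational_iso x y mu nu : x = BInf y -> ~ rational x ->
  isotropic x (mu, nu) -> mu = nu.
Proof.
move=> xy hr; have lt u w : isotropic x (u, w) -> ~ (flen u < flen w)%N.
  move=> [p /= h1 h2] hlt; apply: hr; split; first by exists y.
  have [eta [h e]] :=
    bprefix_comp (ex_intro _ p h1) (ex_intro _ p h2) (ltnW hlt).
  have hp : concat eta p p by apply/(concat_fcatE h p h1); rewrite -e.
  have [||c hc] := @cpath_of eta; first by case: hp => -> <-.
    by move: hlt; rewrite e flen_fcat -{1}(addn0 (flen u)) ltn_add2l.
  subst eta; exists c; rewrite -(fixed_cinf hp); exact: tail_equiv_concat h1.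
move=> hi; have [p /= h1 h2] := hi; apply: (concat_same_len h1 h2).
case: (ltngtP (flen mu) (flen nu)) => // hl; first by case: (lt _ _ hi).
by case: (lt nu mu) => //; exists p.
Qed.

Lemma concat_bvert v (hv : singular v) mu p :
  concat mu p (bvert hv) -> flen mu = 0%N.
Proof.
move=> h; apply/eqP; rewrite -leqn0 leqNgt; apply/negP => hl.
have e : None = onth (fedges mu) 0 := concat_onth h hl.
by have := onthTE (fedges mu) 0; rewrite -e -/(flen mu) hl.
Qed.

Lemma vertex_iso x mu nu : singular_vertex x -> isotropic x (mu, nu) -> mu = nu.
Proof.
move=> [v [hv ->]] [p /= h1 h2]; apply: (concat_same_len h1 h2).
by rewrite (concat_bvert h1) (concat_bvert h2).
Qed.

Lemma rotation_concat c d : rotation c d -> clen c = clen d /\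
  exists alpha, concat alpha (cinf d) (cinf c).
Proof.
move=> [i hi hd]; have hl : clen c = clen d by rewrite /clen hd size_rot.
split=> //; have [mu hmu h] := @shift_prefix (IPath (@cinf_walk E c)) i.
exists mu; rewrite (_ : cinf d = BInf (shift (IPath (@cinf_walk E c)) i)) //.
apply: bpath_ext_inf => j /=; congr Some; rewrite {1}/cinf_edge -hl hd.
rewrite (set_nth_default (chead c)); last by rewrite size_rot ltn_pmod.
rewrite /rot nth_cat size_drop -/(clen c) /cinf_edge.
have hj : (j %% clen c < clen c)%N by rewrite ltn_pmod.
rewrite -(modnDmr i j); move: (j %% clen c)%N hj => k hj; case: ltnP => h'.
  by rewrite nth_drop; congr nth; rewrite modn_small //; lia.
rewrite nth_take; last by lia.
congr nth; have -> : (i + k = clen c + (k - (clen c - i)))%N.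
  by lia.
by rewrite modnDl modn_small //; lia.
Qed.

(** Up to a shift the two infinite words agree, so each length is a period of
    the other word; by [period_dvd] the lengths are equal. *)
Lemma cinf_rotation c d : simple_closed c -> simple_closed d ->
  tail_equiv (cinf c) (cinf d) -> rotation c d.
Proof.
move=> sc sd [k [mu [nu [p [h1 h2 _]]]]].
have hp i : cinf_edge c (flen mu + i) = cinf_edge d (flen nu + i).
  by have := concat_shift i h1; rewrite -(concat_shift i h2) => -[].
have /= nu_le : (flen nu <= flen nu * clen d)%N by rewrite leq_pmulr.
pose a := (flen mu + (flen nu * clen d - flen nu))%N.
have hd i : cinf_edge d i = cinf_edge c (a + i).
  rewrite /a -addnA hp -(cinf_edgeDM d (flen nu) i).
  by congr (cinf_edge d _); lia.
have dc : (clen d %| clen c)%N.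
  by apply: period_dvd => // i; rewrite !hd addnCA cinf_edgeD.
have cd : (clen c %| clen d)%N.
  rewrite -(addnK a (clen d)); apply: shift_period_dvd => //.
    exact: leq_addl.
  by move=> i; rewrite (addnC (clen d)) -addnA -!hd cinf_edgeD.
have hl : clen c = clen d by apply/eqP; rewrite eqn_dvd cd dc.
exists (a %% clen c)%N; first by rewrite ltn_pmod.
have ha : (a %% clen c < clen c)%N by rewrite ltn_pmod.
apply: (@eq_from_nth _ (chead c)) => [|i hi]; first by rewrite size_rot.
have := hd i; rewrite {1}/cinf_edge modn_small // => e.
rewrite (set_nth_default (chead d)) // e /cinf_edge.
rewrite /rot nth_cat size_drop -[size _]/(clen c).
have {}hi : (i < clen c)%N by rewrite hl.
rewrite -(modnDml a i); move: (a %% clen c)%N ha => k' ha; case: ltnP => h'.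
  by rewrite nth_drop; congr nth; rewrite modn_small //; lia.
rewrite nth_take; last by lia.
congr nth; have -> : (k' + i = clen c + (i - (clen c - k')))%N.
  by lia.
by rewrite modnDl modn_small //; lia.
Qed.

Lemma cycle_simple c : is_cycle c -> simple_closed c.
Proof.
move=> hc [d [[|[|k]] [//= _ h]]]; move: hc; rewrite /is_cycle h.
by rewrite {c h} /cedges /= map_cat mem_cat /= mem_head orbT.
Qed.

End ClosedPaths.

(** * Vectors supported at the infinite power of a closed path *)
Section PolyAction.
Variables (K : fieldType) (E : digraph).
Implicit Types (c d : cpath E) (M N : lmodule K E) (p q f g : {poly K}).

Definition cact c M (m : M) : M := pathact (cfp c) m.
Definition pact c M p (m : M) : M := \sum_(i < size p) p`_i *: iter i (@cact c M) m.

Section Algebra.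
Variables (c : cpath E) (M : lmodule K E).
Local Notation T := (@cact c M).
Implicit Type m : M.

Lemma iter_cactD k m n : iter k T (m + n) = iter k T m + iter k T n.
Proof. by elim: k => //= k ->; rewrite /cact pathactD. Qed.
Lemma iter_cactZ k a m : iter k T (a *: m) = a *: iter k T m.
Proof. by elim: k => //= k ->; rewrite /cact pathactZ. Qed.
Lemma iter_cact0 k : iter k T 0 = 0.
Proof. by elim: k => //= k ->; rewrite /cact pathact0. Qed.
Lemma iter_cact_sum k (I : Type) (r : seq I) (P : pred I) (F : I -> M) :
  iter k T (\sum_(i <- r | P i) F i) = \sum_(i <- r | P i) iter k T (F i).
Proof.
elim/big_rec2: _ => [|i x y _ <-]; [exact: iter_cact0 | exact: iter_cactD].
Qed.

Lemma pact_wide n p m : (size p <= n)%N ->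
  pact c p m = \sum_(i < n) p`_i *: iter i T m.
Proof.
move=> hn; rewrite /pact (big_ord_widen n (fun i => p`_i *: iter i T m)) //.
rewrite big_mkcond; apply: eq_bigr => i _; case: ltnP => // h.
by rewrite nth_default // scale0r.
Qed.

Lemma pactD p q m : pact c (p + q) m = pact c p m + pact c q m.
Proof.
have [h1 h2] := (leq_maxl (size p) (size q), leq_maxr (size p) (size q)).
rewrite (pact_wide _ h1) (pact_wide _ h2) (pact_wide _ (size_polyD p q)).
by rewrite -big_split; apply: eq_bigr => i _; rewrite coefD scalerDl.
Qed.

Lemma pactZ a p m : pact c (a *: p) m = a *: pact c p m.
Proof.
rewrite (pact_wide _ (size_scale_leq a p)) scaler_sumr.
by apply: eq_bigr => i _; rewrite coefZ scalerA.
Qed.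

Lemma pact0 m : pact c 0 m = 0.
Proof. by rewrite /pact size_poly0 big_ord0. Qed.

Lemma pactC a m : pact c a%:P m = a *: m.
Proof. by rewrite (pact_wide _ (size_polyC_leq1 a)) big_ord1 coefC eqxx. Qed.

Lemma pactMX p m : pact c (p * 'X) m = cact c (pact c p m).
Proof.
have h : (size (p * 'X)%R <= (size p).+1)%N.
  by rewrite (leq_trans (size_polyMleq _ _)) // size_polyX addn2.
rewrite (pact_wide _ h) big_ord_recl coefMX eqxx scale0r add0r.
rewrite -[RHS]/(iter 1 T (pact c p m)) iter_cact_sum; apply: eq_bigr => i _.
by rewrite coefMX /= /cact pathactZ.
Qed.

Lemma pactZr p a m : pact c p (a *: m) = a *: pact c p m.
Proof.
rewrite /pact scaler_sumr; apply: eq_bigr => i _.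
by rewrite iter_cactZ !scalerA mulrC.
Qed.
Lemma pact0r p : pact c p (0 : M) = 0.
Proof. by have := pactZr p 0 (0 : M); rewrite !scale0r. Qed.

Lemma pactM p q m : pact c (p * q) m = pact c p (pact c q m).
Proof.
elim/poly_ind: p => [|p a IH]; first by rewrite mul0r !pact0.
rewrite mulrDl pactD -mulrA (mulrC 'X) mulrA pactMX IH mul_polyC pactZ.
by rewrite pactD pactMX pactC.
Qed.

Lemma pactXn k m : pact c 'X^k m = iter k T m.
Proof.
elim: k => [|k IH]; first by rewrite expr0 -[1]/(1%:P) pactC scale1r.
by rewrite exprSr pactMX IH.
Qed.

(** The vectors supported at [c^oo] form a [K[t,t^-1]]-module. *)
Lemma loc_cact m : localized (cinf c) m -> localized (cinf c) (cact c m).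
Proof. exact: loc_path (concat_cfp c). Qed.

Lemma loc_iter k m : localized (cinf c) m -> localized (cinf c) (iter k T m).
Proof. by move=> h; elim: k => //= k; exact: loc_cact. Qed.

Lemma loc_pact p m : localized (cinf c) m -> localized (cinf c) (pact c p m).
Proof. by move=> h; apply: loc_sum => i _; apply/locZ/loc_iter. Qed.

Lemma cact_eq0 m : localized (cinf c) m -> cact c m = 0 -> m = 0.
Proof.
move=> hm h; rewrite -(loc_ghost_path (concat_cfp c) hm) -/(cact c m) h.
exact: ghostact0.
Qed.

Lemma iter_cact_eq0 k m : localized (cinf c) m -> iter k T m = 0 -> m = 0.
Proof. by move=> hm; elim: k => //= k IH /(cact_eq0 (loc_iter k hm))/IH. Qed.

Lemma pact_coprime p q m : coprimep p q -> pact c p m = 0 -> pact c q m = 0 -> m = 0.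
Proof.
move=> /Bezout_coprimepP[[u v] /= /eqp_size]; rewrite size_poly1.
move=> /eqP/size_poly1P[a a0 h] hp hq.
have : pact c (u * p + v * q) m = 0 by rewrite pactD !pactM hp hq !pact0r addr0.
rewrite h pactC => /(congr1 (GRing.scale a^-1)).
by rewrite scalerA mulVf // scale1r scaler0.
Qed.

Lemma pact_irr_dvd f q m : irreducible_poly f -> m <> 0 ->
  pact c f m = 0 -> pact c q m = 0 -> f %| q.
Proof.
move=> [_ hf] m0 h1 h2; have [co|nco] := boolP (coprimep f q).
  by case: m0; exact: pact_coprime co h1 h2.
have := hf _ nco (dvdp_gcdl f q); rewrite /eqp => /andP[_ h].
by rewrite (dvdp_trans h) ?dvdp_gcdr.
Qed.

End Algebra.

Lemma cpow_exists c k : exists theta, [/\ flen theta = (k * clen c)%N,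
  concat theta (cinf c) (cinf c) &
  forall M (m : M), localized (cinf c) m -> pathact theta m = iter k (@cact c M) m].
Proof.
elim: k => [|k [theta [h1 h2 h3]]].
  exists (fvert (bsrc (cinf c))); split=> //; first exact: concat_vert.
  by move=> M m hm; rewrite pathact_vert loc_src.
have h : frng (cfp c) = fsrc theta by rewrite frng_cfp; case: h2 => _ <-.
exists (fcat h); split; first by rewrite flen_fcat h1 mulSn.
- exact: concat_fcat h2 (concat_cfp c).
- by move=> M m hm; rewrite pathact_fcat h3.
Qed.

Lemma iso_ge c mu nu : simple_closed c -> isotropic (cinf c) (mu, nu) ->
  (flen nu <= flen mu)%N -> exists2 k, (k <= flen mu)%N &
  forall M (m : M), localized (cinf c) m -> monoact (mu, nu) m = iter k (@cact c M) m.
Proof.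
move=> sc hi hl; have hi' : isotropic (cinf c) (nu, mu) by case: hi => p; exists p.
have [p /= h1 h2] := hi; have /dvdnP[k hk] := cinf_iso_dvd sc hi' hl.
exists k.
  rewrite (leq_trans _ (leq_subr (flen nu) _)) // hk leq_pmulr //; exact: clen_gt0.
have [theta [t1 t2 t3]] := cpow_exists c k.
have h : frng theta = fsrc nu by case: t2 => ->; case: h2.
have e : mu = fcat h.
  apply: (concat_same_len h1 (concat_fcat h h2 t2)).
  by rewrite flen_fcat t1 -hk subnK.
move=> M m hm; rewrite /monoact /= e pathact_fcat (loc_path_ghost h2 hm).
exact: t3.
Qed.

(** A monomial fixing [c^oo] acts as a power of [c], positive or negative;
    a negative one becomes positive after a power of [c]. *)
Lemma iso_power c mu nu : simple_closed c -> isotropic (cinf c) (mu, nu) ->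
  exists j, forall M (m : M), localized (cinf c) m ->
    iter (flen nu) (@cact c M) (monoact (mu, nu) m) = iter j (@cact c M) m.
Proof.
move=> sc hi; have [hl|/ltnW hl] := leqP (flen nu) (flen mu).
  have [k _ hk] := iso_ge sc hi hl; exists (flen nu + k)%N => M m hm.
  by rewrite hk // iterD.
have hi' : isotropic (cinf c) (nu, mu) by case: hi => p; exists p.
have [k kn hk] := iso_ge sc hi' hl; exists (flen nu - k)%N => M m hm.
have [p /= h1 h2] := hi; have [hy e] := loc_move h2 h1 hm.
by rewrite -{1}(subnK kn) iterD -hk // /monoact /= e.
Qed.

Lemma combo_poly c (s : seq (K * (finpath E * finpath E))) : simple_closed c ->
  (forall t, t \in s -> isotropic (cinf c) t.2) -> exists n p,
  forall M (m : M), localized (cinf c) m ->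
    iter n (@cact c M) (combo s m) = pact c p m.
Proof.
move=> sc; elim: s => [|[k [mu nu]] s IH] hs.
  by exists 0%N, 0 => M m hm; rewrite pact0 /combo big_nil.
have [|n [p hp]] := IH; first by move=> t ts; apply: hs; rewrite inE ts orbT.
have [j hj] := iso_power sc (hs _ (mem_head _ _)).
exists (n + flen nu)%N, (k *: 'X^(n + j) + 'X^(flen nu) * p) => M m hm.
rewrite /combo big_cons iter_cactD iter_cactZ /= [in LHS]iterD hj //.
rewrite pactD pactZ !pactXn pactM pactXn -hp // -iterD; congr (_ + _).
by rewrite addnC iterD.
Qed.

Lemma loc_combo x M (m : M) (s : seq (K * (finpath E * finpath E))) :
  (forall t, t \in s -> isotropic x t.2) -> localized x m ->
  localized x (combo s m).
Proof.
move=> hs hm; rewrite /combo big_seq; apply: loc_sum => t /hs[p h1 h2].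
by apply: locZ; case: (loc_move h2 h1 hm).
Qed.

(** Multiplied by a power of [c], a combination of the monomials fixing [c^oo] is a
    polynomial in [c], the same for both modules ([combo_poly]); it annihilates
    either vector exactly when [f] divides that polynomial. *)
Lemma rational_lisom c M N (m : M) (n : N) f : simple_closed c ->
  irreducible_poly f -> lsimple M -> lsimple N ->
  localized (cinf c) m -> localized (cinf c) n -> m <> 0 -> n <> 0 ->
  pact c f m = 0 -> pact c f n = 0 -> lisom M N.
Proof.
move=> sc irr sM sN hm hn m0 n0 fm fn.
apply: (lisom_of_ann sM sN hm hn m0 n0); apply: (ann_sub hm hn) => s hs sm.
have [k [p hp]] := combo_poly sc hs.
have := hp _ _ hm; rewrite sm iter_cact0 => /esym/(pact_irr_dvd irr m0 fm).
move=> /dvdpP[q qE]; have := hp _ _ hn; rewrite qE pactM fn pact0r.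
exact/iter_cact_eq0/loc_combo.
Qed.

(** Without isotropy at [x] a combination of the monomials fixing [x] acts on the
    vectors supported there as the sum of its coefficients. *)
Lemma nonrational_lisom x M N (m : M) (n : N) :
  (forall mu nu, isotropic x (mu, nu) -> mu = nu) -> lsimple M -> lsimple N ->
  localized x m -> localized x n -> m <> 0 -> n <> 0 -> lisom M N.
Proof.
move=> hx sM sN hm hn m0 n0.
apply: (lisom_of_ann sM sN hm hn m0 n0); apply: (ann_sub hm hn) => s hs.
have hc (L : lmodule K E) (l : L) : localized x l ->
    combo s l = (\sum_(t <- s) t.1) *: l.
  move=> hl; rewrite scaler_suml /combo big_seq [RHS]big_seq.
  apply: eq_bigr => -[a [mu nu]] /hs /= hi; congr (_ *: _).
  have e := hx _ _ hi; subst nu; have [p h _] := hi.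
  exact: loc_path_ghost h hl.
rewrite !hc // => /eqP; rewrite scaler_eq0 => /orP[/eqP->|/eqP//].
exact: scale0r.
Qed.

(** A simple module with a vector supported at [c^oo] has one annihilated by an
    irreducible polynomial in [c]: as [m] is a multiple of [m' = c m - m], some
    [c^n m] is a polynomial in [c] applied to [m'], so [t^n - q (t - 1)]
    annihilates [m]; the value of this polynomial at 1 is 1. *)
Lemma rational_poly c M (m : M) : simple_closed c -> lsimple M ->
  localized (cinf c) m -> m <> 0 -> exists f : lpoly K,
    exists2 m' : M, localized (cinf c) m' /\ m' <> 0 & pact c f m' = 0.
Proof.
move=> sc sM hm m0.
pose P k := `[< exists p : {poly K}, p != 0 /\ size p = k /\
  exists m' : M, [/\ localized (cinf c) m', m' <> 0 & pact c p m' = 0] >].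
have exP : exists k, P k.
  suff [p [p0 hp]] : exists p : {poly K}, p != 0 /\ pact c p m = 0.
    exists (size p); apply/asboolP; exists p; split=> //; split=> //.
    by exists m.
  (* [c m - m] is zero or generates the module *)
  pose m' := pact c ('X - 1) m.
  have [m'0|m'0] := pselect (m' = 0).
    by exists ('X - 1); rewrite polyXsubC_eq0.
  have hm' : localized (cinf c) m' by exact: loc_pact.
  have [a ha] := cyclic sM hm' m'0 m.
  have [|s hs e] := @project K E (cinf c) M m' a hm'; first by rewrite -ha.
  have [n [q hq]] := combo_poly sc hs; exists ('X^n - q * ('X - 1)); split.
    apply/eqP => /(congr1 (fun p => p.[1])); rewrite !hornerE subrr mulr0 expr1n subr0.
    by apply/eqP; exact: oner_neq0.
  rewrite pactD -scaleN1r pactZ pactM pactXn -/m' -hq // -e -ha scaleN1r.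
  by rewrite subrr.
case: (ex_minnP exP) => k /asboolP[f [f0 [fk [m' [hm' m'0 fm']]]]] kmin.
have minf (p : {poly K}) (n : M) : p != 0 -> localized (cinf c) n -> n <> 0 ->
    pact c p n = 0 -> (size f <= size p)%N.
  move=> p0 hn n0 pn; rewrite fk; apply/kmin/asboolP; exists p.
  by split=> //; split=> //; exists n.
have lf0 : lead_coef f != 0 by rewrite lead_coef_eq0.
pose g := (lead_coef f)^-1 *: f.
have fg : f %= g by rewrite eqp_sym eqp_scale // invr_eq0.
have irr : irreducible_poly f.
  split=> [|q q1 qf].
    rewrite ltnNge; apply/negP => /size1_polyC fC.
    apply: m'0; move: fm' f0; rewrite fC pactC polyC_eq0 => /eqP.
    by rewrite scaler_eq0 => /orP[/eqP-> /eqP//|/eqP->].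
  have /dvdpP[h fE] := qf.
  have q0 : q != 0 by apply: contraNneq f0 => q0; rewrite fE q0 mulr0.
  have h0 : h != 0 by apply: contraNneq f0 => h0; rewrite fE h0 mul0r.
  rewrite -dvdp_size_eqp // eqn_leq dvdp_leq //=.
  have [qm|qm] := pselect (pact c q m' = 0); first exact: minf qm.
  have : (size f <= size h)%N.
    apply: (minf _ (pact c q m')) => //; first exact: loc_pact.
    by rewrite -pactM -fE.
  rewrite fE size_mul // -[X in (_ <= X)%N]add0n.
  case: (size q) (size_poly_eq0 q) q1 => [|[|n]] //; first by rewrite (negPf q0).
  by rewrite addnS /= -(addn0 (size h)) -addnA leq_add2l.
have girr : monic_irreducible_poly g.
  split; last by rewrite monicE lead_coefZ mulVf.
  case: irr => s1 s2; split; first by rewrite -(eqp_size fg).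
  by move=> q q1; rewrite -(eqp_dvdr q fg) -(eqp_rtrans fg); exact: s2.
have gm' : pact c g m' = 0 by rewrite pactZ fm' scaler0.
have gX : g != 'X.
  apply: contra_notN m'0 => /eqP gX; apply: (iter_cact_eq0 (k := 1) hm').
  by rewrite -pactXn expr1 -gX.
by exists (LPoly girr gX), m'.
Qed.

Lemma monic_irr_eq (f g : lpoly K) : f %| g -> f = g :> {poly K}.
Proof.
have [[fs _] fm] := lp_irr f; have [[gs gi] gm] := lp_irr g.
move=> fg; apply/eqP; rewrite -eqp_monic //; apply: gi => //.
by rewrite neq_ltn fs orbT.
Qed.

(** Writing [n = a m], some [c^k n] is a polynomial in [c] applied to [m]; so [f(c)]
    annihilates [n] as well. *)
Lemma rational_poly_uniq c M (m n : M) (f g : lpoly K) : simple_closed c ->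
  lsimple M -> localized (cinf c) m -> localized (cinf c) n -> m <> 0 -> n <> 0 ->
  pact c f m = 0 -> pact c g n = 0 -> f = g :> {poly K}.
Proof.
move=> sc sM hm hn m0 n0 fm gn; apply: monic_irr_eq.
have [[fi _] [gi _]] := (lp_irr f, lp_irr g).
have [a ha] := cyclic sM hm m0 n.
have [|s hs e] := @project K E (cinf c) M m a hm; first by rewrite -ha.
have [k [q hq]] := combo_poly sc hs.
apply: (pact_irr_dvd fi n0 _ gn); apply: (iter_cact_eq0 (k := k)).
  exact: loc_pact.
rewrite -pactXn -pactM mulrC pactM pactXn ha e hq // -pactM mulrC pactM fm.
exact: pact0r.
Qed.

Lemma lisom_pact c M N f : lisom M N ->
  (exists2 m : M, localized (cinf c) m /\ m <> 0 & pact c f m = 0) ->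
  exists2 n : N, localized (cinf c) n /\ n <> 0 & pact c f n = 0.
Proof.
move=> [h [bh hh]] [m [hm m0] fm]; exists (h m).
  split; first exact: hom_loc.
  by move=> e; apply: m0; apply: (bij_inj bh); rewrite e linear0.
have it k : iter k (@cact c N) (h m) = h (iter k (@cact c M) m).
  by elim: k => //= k ->; rewrite /cact /pathact hh.
rewrite /pact; under eq_bigr do rewrite it -linearZ.
by rewrite -linear_sum -/(pact c f m) fm linear0.
Qed.

(** A path [alpha] with [c alpha = alpha d] intertwines the two actions. *)
Lemma rotation_pact c d M (m : M) f : rotation c d ->
  localized (cinf d) m -> m <> 0 -> pact d f m = 0 ->
  exists2 n : M, localized (cinf c) n /\ n <> 0 & pact c f n = 0.
Proof.
move=> /rotation_concat[hl [alpha ha]] hm m0 fm; exists (pathact alpha m).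
  split; first exact: loc_path ha hm.
  by move=> h; apply: m0; rewrite -(loc_ghost_path ha hm) h ghostact0.
have h1 : frng (cfp c) = fsrc alpha by rewrite frng_cfp; case: ha => _ <-.
have h2 : frng alpha = fsrc (cfp d) by case: ha.
have e : fcat h1 = fcat h2.
  apply: (concat_same_len (concat_fcat h1 ha (concat_cfp c))
            (concat_fcat h2 (concat_cfp d) ha)).
  by rewrite !flen_fcat addnC; congr (_ + _)%N.
have it k : iter k (@cact c M) (pathact alpha m) = pathact alpha (iter k (@cact d M) m).
  elim: k => //= k ->; rewrite /cact -pathact_fcat e pathact_fcat.
  by [].
rewrite /pact; under eq_bigr do rewrite it -pathactZ.
by rewrite -pathact_sum -/(pact d f m) fm pathact0.
Qed.

End PolyAction.

(** * The modules of a tail-equivalence class *)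
Section Weighted.
Variables (K F : fieldType) (phi : {rmorphism K -> F}) (E : digraph) (x : bpath E).
Variables (w : edge E -> bpath E -> F) (hw : forall e q, w e q != 0).
Local Notation B := (bclass x).
Local Notation V := {malg F[B]}.
Local Notation W := (Defs.restrict phi (weighted_chen x hw)).
Implicit Types (p q : B) (l : F) (g : W).

Definition bas q l : W := (<< l *g q >> : V).

Lemma basE q l : bas q l = (l *: << q >> : V).
Proof.
by apply/malgP => k; rewrite mcoeffZ !mcoeffU mulr_natr.
Qed.

Lemma basD q l l' : bas q (l + l') = bas q l + bas q l'.
Proof.
have h : (<< l + l' *g q >> : V) = << l *g q >> + << l' *g q >>.
  by apply/malgP => k; rewrite mcoeffD !mcoeffU mulrnDl.
exact: h.
Qed.

Lemma bas0 q : bas q 0 = 0.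
Proof.
have h : (<< 0 *g q >> : V) = 0 by apply/malgP => k; rewrite mcoeffU mul0rn mcoeff0.
exact: h.
Qed.

Lemma basZ q k l : k *: bas q l = bas q (phi k * l).
Proof. by rewrite !basE -[LHS]/(phi k *: (l *: << q >> : V)) scalerA. Qed.

Lemma bas_eq0 q l : bas q l = 0 -> l = 0.
Proof.
by move=> /(congr1 (fun g : V => g@_q)); rewrite mcoeffUU mcoeff0.
Qed.

Lemma wact_pi (t : lterm K E) g : lact (lpi t) g =
  interp (@op_vert F E x) (@op_edge F E x w) (@op_ghost F E x w)
    (tmap phi (fun=> 1) t) (g : V).
Proof.
have h := @weighted_chen_pi F E x w hw (tmap phi (fun=> 1) t) g.
rewrite -[RHS]h; congr (lact (l := weighted_chen x hw) _ _).
exact: (lmap_pi phi (@one_neq0 E F)).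
Qed.

Lemma wact_vert v g : lact (lvert K v) g = (op_vert F x v (g : V)).
Proof. exact: wact_pi. Qed.
Lemma wact_edge e g : lact (ledge K e) g = (op_edge x w e (g : V)).
Proof. exact: etrans (wact_pi (TEdge K e) g) (scale1r (op_edge x w e (g : V))). Qed.
Lemma wact_ghost e g : lact (lghost K e) g = (op_ghost x w e (g : V)).
Proof.
rewrite [LHS](wact_pi (TGhost K e) g) /= invr1.
exact: (scale1r (op_ghost x w e (g : V))).
Qed.

Lemma bas_vert v q l : lact (lvert K v) (bas q l) = if bsrc q == v then bas q l else 0.
Proof.
rewrite wact_vert basE linearZ /= op_vertE; case: eqP => // _.
exact: scaler0.
Qed.
Lemma bas_edge e p q l : concat (fedge e) p q ->
  lact (ledge K e) (bas p l) = bas q (w e q * l).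
Proof.
by move=> h; rewrite wact_edge !basE linearZ /= (op_edgeE w h) scalerA mulrC.
Qed.
Lemma bas_ghost e p q l : concat (fedge e) p q ->
  lact (lghost K e) (bas q l) = bas p ((w e q)^-1 * l).
Proof.
by move=> h; rewrite wact_ghost !basE linearZ /= (op_ghostE w h) scalerA mulrC.
Qed.
Lemma bas_ghost0 e q l : bedge q 0 <> Some e -> lact (lghost K e) (bas q l) = 0.
Proof.
move=> h; rewrite wact_ghost !basE linearZ /= (op_ghost0 w h).
exact: scaler0.
Qed.

(** The weights of an edge and of its ghost cancel in [nu nu^*]. *)
Lemma bas_loc q l : localized (bval q) (bas q l).
Proof.
case=> v s; elim: s v q l => [|e s IH] v q l hs.
  rewrite fpath0 pathact_vert ghostact_vert vertvert eqxx bas_vert.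
  by split=> /bprefix_vert; [move=> ->; rewrite eqxx | move=> /eqP/negPf ->].
rewrite pathact_cons ghostact_cons.
have [he|he] := pselect (bedge q 0 = Some e); last first.
  rewrite bas_ghost0 // ghostact0; by split=> // -[r /concat_first/he].
have [p hp] := bclass_uncons he; rewrite (bas_ghost _ hp).
have [h1 h2] := IH _ p ((w e q)^-1 * l) (proj2 (andP hs)).
split=> [/(bprefix_cons hs hp)/h1 ->|hn]; last by apply: h2 => /(bprefix_cons hs hp).
by rewrite (bas_edge _ hp) mulrA mulfV // mul1r.
Qed.

Lemma wexpand g : g = \sum_(q <- msupp (g : V)) bas q ((g : V)@_q).
Proof. exact: (monalgE (g : V)). Qed.

(** Comparing components, a vector supported at [y] has no basis element other
    than [y] in its support. *)
Lemma wloc_inv y g : localized y g -> g <> 0 ->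
  exists q l, [/\ bval q = y, g = bas q l & l != 0].
Proof.
move=> hg g0.
have supp q : q \in msupp (g : V) -> bval q = y.
  move=> qs; apply: contrapT => qy.
  pose Q (o : option B) := if o is Some k then bval k else y.
  pose G (o : option B) : W := if o is Some k then bas k ((g : V)@_k) else - g.
  have := @independent K E W _ (None :: map Some (enum_fset (msupp (g : V)))) Q G (bval q).
  rewrite !big_cons !big_map /= -wexpand addNr.
  have -> : (y == bval q) = false by apply/eqP => h; apply: qy.
  rewrite (eq_bigl (fun k => k == q)); last first.
    by move=> k; apply/eqP/eqP => [/bclass_ext|->].
  rewrite -big_filter filter_pred1_uniq ?fset_uniq // big_seq1 => h.
  have /bas_eq0/eqP : bas q ((g : V)@_q) = 0.
    apply: h => // -[k|] /=; [exact: bas_loc | exact: locN].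
  by rewrite mcoeff_eq0 qs.
have [q qs] : exists q, q \in msupp (g : V).
  apply/fset0Pn; apply/eqP => h; apply: g0; rewrite (wexpand g) h.
  by rewrite big_seq_fset0.
exists q, ((g : V)@_q); split; [exact: supp | | by rewrite mcoeff_neq0].
rewrite {1}(wexpand g) (bigD1_seq q) ?fset_uniq //= big_seq_cond big1 ?addr0 //.
move=> k /andP[ks]; case/eqP; apply: bclass_ext; by rewrite (supp _ ks) (supp _ qs).
Qed.

Lemma wbase : exists q : B, bval q = x.
Proof. by exists (BClass (tail_equiv_refl x)). Qed.

(** A nonzero submodule contains a component of each of its vectors, hence
    multiples of [x]; if it then contains all of them it is everything. *)
Lemma wsimple (q0 : B) : bval q0 = x ->
  (forall (N : set W) l, lsubmodule N -> l != 0 -> N (bas q0 l) ->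
    forall l', N (bas q0 l')) ->
  lsimple W.
Proof.
move=> q0x hN; split.
  by exists (bas q0 1) => /bas_eq0/eqP; rewrite oner_eq0.
move=> N sN; have [N0 ND NZ NL] := sN.
have [[g [Ng g0]]|hno] := pselect (exists g, N g /\ g <> 0); last first.
  left; apply/seteqP; split=> [g Ng|_ ->] //=.
  by apply: contrapT => g0; apply: hno; exists g.
right; apply/seteqP; split=> // h _.
have NM u (m : W) : N m -> N (pathact u.1 (ghostact u.2 m)).
  by move=> hm; apply/NL/NL.
have [q [l [Nq l0]]] : exists q l, N (bas q l) /\ l != 0.
  have [q qs] : exists q, q \in msupp (g : V).
    apply/fset0Pn; apply/eqP => h0; apply: g0.
    by rewrite (wexpand g) h0 big_seq_fset0.
  exists q, ((g : V)@_q); split; last by rewrite mcoeff_neq0.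
  have [a ha] := @component K E _ (enum_fset (msupp (g : V))) (fun k : B => bval k) (bval q).
  have := ha W (fun k => bas k ((g : V)@_k)); rewrite -wexpand.
  rewrite (eq_bigl (fun k => k == q)); last first.
    by move=> k; apply/eqP/eqP => [/bclass_ext|->].
  rewrite -big_filter filter_pred1_uniq ?fset_uniq // big_seq1 => ->; first exact: NL.
  by move=> k; exact: bas_loc.
have toq0 k r : r != 0 -> N (bas k r) -> exists2 r', r' != 0 & N (bas q0 r').
  move=> r0 Nk; have [d [mu [nu [p [h1 h2 _]]]]] := bvalP k.
  have [hl hb] := loc_move h2 h1 (bas_loc k r).
  have [|k' [r' [e1 e2 e3]]] := wloc_inv hl.
    move=> e; move: hb; rewrite e ghostact0 pathact0 => /esym/bas_eq0/eqP.
    by rewrite (negPf r0).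
  exists r' => //; have -> : q0 = k' by apply: bclass_ext; rewrite e1 q0x.
  by rewrite -e2; exact: (NM (mu, nu)).
have [r r0 Nr] := toq0 _ _ l0 Nq.
have all0 := hN N r sN r0 Nr.
rewrite (wexpand h); elim/big_rec: _ => // k m _ Nm; apply: ND => //.
have [->|r0'] := eqVneq ((h : V)@_k) 0; first by rewrite bas0.
have [d [mu [nu [p [h1 h2 _]]]]] := bvalP k.
have [hl hb] := loc_move h2 h1 (bas_loc k (h : V)@_k).
have [|k' [r' [e1 e2 e3]]] := wloc_inv hl.
  move=> e; move: hb; rewrite e ghostact0 pathact0 => /esym/bas_eq0/eqP.
  by rewrite (negPf r0').
have ek : q0 = k' by apply: bclass_ext; rewrite e1 q0x.
rewrite -hb e2 -ek; exact: (NM (nu, mu)) (all0 r').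
Qed.

Lemma wspectral : spectral W.
Proof.
have [q qx] := wbase; apply/spectralE; exists x, (bas q 1).
split; first by have := bas_loc q 1; rewrite qx.
by move=> /bas_eq0/eqP; rewrite oner_eq0.
Qed.

Lemma wloc : exists2 m : W, localized x m & m <> 0.
Proof.
have [q qx] := wbase; exists (bas q 1).
  by have := bas_loc q 1; rewrite qx.
by move=> /bas_eq0/eqP; rewrite oner_eq0.
Qed.

Lemma wloc_class y : (exists2 m : W, localized y m & m <> 0) -> tail_equiv x y.
Proof. by move=> [m hm /(wloc_inv hm)[q [l [<- _ _]]]]; exact: bvalP. Qed.

End Weighted.

Section ChenModule.
Variables (K : fieldType) (E : digraph).
Implicit Types (x y : bpath E).

Lemma lmap_id (a : leavitt K E) : lmap idfun (fun=> 1) a = a.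
Proof.
elim/lpi_ind: a => t; rewrite lmap_pi; last exact: one_neq0.
elim: t => //= [e|e|s hs t ht|k s hs|s hs t ht].
- by rewrite lpiZ scale1r.
- by rewrite lpiZ invr1 scale1r.
- by rewrite !lpiD hs ht.
- by rewrite !lpiZ hs.
- by rewrite !lpiM hs ht.
Qed.

Lemma chen_restrict x : lisom (Defs.restrict idfun (chen K x)) (chen K x).
Proof.
have lf : linear (idfun : Defs.restrict idfun (chen K x) -> chen K x) by [].
exists (HB.pack idfun (GRing.isLinear.Build _ _ _ _ _ lf)
  : {linear Defs.restrict idfun (chen K x) -> chen K x}).
split; first by exists idfun.
by move=> a m /=; rewrite -[LHS]/(pull_act _ _ _) /pull_act lmap_id.
Qed.

Lemma chen_simple x : lsimple (chen K x).
Proof.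
apply: (lisom_simple (chen_restrict x)).
have [q qx] := wbase x; apply: (wsimple qx) => N l [_ _ NZ _] l0 Nl l'.
have := NZ (l' / l) _ Nl; by rewrite basZ divfK.
Qed.

Lemma chen_spectral x : spectral (chen K x).
Proof. exact: lisom_spectral (chen_restrict x) (wspectral _ _ _). Qed.

Lemma chen_loc x : exists2 m : chen K x, localized x m & m <> 0.
Proof. exact: lisom_loc (chen_restrict x) (wloc _ _ _). Qed.

Lemma chen_loc_class x y :
  (exists2 m : chen K x, localized y m & m <> 0) -> tail_equiv x y.
Proof.
move=> h; have := lisom_loc (lisom_sym (chen_restrict x)) h.
exact: wloc_class.
Qed.

End ChenModule.

(** * The modules of the infinite power of a closed path *)
Section ChenPoly.
Variables (K : fieldType) (E : digraph) (c : cpath E) (f : lpoly K).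
Hypothesis sc : simple_closed c.
Local Notation W := (chen_poly c f).
Local Notation x := (cinf c).
Local Notation B := (bclass x).
Local Notation bas := (@bas K (lpfield f) (in_alg (lpfield f)) E x
  (@cweight K E c f) (@cweight_neq0 K E c f)).
Implicit Types (q k : B) (l : lpfield f).

Lemma cweight_later q e : later_turn c q -> cweight c f e q = 1.
Proof. by move=> h; rewrite /cweight asboolT // andbF. Qed.

(** This is where simplicity of [c] matters: otherwise [c^oo] is also one of its
    own proper shifts within a turn. *)
Lemma not_later_turn : ~ later_turn c x.
Proof.
move=> [i [/andP[i0 hi] h]]; have : (clen c %| i)%N.
  by apply: period_dvd => // j; have [] := h j.
by move=> /(dvdn_leq i0); rewrite leqNgt hi.
Qed.

(** Every edge of a turn but the first one has weight 1. *)
Lemma later_path (q : B) s v (hs : walk v s) k i l : bval q = x ->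
  concat (FPath hs) q k -> (forall j, bedge k j = Some (cinf_edge c (i + j))) ->
  (0 < i)%N -> (i + size s)%N = clen c ->
  pathact (FPath hs) (bas q l) = bas k l.
Proof.
move=> qx; elim: s v hs k i => [|e s IH] v hs k i hk hi i0 hl.
  move: hk; rewrite fpath0 => /concat_vertE[/bclass_ext qk kv].
  by rewrite pathact_vert bas_vert qk kv eqxx.
have [k' hk'] := bclass_uncons (concat_first hk).
rewrite pathact_cons (IH _ _ k' i.+1) //; last first.
- by rewrite -hl /= addSnnS.
- by move=> j; rewrite -(concat_shift j hk') hi /= addnCA addnA.
- exact/(concat_cons hs q hk').
rewrite (bas_edge _ _ _ hk') cweight_later ?mul1r //; exists i; split=> //.
by rewrite i0 -hl /= addnS ltnS leq_addr.
Qed.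

(** One turn around [c] collects the factor [tbar] exactly once, so [c] acts on
    the multiples of [c^oo] by multiplication with [tbar]. *)
Lemma cact_bas q l : bval q = x -> cact c (bas q l) = bas q (tbar f * l).
Proof.
move=> qx; have h0 : bedge q 0 = Some (chead c).
  by rewrite qx /= /cinf_edge mod0n.
have [q' hq'] := bclass_uncons h0.
have hq : concat (cfp c) q q by rewrite qx; exact: concat_cfp.
rewrite /cact /cfp pathact_cons (@later_path q _ _ _ q' 1) //.
- rewrite (bas_edge _ _ _ hq') /cweight eqxx /= asboolF //.
  by rewrite qx; exact: not_later_turn.
- exact/(concat_cons (cwalk c) q hq').
- by move=> j; rewrite -(concat_shift j hq') qx.
Qed.

Lemma pact_bas q l p : bval q = x ->
  pact c p (bas q l) = bas q ((in_qpoly f p : lpfield f) * l).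
Proof.
move=> qx; elim/poly_ind: p => [|p a IH].
  by rewrite pact0 in_qpoly0 mul0r bas0.
rewrite pactD pactMX pactC IH cact_bas // basZ -basD; congr (bas _ _).
rewrite in_qpolyD in_qpolyM mulrDl mulrA (mulrC (tbar f)); congr (_ + _ * _).
by rewrite -[in RHS](mulr1 a%:P) mul_polyC in_qpolyZ in_qpoly1.
Qed.

Lemma chen_poly_simple : lsimple W.
Proof.
have [q qx] := wbase x; apply: (wsimple qx) => N l [N0 ND NZ NL] l0 Nl l'.
have NP p m : N m -> N (pact c p m).
  move=> Nm; rewrite /pact; elim/big_rec: _ => // i y _ Ny; apply: ND => //.
  by apply: NZ; elim: (nat_of_ord i) => //= j; exact: NL.
(* every element of the field [K[t]/(f)] is a polynomial in [tbar] *)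
pose p : {poly K} := val (l' / l).
have := NP p _ Nl; rewrite pact_bas //.
rewrite (_ : in_qpoly f p = (l' / l) :> lpfield f) ?divfK //.
apply: val_inj; apply: (@in_qpoly_small K f p); exact: size_mk_monic.
Qed.

Lemma chen_poly_spectral : spectral W. Proof. exact: wspectral. Qed.

Lemma chen_poly_loc : exists2 m : W, localized x m & m <> 0.
Proof. exact: wloc. Qed.

Lemma chen_poly_loc_class y : (exists2 m : W, localized y m & m <> 0) ->
  tail_equiv x y.
Proof. exact: wloc_class. Qed.

Lemma chen_poly_ann : exists2 m : W, localized x m /\ m <> 0 & pact c f m = 0.
Proof.
have [q qx] := wbase x; exists (bas q 1).
  split; last by move=> /bas_eq0/eqP; rewrite oner_eq0.
  have : localized (bval q) (bas q 1) by exact: bas_loc.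
  by rewrite qx.
rewrite pact_bas // (_ : in_qpoly f f = 0) ?mul0r ?bas0 //.
apply: val_inj; rewrite /= mk_monicE; last exact: lp_irr.
by rewrite Pdiv.RingMonic.rmodpp //; case: (lp_irr f).
Qed.

End ChenPoly.

(** * Finite-dimensional modules *)
Section DiagonalOperators.
Variables (K : fieldType) (E : digraph) (M : lmodule K E).
Implicit Types (mu nu eta : finpath E) (m : M).

(** The idempotents [nu nu^*]; they commute. *)
Definition dg nu m : M := pathact nu (ghostact nu m).

Lemma dgD nu m n : dg nu (m + n) = dg nu m + dg nu n.
Proof. by rewrite /dg ghostactD pathactD. Qed.
Lemma dgZ nu k m : dg nu (k *: m) = k *: dg nu m.
Proof. by rewrite /dg ghostactZ pathactZ. Qed.
Lemma dg0 nu : dg nu 0 = 0.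
Proof. by rewrite /dg ghostact0 pathact0. Qed.
Lemma dgB nu m n : dg nu (m - n) = dg nu m - dg nu n.
Proof. by rewrite dgD -scaleN1r dgZ scaleN1r. Qed.
Lemma dg_sum nu (I : Type) (r : seq I) (P : pred I) (F : I -> M) :
  dg nu (\sum_(i <- r | P i) F i) = \sum_(i <- r | P i) dg nu (F i).
Proof. by rewrite /dg ghostact_sum pathact_sum. Qed.

Lemma dg_fcat mu eta (h : frng mu = fsrc eta) m :
  dg mu (dg (fcat h) m) = dg (fcat h) m /\ dg (fcat h) (dg mu m) = dg (fcat h) m.
Proof.
rewrite /dg; split; first by rewrite ghost_path_fcat -pathact_fcat.
by rewrite ghost_fcat_path -ghostact_fcat.
Qed.

Lemma dg_idem nu m : dg nu (dg nu m) = dg nu m.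
Proof. by rewrite /dg ghost_path vert_ghostact. Qed.

Lemma dgC mu nu m : dg mu (dg nu m) = dg nu (dg mu m).
Proof.
case: (path_cmpP K mu nu) => [eta h ->|eta h ->|h1 _].
- by have [-> ->] := dg_fcat h m.
- by have [-> ->] := dg_fcat h m.
case: (path_cmpP K nu mu) => [eta h ->|eta h ->|h2 _].
- by have [-> ->] := dg_fcat h m.
- by have [-> ->] := dg_fcat h m.
by rewrite /dg /ghostact /pathact h1 h2 !lact0r.
Qed.

Lemma vert_sum m : exists s : seq (vertex E * M),
  m = \sum_(t <- s) lact (lvert K t.1) t.2.
Proof.
have [r ->] := lact_unital m; elim: r => [|[a n] r [s hs]].
  by exists [::]; rewrite !big_nil.
have [c hc] := span a.
exists ([seq (fsrc t.2.1, t.1 *: monoact t.2 n) | t <- c] ++ s).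
rewrite big_cons big_cat big_map /= hs hc; congr (_ + _).
by apply: eq_bigr => t _; rewrite lactZr /monoact vert_pathact.
Qed.

(** The sum of the vertices occurring in a decomposition of [m] fixes [m]. *)
Lemma vert_faithful m : (forall v, lact (lvert K v) m = 0) -> m = 0.
Proof.
move=> h; have [s ms] := vert_sum m.
transitivity (\sum_(v <- undup (map fst s)) lact (lvert K v) m); last first.
  by rewrite big1.
rewrite {2}ms; under eq_bigr => v _ do rewrite lact_sumr.
rewrite exchange_big /= {1}ms big_seq [RHS]big_seq; apply: eq_bigr => t ts.
rewrite (bigD1_seq t.1) ?undup_uniq ?mem_undup ?map_f //= vertvert eqxx.
by rewrite big1 ?addr0 // => v /negPf vt; rewrite vertvert vt.
Qed.

(** The paths [nu] for which [nu nu^*] fixes the vector satisfy the conditions of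
    [bpath_of_prefixes]; the last one comes from the relation
    [r(nu) = \sum_e e e^*] at a regular vertex. *)
Lemma localized_of_dg m : m <> 0 -> (forall nu, dg nu m = m \/ dg nu m = 0) ->
  exists x, localized x m.
Proof.
move=> m0 hm; have nz nu : dg nu m <> 0 -> dg nu m = m by case: (hm nu) => ->.
have [v hv] : exists v, lact (lvert K v) m <> 0.
  apply: contrapT => hn; apply: m0; apply: vert_faithful => v.
  by apply: contrapT => hv; apply: hn; exists v.
have [||||x hx] := @bpath_of_prefixes E (fun nu => dg nu m = m) v.
- by apply: nz; rewrite /dg pathact_vert ghostact_vert vertvert eqxx.
- move=> mu nu h1 h2 /fpath_split[mu' [eta [h [e1 e2]]]].
  have [e|hne] := pselect (mu = mu'); first by subst mu'; exists eta, h.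
  case: m0; rewrite -h1 -h2 e1 /dg pathact_fcat ghost_path0 ?pathact0 //.
- by move=> mu eta h e; rewrite -{1}e (dg_fcat h m).1.
- move=> nu hnu hreg; have [es [h1 h2 h3]] := regular_edges hreg.
  have e := @act_CK2_additive K E M m (nu, nu) es erefl h1 h2 h3.
  have [f fes hf] : exists2 f, f \in es & dg (fsnoc nu f) m <> 0.
    apply: contrapT => hn; apply: m0; rewrite -hnu [LHS]e big_seq big1 // => f fes.
    by apply: contrapT => hf; apply: hn; exists f.
  have h : frng nu = fsrc (fedge f) by move: fes; rewrite h3 => /eqP <-.
  by exists f, h; rewrite -(fsnocE h); exact: nz.
exists x => nu; split=> [/hx//|hn].
have [/hx//|h0] := hm nu.
by rewrite -[LHS]vert_ghostact -ghost_path -/(dg nu m) h0 ghostact0.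
Qed.

Definition stable_span k (W : set M) : Prop :=
  [/\ exists2 m, W m & m <> 0, forall m n, W m -> W n -> W (m + n),
      forall a m, W m -> W (a *: m), forall nu m, W m -> W (dg nu m) &
      exists b : 'I_k -> M, forall m, W m -> exists c : 'I_k -> K,
        m = \sum_i c i *: b i].

(** Over a minimal nonzero subspace stable under the commuting idempotents
    [nu nu^*], each of them is 0 or 1: otherwise its image would be a smaller
    one. *)
Lemma stable_span_min k W : stable_span k W ->
  (forall j V, stable_span j V -> (k <= j)%N) ->
  forall nu, (forall m, W m -> dg nu m = m) \/ (forall m, W m -> dg nu m = 0).
Proof.
move=> [_ WD WZ Wdg [b hb]] kmin nu; apply: contrapT => /not_orP[].
move=> /existsNP[u0 /not_implyP[Wu0 hu0]] /existsNP[w0 /not_implyP[Ww0 hw0]].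
pose u := u0 - dg nu u0.
have Wu : W u by apply: WD => //; rewrite -scaleN1r; apply/WZ/Wdg.
have du : dg nu u = 0 by rewrite dgB dg_idem subrr.
have u_neq0 : u <> 0 by move=> /eqP; rewrite subr_eq0 => /eqP h; apply: hu0.
have [c uc] := hb _ Wu.
have [j cj] : exists j, c j != 0.
  apply: contrapT => hn; apply: u_neq0; rewrite uc big1 // => i _.
  case: (eqVneq (c i) 0) => [->|h]; first by rewrite scale0r.
  by case: hn; exists i.
case: k b c uc j cj hb kmin => [|k] b c uc j cj hb kmin; first by case: j cj.
suff /kmin : stable_span k [set m | W m /\ dg nu m = m] by rewrite ltnn.
split.
- exists (dg nu w0) => //; split; [exact: Wdg | exact: dg_idem].
- by move=> m n [Wm dm] [Wn dn]; split; [exact: WD | rewrite dgD dm dn].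
- by move=> a m [Wm dm]; split; [exact: WZ | rewrite dgZ dm].
- by move=> mu m [Wm dm]; split; [exact: Wdg | rewrite dgC dm].
(* modulo [u], which [nu nu^*] kills, [b j] is a combination of the others *)
exists (fun i => dg nu (b (lift j i))) => m [Wm dm]; have [d md] := hb _ Wm.
exists (fun i => d (lift j i) - d j / c j * c (lift j i)).
have : dg nu (m - (d j / c j) *: u) = m by rewrite dgB dgZ du scaler0 subr0.
move=> <-; rewrite {1}md uc scaler_sumr -sumrB dg_sum (bigD1_ord j) //=.
rewrite scalerA divfK // subrr dg0 add0r; apply: eq_bigr => i _.
by rewrite scalerA -scalerBl dgZ.
Qed.

Lemma finite_dim_localized : lfinite_dim M -> lnonzero M ->
  exists x (m : M), localized x m /\ m <> 0.
Proof.
move=> [n [b hb]] [m0 hm0].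
pose P k := `[< exists W, stable_span k W >].
have exP : exists k, P k.
  exists n; apply/asboolP; exists setT; split=> //; first by exists m0.
  by exists b => m _; exact: hb.
case: (ex_minnP exP) => k /asboolP[W hW] kmin.
have [[w Ww w0] _ _ _ _] := hW.
have [|x hx] := localized_of_dg w0; last by exists x, w.
move=> nu; have [|h|h] := stable_span_min hW _ nu.
- by move=> j V hV; apply/kmin/asboolP; exists V.
- by left; exact: h.
- by right; exact: h.
Qed.

End DiagonalOperators.

Section FiniteDim.
Variables (K : fieldType) (E : digraph).

Lemma lfinite_dim_fin (M : lmodule K E) (I : finType) (b : I -> M) :
  (forall m, exists c : I -> K, m = \sum_i c i *: b i) -> lfinite_dim M.
Proof.
move=> h; exists #|I|, (fun i => b (enum_val i)) => m; have [c ->] := h m.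
exists (fun i => c (enum_val i)).
by rewrite (reindex (@enum_val I I)) //; apply: onW_bij; exact: enum_val_bij.
Qed.

Lemma lisom_finite_dim (M N : lmodule K E) : lisom M N -> lfinite_dim M ->
  lfinite_dim N.
Proof.
move=> [f [[g fK gK] _]] [n [b hb]]; exists n, (fun i => f (b i)) => m.
have [c hc] := hb (g m); exists c; rewrite -[LHS]gK hc linear_sum.
by apply: eq_bigr => i _; rewrite linearZ.
Qed.

(** Every path tail-equivalent to [x] also has a nonzero vector supported at it,
    and these vectors are independent. *)
Lemma finite_dim_class (M : lmodule K E) x : lfinite_dim M ->
  (exists2 m : M, localized x m & m <> 0) -> finite_set [set q | tail_equiv x q].
Proof.
move=> [n [b hb]] [m0 hm0 m00]; apply: contrapT => /(infinite_set_fset n.+1)[S SA hS].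
have hq (q : bpath E) : {m : M | tail_equiv x q -> localized q m /\ m <> 0}.
  apply: cid; have [h|h] := pselect (tail_equiv x q); last by exists 0.
  by have [m h1 h2] := loc_tail_equiv h hm0 m00; exists m.
pose s := enum_fset S; pose N := size s.
have nN : (n < N)%N by [].
pose q0 (i : 'I_N) := nth x s i.
have tq i : tail_equiv x (q0 i) by apply: SA; rewrite /= /q0 mem_nth.
pose v (i : 'I_N) := sval (hq (q0 i)).
have lv i : localized (q0 i) (v i) by rewrite /v; case: (hq _) => m /= /(_ (tq i))[].
have v0 i : v i <> 0 by rewrite /v; case: (hq _) => m /= /(_ (tq i))[].
have co i : {c : 'I_n -> K | v i = \sum_j c j *: b j} by apply: cid; exact: hb.
pose A : 'M[K]_(N, n) := \matrix_(i, j) sval (co i) j.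
have : kermx A != 0.
  rewrite kermx_eq0 /row_free neq_ltn; apply/orP; left.
  exact: leq_ltn_trans (rank_leq_col A) nN.
move=> /rowV0Pn[u /sub_kermxP uA u0].
have sum0 : \sum_(i <- enum 'I_N) u 0 i *: v i = 0.
  rewrite big_enum /=.
  transitivity (\sum_j (u *m A) 0 j *: b j); last first.
    by rewrite uA big1 // => j _; rewrite mxE scale0r.
  rewrite (eq_bigr (fun j => \sum_i (u 0 i * sval (co i) j) *: b j)); last first.
    by move=> j _; rewrite mxE scaler_suml; apply: eq_bigr => i _; rewrite mxE.
  rewrite exchange_big /=; apply: eq_bigr => i _.
  rewrite {1}(svalP (co i)) scaler_sumr; apply: eq_bigr => j _.
  by rewrite scalerA.
case/eqP: u0; apply/rowP => i; rewrite mxE.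
have := @independent K E M _ (enum 'I_N) q0 (fun i => u 0 i *: v i) (q0 i) _ sum0.
rewrite big_enum_cond (eq_bigl (fun j => j == i)); last first.
  by move=> j; rewrite /= nth_uniq // fset_uniq.
rewrite big_pred1_eq => h; have /eqP : u 0 i *: v i = 0 by apply: h => j; exact: locZ.
by rewrite scaler_eq0 => /orP[/eqP|/eqP/v0].
Qed.

Section WeightedFinite.
Variables (F : fieldType) (phi : {rmorphism K -> F}) (x : bpath E).
Variables (w : edge E -> bpath E -> F) (hw : forall e q, w e q != 0).
Local Notation W := (Defs.restrict phi (weighted_chen x hw)).

Lemma weighted_finite_dim n (b : 'I_n -> F) :
  (forall l, exists c : 'I_n -> K, l = \sum_i phi (c i) * b i) ->
  finite_set [set q | tail_equiv x q] -> lfinite_dim W.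
Proof.
move=> hb /finite_seqP[s hs].
have inS (q : bclass x) : bval q \in s.
  by have : [set` s] (bval q) by rewrite -hs; exact: bvalP.
pose v (i : 'I_(size s) * 'I_n) : W :=
  if pselect (tail_equiv x (nth x s i.1)) is left h
  then bas phi hw (BClass h) (b i.2) else 0.
apply: (@lfinite_dim_fin W _ v) => m; rewrite (wexpand m).
elim/big_rec: _ => [|q g _ [c ->]].
  by exists (fun=> 0); rewrite big1 // => i _; rewrite scale0r.
have [d ->] := hb (mcoeff q m).
have hi : (index (bval q) s < size s)%N by rewrite index_mem.
exists (fun i => c i + (if i.1 == Ordinal hi then d i.2 else 0)).
rewrite addrC; under [RHS]eq_bigr => i _ do rewrite scalerDl.
rewrite big_split /=; congr (_ + _).
rewrite -(pair_bigA _ (fun i j => (if i == Ordinal hi then d j else 0) *: v (i, j))) /=.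
rewrite (bigD1 (Ordinal hi)) //= [X in _ = _ + X]big1 ?addr0; last first.
  by move=> i /negPf ->; apply: big1 => j _; rewrite scale0r.
rewrite eqxx; elim/big_rec2: _ => [|j y1 y2 _ <-]; first exact: bas0.
rewrite basD -basZ; congr (_ *: _ + _).
rewrite /v /= ; case: pselect => [h|]; last by rewrite nth_index //; case; exact: bvalP.
by congr bas; apply: bclass_ext => /=; rewrite nth_index.
Qed.
End WeightedFinite.

Lemma chen_finite_dim (x : bpath E) : finite_set [set q | tail_equiv x q] ->
  lfinite_dim (chen K x).
Proof.
move=> h; apply: (lisom_finite_dim (chen_restrict K x)).
apply: (@weighted_finite_dim _ _ _ _ _ 1 (fun=> 1)) h => l.
by exists (fun=> l); rewrite big_ord1 mulr1.
Qed.

Lemma chen_poly_finite_dim (c : cpath E) (f : lpoly K) :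
  finite_set [set q | tail_equiv (cinf c) q] -> lfinite_dim (chen_poly c f).
Proof.
apply: (@weighted_finite_dim _ _ _ _ _ (size (mk_monic f)).-1
  (fun i => in_qpoly f 'X^i : lpfield f)) => l.
exists (fun i => (val l : {poly K})`_i).
have e : l = in_qpoly f (val l) :> lpfield f.
  apply: val_inj; apply: esym; apply: (@in_qpoly_small K f (val l)).
  exact: size_mk_monic.
have lE : val l = \sum_(i < (size (mk_monic f)).-1) (val l)`_i *: 'X^i :> {poly K}.
  rewrite -(poly_def _ (nth 0 (val l))); apply/polyP => i; rewrite coef_poly.
  case: ltnP => // hi; apply: nth_default; apply: leq_trans hi.
  exact: size_npoly.
rewrite {1}e {1}lE linear_sum; apply: eq_bigr => i _.
by rewrite linearZ /= mulr_algl.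
Qed.

End FiniteDim.
(** * Finite tail-equivalence classes *)
Section FiniteClasses.
Variable E : digraph.
Implicit Types (c d : cpath E) (mu nu eta : finpath E) (x y p q : bpath E).
Local Notation cls x := [set q | tail_equiv x q].

Lemma finite_of_inj (T U : Type) (A : set T) (B : set U) (f : T -> U) :
  (forall a, A a -> B (f a)) ->
  (forall a b, A a -> A b -> f a = f b -> a = b) -> finite_set B -> finite_set A.
Proof.
move=> fAB finj fB; have [[a0 Aa0]|hA] := pselect (exists a, A a); last first.
  rewrite (_ : A = set0); first exact: finite_set0.
  by apply/seteqP; split=> // a Aa; apply: hA; exists a.
pose g u := if pselect (exists2 a, A a & f a = u) is left h then sval (cid2 h) else a0.
apply: (@sub_finite_set _ _ (g @` B)); last exact: finite_image.
move=> a Aa; exists (f a); first exact: fAB.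
rewrite /g; case: pselect => [h|[]]; last by exists a.
by case: (cid2 h) => b /= Ab; exact: finj.
Qed.

Lemma finite_class_eq x y : tail_equiv x y -> finite_set (cls x) -> finite_set (cls y).
Proof.
move=> xy; apply: sub_finite_set => q /=; exact: tail_equiv_trans.
Qed.

Lemma nat_not_inj (U : Type) (B : set U) (f : nat -> U) :
  finite_set B -> (forall i, B (f i)) -> exists i j, (i < j)%N /\ f i = f j.
Proof.
move=> fB hf; apply: contrapT => hn; apply: infinite_nat.
apply: (finite_of_inj (f := f) _ _ fB) => [i _|i j _ _ fij]; first exact: hf.
by case: (ltngtP i j) => // h; case: hn; [exists i, j | exists j, i].
Qed.

(** The paths [eta^k y] cannot all be distinct when the class of [y] is finite,
    and [y = eta^r y] with [r > 0] forces [y = eta^oo]. *)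
Lemma pump y eta : finite_set (cls y) -> frng eta = fsrc eta -> bsrc y = fsrc eta ->
  concat eta y y.
Proof.
move=> fy hc hy; have [h0|h0] := posnP (flen eta).
  rewrite (_ : eta = fvert (bsrc y)); first exact: concat_vert.
  by apply: finpath_ext; [rewrite hy | exact: size0nil].
have [c ec] := cpath_of hc h0.
have st z : {z' | bsrc z = fsrc eta -> concat eta z z'}.
  apply: cid; have [h|h] := pselect (bsrc z = fsrc eta); last by exists z.
  by have [|z' hz] := @concat_ex E eta z; [rewrite hc | exists z'].
pose f z := sval (st z).
have fE z : bsrc z = fsrc eta -> concat eta z (f z) by exact: (svalP (st z)).
have fs k : bsrc (iter k f y) = fsrc eta.
  by elim: k => //= k IH; case: (fE _ IH).
have fk k : tail_equiv y (iter k f y).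
  elim: k => [|k IH]; first exact: tail_equiv_refl.
  apply: tail_equiv_trans IH (tail_equiv_sym _).
  exact: tail_equiv_concat (fE _ (fs k)).
have [i0 [j0 [ij0 e0]]] := nat_not_inj fy fk.
have [r r0 hr] : exists2 r, (0 < r)%N & iter r f y = y.
  elim: i0 j0 ij0 e0 => [|i IH] [|j] // ij e; first by exists j.+1.
  apply: (IH j ij); apply: concat_inj (fE _ (fs i)) _.
  by rewrite -[f _]/(iter i.+1 f y) e; exact: fE.
have hk k : iter (k * r) f y = y by elim: k => // k IH; rewrite mulSn iterD IH.
have agree k i : (i < k * flen eta)%N ->
    bedge (iter k f y) i = bedge (cinf c) i.
  elim: k i => // k IH i; rewrite mulSn iterS => hi.
  have [_ _ ->] := fE _ (fs k); have := concat_cfp c; rewrite ec => -[_ _ ->].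
  by case: ltnP => // h; apply: IH; rewrite ltn_subLR.
have -> : y = cinf c; last by rewrite -ec; exact: concat_cfp.
apply: bpath_ext_inf => i; rewrite -[X in bedge X i](hk i.+1) agree //.
by rewrite (leq_trans (ltnSn i)) // -mulnA leq_pmulr // muln_gt0 r0.
Qed.

(** The shifts of an irrational path are pairwise distinct. *)
Lemma irrational_class x : irrational x -> ~ finite_set (cls x).
Proof.
move=> [[y xy] hr] fx; subst x.
have [|i [j [ij e]]] := nat_not_inj (f := fun a => BInf (shift y a)) fx.
  by move=> a; have [mu _] := shift_prefix y a; exact: tail_equiv_concat.
have [mu hmu h1] := shift_prefix y i; have [nu hnu h2] := shift_prefix y j.
have emn : mu = nu.
  apply: (rational_iso erefl hr); exists (BInf (shift y i)) => //=.
  by rewrite e.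
by move: ij; rewrite -hmu -hnu emn ltnn.
Qed.

Section SingularVertex.
Variables (v : vertex E) (hv : singular v).
Local Notation x := (bvert hv).

Lemma bvert_class q : tail_equiv x q -> exists nu, concat nu x q.
Proof.
move=> [k [mu [nu [p [h1 h2 _]]]]]; exists nu; rewrite -(_ : p = x) //.
have e : mu = fvert (fsrc mu) by apply: finpath_ext => //; exact: size0nil (concat_bvert h1).
by move: h1; rewrite e => /concat_vertE[].
Qed.

Lemma bvert_concat_inj mu nu q : concat mu x q -> concat nu x q -> mu = nu.
Proof.
have le u w : concat u x q -> concat w x q -> (flen u <= flen w)%N -> u = w.
  move=> h1 h2 hl.
  have [eta [h e]] := bprefix_comp (ex_intro _ x h1) (ex_intro _ x h2) hl.
  apply: (concat_same_len h1 h2); rewrite e flen_fcat.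
  rewrite (@concat_bvert E v hv eta x) ?addn0 //.
  by apply/(concat_fcatE h x h1); rewrite -e.
move=> h1 h2; have [hl|/ltnW hl] := leqP (flen mu) (flen nu); first exact: le.
by apply/esym/le.
Qed.

Lemma bvert_class_finite :
  finite_set [set mu : finpath E | frng mu = v] <-> finite_set (cls x).
Proof.
have ex mu : {q | frng mu = v -> concat mu x q}.
  apply: cid; have [h|h] := pselect (frng mu = v); last by exists x.
  by have [q hq] := @concat_ex E mu x h; exists q.
split=> [fv|].
  apply: (@sub_finite_set _ _ ((fun mu => sval (ex mu)) @` [set mu | frng mu = v])).
    move=> q /bvert_class[nu hq]; have hn : frng nu = v by case: hq.
    by exists nu => //; apply: concat_fun (svalP (ex nu) hn) hq.
  exact: finite_image.
apply: (finite_of_inj (f := fun mu => sval (ex mu))) => [mu hmu|mu nu hmu hnu e].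
  exact: tail_equiv_sym (tail_equiv_concat (svalP (ex mu) hmu)).
apply: bvert_concat_inj (svalP (ex mu) hmu) _; rewrite e.
exact: (svalP (ex nu) hnu).
Qed.

End SingularVertex.

Section InfinitePower.
Variables (c : cpath E).
Local Notation x := (cinf c).
Local Notation entries := [set mu : finpath E | frng mu = csrc c /\ ~ ends_with mu c].

Lemma cinf_class q : tail_equiv x q -> exists nu, concat nu x q.
Proof.
move=> [k [mu [nu [p [h1 h2 _]]]]].
have [theta ht] : exists theta, concat theta x p.
  have hpi i : bedge p i = Some (cinf_edge c (flen mu + i)).
    by rewrite -(concat_shift i h1).
  have [y py] : exists y : ipath E, p = BInf y.
    case: p hpi {h1 h2} => [y|rho hrho] hpi; first by exists y.
    have := hpi (flen rho); rewrite /= onth_default //.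
  (* this length completes [mu] to a whole number of turns *)
  have [theta ht1 ht2] := shift_prefix y (flen mu * clen c - flen mu).
  exists theta; rewrite py; move: ht2; congr (concat _ _ _).
  apply: esym; apply: bpath_ext_inf => i /=.
  have := hpi (flen mu * clen c - flen mu + i)%N; rewrite py /= => -[->].
  rewrite -(cinf_edgeDM c (flen mu) i); congr (Some (cinf_edge c _)).
  have : (flen mu <= flen mu * clen c)%N by rewrite leq_pmulr // clen_gt0.
  lia.
have h : frng nu = fsrc theta by case: h2 => -> _ _; case: ht => _ ->.
by exists (fcat h); exact: concat_fcat ht h2.
Qed.

Lemma ends_withP mu : frng mu = csrc c -> ends_with mu c <->
  exists nu (h : frng nu = fsrc (cfp c)), mu = fcat h.
Proof.
move=> hmu; split=> [[s hs]|[nu [h ->]]]; last by exists (fedges nu).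
have := fwalk mu; rewrite hs walk_cat => /andP[hw /= /andP[/eqP he _]].
have h : frng (FPath hw) = fsrc (cfp c) by rewrite /frng /= -he.
by exists (FPath hw), h; apply: finpath_ext.
Qed.

(** Removing powers of [c] from the end of [nu] writes each path tail-equivalent
    to [c^oo] as [nu c^oo] with [nu] not ending with [c]. *)
Lemma cinf_class_entry q : tail_equiv x q -> exists2 nu, entries nu & concat nu x q.
Proof.
move=> /cinf_class[nu]; have [n] := ubnP (flen nu).
elim: n nu => // n IH nu hn hq; have hr : frng nu = csrc c by case: hq.
have [he|he] := pselect (ends_with nu c); last by exists nu.
have [mu [h e]] := (ends_withP hr).1 he; subst nu.
have [y hy] := bprefix_fcatl (ex_intro (fun p => concat _ p q) x hq).
have hyx := (concat_fcatE h x hy).1 hq.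
apply: (IH mu); last by rewrite -(concat_fun hyx (concat_cfp c)).
rewrite -ltnS; apply: leq_trans hn; rewrite ltnS flen_fcat.
by rewrite -{1}(addn0 (flen mu)) ltn_add2l.
Qed.

(** If [nu = mu eta] is longer, then [eta c^oo = c^oo], so [eta] is a power of [c] and
    [nu] ends with [c]. *)
Lemma entry_inj mu nu q : simple_closed c -> entries mu -> entries nu ->
  concat mu x q -> concat nu x q -> mu = nu.
Proof.
move=> sc; have lt u w : entries w -> concat u x q -> concat w x q ->
    ~ (flen u < flen w)%N.
  move=> [hw hne] h1 h2 hl; apply: hne.
  have [eta [h e]] := bprefix_comp (ex_intro _ x h1) (ex_intro _ x h2) (ltnW hl).
  have he : concat eta x x by apply/(concat_fcatE h x h1); rewrite -e.
  have hi : isotropic x (fvert (bsrc x), eta) by exists x => //; exact: concat_vert.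
  have := cinf_iso_dvd sc hi (leq0n _); rewrite subn0 => /dvdnP[[|k] hk].
    by move: hl; rewrite e flen_fcat hk addn0 ltnn.
  (* only the path [theta = c^k] matters here, not the field *)
  have [theta [t1 t2 _]] := cpow_exists 'F_2 c k.
  have ht : frng theta = fsrc (cfp c) by case: t2.
  have ee : eta = fcat ht.
    apply: (concat_same_len he (concat_fcat ht (concat_cfp c) t2)).
    by rewrite flen_fcat t1 hk mulSn addnC.
  have ef : fedges eta = fedges theta ++ cedges c by rewrite ee.
  by exists (fedges u ++ fedges theta); rewrite e /= ef catA.
move=> e1 e2 h1 h2; apply: (concat_same_len h1 h2).
by case: (ltngtP (flen mu) (flen nu)) => // hl; [case: (lt mu nu) | case: (lt nu mu)].
Qed.

Lemma cinf_class_finite : simple_closed c ->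
  finite_set entries <-> finite_set (cls x).
Proof.
move=> sc; have ex mu : {q | frng mu = csrc c -> concat mu x q}.
  apply: cid; have [h|h] := pselect (frng mu = csrc c); last by exists x.
  by have [q hq] := @concat_ex E mu x h; exists q.
split=> [fv|].
  apply: (@sub_finite_set _ _ ((fun mu => sval (ex mu)) @` entries)).
    move=> q /cinf_class_entry[nu en hq]; exists nu => //.
    exact: concat_fun (svalP (ex nu) en.1) hq.
  exact: finite_image.
apply: (finite_of_inj (f := fun mu => sval (ex mu))) => [mu [hmu _]|mu nu hmu hnu e].
  exact: tail_equiv_sym (tail_equiv_concat (svalP (ex mu) hmu)).
apply: (entry_inj sc hmu hnu (svalP (ex mu) hmu.1)); rewrite e.
exact: (svalP (ex nu) hnu.1).
Qed.

(** Any closed path from which [c] can be reached has infinite power in the class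
    of [c^oo] by [pump]; this applies to the closed part of [c] between two visits
    of a vertex, which is too short, and to the cycles leading to [c]. *)
Lemma finite_class_maximal : simple_closed c -> finite_set (cls x) -> maximal_cycle c.
Proof.
move=> sc fx; split.
  rewrite /is_cycle; apply: contrapT => /negP/(uniqPn (csrc c))[i [j [ij]]].
  rewrite size_map -/(clen c) => jn.
  have -> : nth (csrc c) (map (@src E) (cedges c)) i = src (cinf_edge c i).
    by rewrite (nth_map (chead c)) ?(ltn_trans ij) // /cinf_edge modn_small // (ltn_trans ij).
  have -> : nth (csrc c) (map (@src E) (cedges c)) j = src (cinf_edge c j).
    by rewrite (nth_map (chead c)) // /cinf_edge modn_small.
  move=> eij; pose y := IPath (@cinf_walk E c).
  have [mu _ hmu] := shift_prefix y i.
  have [eta he1 he2] := shift_prefix (shift y i) (j - i).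
  have h1 : fsrc eta = src (cinf_edge c i) by case: he2 => _ <- _ /=; rewrite addn0.
  have h2 : frng eta = src (cinf_edge c j).
    by case: he2 => -> _ _ /=; rewrite addn0 subnKC // ltnW.
  have hp : concat eta (BInf (shift y i)) (BInf (shift y i)).
    apply: pump; [|by rewrite h1 h2 eij|by case: he2 => _ ->].
    exact: finite_class_eq (tail_equiv_concat hmu) fx.
  have /dvdn_leq : (clen c %| j - i)%N.
    apply: (shift_period_dvd sc (ltnW ij)) => k.
    have := concat_shift k hp; rewrite he1 /= => -[<-].
    by rewrite addnA subnKC // ltnW.
  rewrite subn_gt0 ij => /(_ isT); rewrite leqNgt => /negP; apply.
  exact: leq_ltn_trans (leq_subr _ _) jn.
move=> d hd hrot [mu [h1 h2]]; apply: hrot.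
have [y hy] : exists y, concat mu x y by exact: concat_ex.
have xy := tail_equiv_sym (tail_equiv_concat hy).
have hp : concat (cfp d) y y.
  apply: pump (finite_class_eq xy fx) (frng_cfp d) _.
  by case: hy => _ -> _; rewrite h1.
apply: (cinf_rotation sc (cycle_simple hd)).
by rewrite -(fixed_cinf hp).
Qed.

End InfinitePower.

End FiniteClasses.

(** * The classification *)
Section Classification.
Variables (E : digraph) (K : fieldType).
Implicit Types (x y : bpath E) (c d : cpath E) (f g : lpoly K) (M : lmodule K E).

Lemma tail_equiv_inf x y : tail_equiv x y -> (exists z, x = BInf z) ->
  exists z, y = BInf z.
Proof.
move=> [k [mu [nu [p [h1 h2 _]]]]] [z xz]; subst x.
case: y h2 => [y|rho hrho] h2; first by exists y.
have := concat_shift (flen rho) h2; have := concat_shift (flen rho) h1.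
rewrite /= => <-; rewrite onth_default // /flen; exact: leq_addl.
Qed.

Lemma irrational_equiv x y : tail_equiv x y -> irrational x -> irrational y.
Proof.
move=> xy [hx hr]; have hy := tail_equiv_inf xy hx; split=> // -[_ [c hc]].
by apply: hr; split=> //; exists c; exact: tail_equiv_trans xy hc.
Qed.

Lemma bvert_not_inf x : singular_vertex x ->
  ~ exists z, x = BInf z.
Proof. by move=> [u [hu ->]] []. Qed.

Lemma singular_vertex_eq x y : singular_vertex x -> singular_vertex y ->
  tail_equiv x y -> x = y.
Proof.
move=> [u [hu ->]] [v [hv ->]] [k [mu [nu [p [h1 h2 _]]]]].
have vert rho w (hw : singular w) : concat rho p (bvert hw) -> p = bvert hw.
  move=> h; have e : rho = fvert (fsrc rho).
    by apply: finpath_ext => //; exact: size0nil (concat_bvert h).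
  by move: h; rewrite e => /concat_vertE[].
by rewrite -(vert _ _ _ h1) -(vert _ _ _ h2).
Qed.

Lemma nonrational_iso x mu nu : irrational x \/ singular_vertex x ->
  isotropic x (mu, nu) -> mu = nu.
Proof.
move=> [[[y xy] hr]|hx] hi; first exact: rational_iso xy hr hi.
exact: vertex_iso hx hi.
Qed.

Lemma chen_recognition M x (m : M) : lsimple M -> localized x m -> m <> 0 ->
  irrational x \/ singular_vertex x -> lisom M (chen K x).
Proof.
move=> sM hm m0 hx; have [n hn n0] := chen_loc K x.
apply: (nonrational_lisom _ sM (chen_simple K x) hm hn m0 n0) => mu nu.
exact: nonrational_iso.
Qed.

Lemma chen_poly_recognition M c f (m : M) : simple_closed c -> lsimple M ->
  localized (cinf c) m -> m <> 0 -> pact c f m = 0 -> lisom M (chen_poly c f).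
Proof.
move=> sc sM hm m0 fm; have [n [hn n0] fn] := chen_poly_ann f sc.
apply: (rational_lisom sc _ sM (chen_poly_simple f sc) hm hn m0 n0 fm fn).
by case: (lp_irr f).
Qed.

(** An isomorphism matches the boundary paths at which vectors are supported and
    the polynomials in [c] that annihilate such vectors. *)
Lemma chen_poly_iso c d f g : simple_closed c -> simple_closed d ->
  lisom (chen_poly c f) (chen_poly d g) <-> rotation c d /\ f = g :> {poly K}.
Proof.
move=> sc sd; split=> [iso|[rot fg]].
  have rot : rotation c d.
    apply: cinf_rotation => //; apply: tail_equiv_sym.
    exact: (chen_poly_loc_class (lisom_loc iso (chen_poly_loc c f))).
  split=> //; have [m [hm m0] gm] := chen_poly_ann g sd.
  have [n [hn n0] gn] := rotation_pact rot hm m0 gm.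
  have [n' [hn' n'0] fn'] := lisom_pact iso (chen_poly_ann f sc).
  exact: rational_poly_uniq sc (chen_poly_simple g sd) hn' hn n'0 n0 fn' gn.
have efg : f = g.
  case: f g fg => [f f1 f2] [g g1 g2] /= fg; subst g.
  by rewrite (Prop_irrelevance f1 g1) (bool_irrelevance f2 g2).
subst g; have [m [hm m0] fm] := chen_poly_ann f sd.
have [n [hn n0] fn] := rotation_pact rot hm m0 fm.
apply: lisom_sym; exact: (chen_poly_recognition sc (chen_poly_simple f sd) hn n0 fn).
Qed.

Lemma chen_chen_poly x c f : irrational x \/ singular_vertex x ->
  simple_closed c -> ~ lisom (chen K x) (chen_poly c f).
Proof.
move=> hx sc iso.
have cx : tail_equiv (cinf c) x.
  exact: (chen_poly_loc_class (lisom_loc iso (chen_loc K x))).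
have xi : exists z, x = BInf z by apply: tail_equiv_inf cx _; exists (IPath (@cinf_walk E c)).
case: hx => [[_ hr]|/bvert_not_inf//]; apply: hr.
by split=> //; exists c; exact: tail_equiv_sym.
Qed.

(** A rational path is tail-equivalent to [c^oo] for a simple closed path [c], and a
    finite boundary path to its last vertex. *)
Lemma spectral_simple_cases M : spectral M -> lsimple M ->
  (exists2 x, irrational x \/ singular_vertex x & exists2 m : M, localized x m & m <> 0) \/
  (exists2 c, simple_closed c & exists f, lisom M (chen_poly c f)).
Proof.
move=> /spectralE[x [m [hm m0]]] sM.
have [[hx [c0 hc0]]|hr] := pselect (rational x).
  right; have [c sc ec] := root_exists c0; exists c => //; rewrite -ec in hc0.
  have [n hn n0] := loc_tail_equiv hc0 hm m0.
  have [f [k [hk k0] fk]] := rational_poly sc sM hn n0.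
  by exists f; exact: chen_poly_recognition sc sM hk k0 fk.
left; case: x hm hr => [y|mu hmu] hm hr.
  by exists (BInf y); [left; split=> //; exists y | exists m].
exists (bvert hmu); first by right; exists (frng mu), hmu.
apply: loc_tail_equiv hm m0; apply: (@tail_equiv_concat _ mu).
split=> // i /=; case: ltnP => // hi; rewrite onth_default //.
by rewrite onth0n.
Qed.

End Classification.

Theorem theorem4p26 (E : digraph) (K : fieldType) (D : set (bpath E))
  (D_sub : forall x, D x -> irrational x \/ singular_vertex x)
  (D_singular : forall x, singular_vertex x -> D x)
  (D_irrational : forall x, irrational x ->
    exists! y, [/\ D y, irrational y & tail_equiv x y]) :
  ([/\ (* the members of the list are spectral simple modules *)
       (forall x, D x -> spectral (chen K x) /\ lsimple (chen K x)),
       (forall (c : cpath E) (f : lpoly K), simple_closed c ->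
          spectral (chen_poly c f) /\ lsimple (chen_poly c f)),
       (* they are pairwise non-isomorphic, c being taken up to rotation *)
       [/\ (forall x y, D x -> D y -> lisom (chen K x) (chen K y) -> x = y),
           (forall x (c : cpath E) (f : lpoly K), D x -> simple_closed c ->
              ~ lisom (chen K x) (chen_poly c f)) &
           (forall (c d : cpath E) (f g : lpoly K),
              simple_closed c -> simple_closed d ->
              (lisom (chen_poly c f) (chen_poly d g) <->
               rotation c d /\ lp_poly f = lp_poly g))] &
       (* every spectral simple module is isomorphic to one of them *)
       (forall M : lmodule K E, spectral M -> lsimple M ->
          (exists2 x, D x & lisom M (chen K x)) \/
          (exists2 c : cpath E, simple_closed c &
             exists f : lpoly K, lisom M (chen_poly c f)))])
  /\
  (* the finite-dimensional simple modules *)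
  (forall M : lmodule K E,
     (lsimple M /\ lfinite_dim M) <->
     (exists (v : vertex E) (hv : singular v),
        finite_set [set mu : finpath E | frng mu = v] /\
        lisom M (chen K (bvert hv))) \/
     (exists (c : cpath E) (f : lpoly K),
        [/\ simple_closed c, maximal_cycle c,
            finite_set [set mu : finpath E |
              frng mu = csrc c /\ ~ ends_with mu c] &
            lisom M (chen_poly c f)])).
Proof.

have classD (M : lmodule K E) : spectral M -> lsimple M ->
    (exists2 x, D x & lisom M (chen K x)) \/
    (exists2 c : cpath E, simple_closed c & exists f : lpoly K, lisom M (chen_poly c f)).
  move=> hM sM; have [[x hx [m hm m0]]|] := spectral_simple_cases hM sM; last by right.
  left; have [y [Dy xy]] : exists y, D y /\ tail_equiv x y.
    case: hx => [/D_irrational[y [[Dy _ xy] _]]|/D_singular Dx]; first by exists y.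
    by exists x; split=> //; exact: tail_equiv_refl.
  exists y => //; have [n hn n0] := loc_tail_equiv xy hm m0.
  exact: chen_recognition sM hn n0 (D_sub _ Dy).
split.
  split=> //.
  - by move=> x _; split; [exact: chen_spectral | exact: chen_simple].
  - by move=> c f sc; split; [exact: chen_poly_spectral | exact: chen_poly_simple].
  split=> [x y Dx Dy iso|x c f Dx|c d f g sc sd]; last exact: chen_poly_iso.
    have xy : tail_equiv x y.
      exact/tail_equiv_sym/(chen_loc_class (lisom_loc iso (chen_loc K x))).
    have [irr|sx] := D_sub _ Dx.
      have [z [_ uz]] := D_irrational _ irr.
      rewrite -(uz x); last by split=> //; exact: tail_equiv_refl.
      by apply: uz; split=> //; exact: irrational_equiv xy irr.
    have [[yi _]|sy] := D_sub _ Dy; last exact: singular_vertex_eq.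
    by case: (bvert_not_inf sx); exact: tail_equiv_inf (tail_equiv_sym xy) yi.
  by apply: chen_chen_poly; exact: D_sub.
move=> M; split=> [[sM fM]|].
  have hM : spectral M by apply/spectralE/finite_dim_localized => //; case: sM.
  have fin x (N : lmodule K E) : lisom M N ->
      (exists2 n : N, localized x n & n <> 0) -> finite_set [set q | tail_equiv x q].
    by move=> iso hN; apply: (finite_dim_class fM); exact: lisom_loc (lisom_sym iso) hN.
  have [[x Dx iso]|[c sc [f iso]]] := classD M hM sM.
    have fx := fin _ _ iso (chen_loc K x); left.
    have [irr|[v [hv xv]]] := D_sub _ Dx; first by case: (irrational_class irr fx).
    by subst x; exists v, hv; split=> //; exact/bvert_class_finite.
  have fx := fin _ _ iso (chen_poly_loc c f); right; exists c, f; split=> //.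
    exact: finite_class_maximal.
  exact/cinf_class_finite.
move=> [[v [hv [fv /lisom_sym iso]]]|[c [f [sc _ fc /lisom_sym iso]]]]; split.
- exact: lisom_simple iso (chen_simple K _).
- by apply: (lisom_finite_dim iso); apply/chen_finite_dim/bvert_class_finite.
- exact: lisom_simple iso (chen_poly_simple f sc).
- by apply: (lisom_finite_dim iso); apply/chen_poly_finite_dim/cinf_class_finite.
Qed.
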